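(* Let $\mathcal{A}$ be an abelian category satisfying conditions (a)--(e) of the context, and let $\chi$ be a map from $\mathrm{Iso}(\mathcal{C}(\mathcal{P}))\times \mathrm{Iso}(\mathcal{C}(\mathcal{P}))$ to $\mathbb{Z}$ (or $\mathbb{C}$) satisfying condition ($\chi$) of the context. Then the tuple $(\mathcal{DH}(\mathcal{A}),\Delta'_{\chi},\epsilon)$ is a topological counital coassociative coalgebra over $\mathbb{C}$.
   Context: $\mathfrak{k}=\mathbb{F}_q$ is a finite field, $t=\sqrt q$ is a fixed square root of $q$. Conditions on an abelian category $\mathcal{A}$: (a) essentially small with finite morphism spaces; (b) $\mathfrak{k}$-linear; (c) of finite global dimension with enough projectives; (d) hereditary, i.e. of global dimension at most 1; (e) nonzero objects have nonzero classes in the Grothendieck group $K(\mathcal{A})$. $\widehat{M}\in K(\mathcal{A})$ is the class of $M$; $\mathcal{P}\subset\mathcal{A}$ is the subcategory of projectives; $\mathrm{Iso}$ denotes the set of isomorphism classes. Complexes: $\mathcal{C}(\mathcal{A})$ is the abelian category of $\mathbb{Z}/2\mathbb{Z}$-graded complexes $M_\bullet=(M_1,M_0;\ d_1:M_1\to M_0,\ d_0:M_0\to M_1)$ with $d_{i+1}d_i=0$ (indices mod 2), with morphisms the degreewise maps commuting with differentials; $\mathcal{C}(\mathcal{P})$ is the full subcategory of complexes of projectives. $H_i(M_\bullet)=\mathrm{Ker}\,d_i/\mathrm{Im}\,d_{i+1}$; acyclic means $H_0=H_1=0$. Algebra: $\mathcal{H}(\mathcal{C}(\mathcal{P}))$ is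 the $\mathbb{C}$-vector space with basis $[M_\bullet]$, $M_\bullet\in\mathrm{Iso}(\mathcal{C}(\mathcal{P}))$. $\mathcal{H}_{\rm tw}(\mathcal{C}(\mathcal{P}))$ is this space with product $$[M_\bullet]*[N_\bullet]=t^{\langle M_0,N_0\rangle+\langle M_1,N_1\rangle}\sum_{L_\bullet}\frac{|\mathrm{Ext}^1_{\mathcal{C}(\mathcal{A})}(M_\bullet,N_\bullet)_{L_\bullet}|}{|\mathrm{Hom}_{\mathcal{C}(\mathcal{A})}(M_\bullet,N_\bullet)|}[L_\bullet],$$ where $\langle A,B\rangle=\sum_i(-1)^i\dim_{\mathfrak{k}}\mathrm{Ext}^i_{\mathcal{A}}(A,B)$ and $\mathrm{Ext}^1(M_\bullet,N_\bullet)_{L_\bullet}$ is the set of classes of extensions $0\to N_\bullet\to L'\to M_\bullet\to0$ with $L'\cong L_\bullet$. $\mathcal{DH}(\mathcal{A})$ is the (Ore) localization of $\mathcal{H}_{\rm tw}(\mathcal{C}(\mathcal{P}))$ inverting all $[M_\bullet]$ with $M_\bullet$ acyclic; its product is again denoted $*$. For $P\in\mathcal{P}$ let $K_{P\bullet}$ be the complex with $M_1=M_0=P$, $d_1=\mathrm{Id}$, $d_0=0$, and $K_{P\bullet}^*$ the complex with $M_1=M_0=P$, $d_1=0$, $d_0=-\mathrm{Id}$. For $\alpha=\widehat P-\widehat Q\in K(\mathcal{A})$ with $P,Q\in\mathcal{P}$ put $K_\alpha=[K_{P\bullet}]*[K_{Q\bullet}]^{-1}$, $K^*_\alpha=[K^*_{P\bullet}]*[K^*_{Q\bullet}]^{-1}$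 (well defined). $\mathcal{DH}(\mathcal{A})$ has a $\mathbb{C}$-basis consisting of the elements $[N_\bullet]*K_\alpha*K_\beta^*$, where $N_\bullet$ runs over isomorphism classes of objects of $\mathcal{C}(\mathcal{P})$ with no nonzero acyclic direct summand and $\alpha,\beta\in K(\mathcal{A})$. Condition ($\chi$): for objects of $\mathcal{C}(\mathcal{P})$, if $\widehat{M_i}=\widehat{P_i}+\widehat{Q_i}$ and $\widehat{R_i}=\widehat{Q_i}+\widehat{N_i}$ for $i=0,1$, then $\chi(M_\bullet,N_\bullet)+\chi(P_\bullet,Q_\bullet)=\chi(P_\bullet,R_\bullet)+\chi(Q_\bullet,N_\bullet)$. $\mathcal{E}_0$ is the class of short exact sequences $0\to N_\bullet\to L_\bullet\to M_\bullet\to0$ in $\mathcal{C}(\mathcal{P})$ such that $H_i(M_\bullet)\ne0\Rightarrow H_{i+1}(N_\bullet)=0$ for both $i=0,1$. $W^{L_\bullet}_{M_\bullet,N_\bullet}$ is the set of equivalence classes of extensions (elements of $\mathrm{Ext}^1_{\mathcal{C}(\mathcal{A})}(M_\bullet,N_\bullet)_{L_\bullet}$) whose sequences $N_\bullet\to L_\bullet\to M_\bullet$ lie in $\mathcal{E}_0$. With $a_{X}=|\mathrm{Aut}_{\mathcal{C}(\mathcal{A})}(X)|$, put $$\Delta'_{\chi,\mathcal{E}_0}([L_\bullet])=\sum_{M_\bullet,N_\bullet}t^{\chi(M_\bullet,N_\bullet)}\frac{|W^{L_\bullet}_{M_\bullet,N_\bullet}|}{|\mathrm{Hom}_{\mathcal{C}(\mathcal{A})}(M_\bullet,N_\bullet)|}\,\frac{a_{L_\bullet}}{a_{M_\bullet}a_{N_\bullet}}\,[M_\bullet]\otimes[N_\bullet].$$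 $\mathcal{DH}(\mathcal{A})\widehat\otimes\mathcal{DH}(\mathcal{A})$ is the completed tensor product over $\mathbb{C}$ (formal, possibly infinite, linear combinations of tensors of basis elements), with $(x\otimes y)*(z\otimes w)=(x*z)\otimes(y*w)$. The linear maps $\Delta'_\chi:\mathcal{DH}(\mathcal{A})\to\mathcal{DH}(\mathcal{A})\widehat\otimes\mathcal{DH}(\mathcal{A})$ and $\epsilon:\mathcal{DH}(\mathcal{A})\to\mathbb{C}$ are defined on the $\mathbb{C}$-basis of $\mathcal{DH}(\mathcal{A})$ consisting of the elements $[N_\bullet]*K_\alpha*K_\beta^*$ (with $N_\bullet$ running over isomorphism classes of objects of $\mathcal{C}(\mathcal{P})$ with no nonzero acyclic direct summand, and $\alpha,\beta\in K(\mathcal{A})$) by $$\Delta'_\chi([N_\bullet]*K_\alpha*K_\beta^* )=\Delta'_{\chi,\mathcal{E}_0}([N_\bullet])*(K_\alpha\otimes K_\alpha)*(K^*_\beta\otimes K^*_\beta),\qquad \epsilon([N_\bullet]*K_\alpha*K_\beta^* )=\delta_{N_\bullet,0}.$$ ''Topological'' coassociativity means coassociativity in the completed triple tensor product.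
   Formalization: The counit axioms are proved only when t^{χ(0,0)} = 1, which they force: the constant map χ = 1 satisfies (χ), but then (ε⊗1)Δ'_χ([0]) = t[0] ≠ [0]. Coassociativity is proved for every χ satisfying (χ). *)

(* Defs.v *)
From HB Require Import structures.
From mathcomp Require Import all_boot all_order all_algebra finmap.
From mathcomp Require Import all_classical all_reals all_analysis.
From mathcomp Require Import complex.
From mathcomp.multinomials Require Import freeg.

Set Implicit Arguments.
Unset Strict Implicit.
Unset Printing Implicit Defensive.

Import Order.TTheory GRing.Theory Num.Theory.

Local Open Scope classical_set_scope.
Local Open Scope ring_scope.
Local Open Scope quotient_scope.

Reserved Notation "g ∘ f" (at level 40, left associativity).

Definition ncard (T : choiceType) (S : set T) : nat := #|` fset_set S|%fset.

(* Morphism spaces are finite-dimensional over the finite field [k]; for a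
   [k]-linear category this is the same as having finite morphism sets. *)
Record linCat (k : finFieldType) := LinCat {
  ob :> Type;
  hom : ob -> ob -> vectType k;
  idm : forall X, hom X X;
  comp : forall X Y Z, hom Y Z -> hom X Y -> hom X Z;
  compA : forall W X Y Z (h : hom Y Z) (g : hom X Y) (f : hom W X),
    comp h (comp g f) = comp (comp h g) f;
  comp1m : forall X Y (f : hom X Y), comp (idm Y) f = f;
  compm1 : forall X Y (f : hom X Y), comp f (idm X) = f;
  comp_linear_l : forall X Y Z (f : hom X Y),
    linear (fun g : hom Y Z => comp g f);
  comp_linear_r : forall X Y Z (g : hom Y Z),
    linear (fun f : hom X Y => comp g f)
}.

Arguments idm {k l} X.
Arguments comp {k l X Y Z} g f : rename.
Notation "g ∘ f" := (comp g f) : ring_scope.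

HB.instance Definition _ (k : finFieldType) (A : linCat k) :=
  gen_eqMixin (ob A).
HB.instance Definition _ (k : finFieldType) (A : linCat k) :=
  gen_choiceMixin (ob A).

Section CatNotions.
Variables (k : finFieldType) (A : linCat k).
Implicit Types X Y Z W : A.

Lemma comp0m X Y Z (f : hom X Y) : (0 : hom Y Z) ∘ f = 0.
Proof.
have := comp_linear_l f (-1) (0 : hom Y Z) 0.
by rewrite scaler0 addr0 scaleN1r addNr.
Qed.

Lemma compm0 X Y Z (g : hom Y Z) : g ∘ (0 : hom X Y) = 0.
Proof.
have := comp_linear_r g (-1) (0 : hom X Y) 0.
by rewrite scaler0 addr0 scaleN1r addNr.
Qed.

Definition is_iso X Y (f : hom X Y) :=
  exists g : hom Y X, g ∘ f = idm X /\ f ∘ g = idm Y.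

Definition iso X Y := exists f : hom X Y, is_iso f.

Definition mono X Y (f : hom X Y) :=
  forall W (u v : hom W X), f ∘ u = f ∘ v -> u = v.

Definition epi X Y (f : hom X Y) :=
  forall W (u v : hom Y W), u ∘ f = v ∘ f -> u = v.

Definition is_zero X :=
  forall Y, (forall f : hom X Y, f = 0) /\ (forall f : hom Y X, f = 0).

Definition is_kernel X Y (f : hom X Y) K (i : hom K X) :=
  f ∘ i = 0 /\ forall W (u : hom W X), f ∘ u = 0 -> exists! v, i ∘ v = u.

Definition is_cokernel X Y (f : hom X Y) Q (p : hom Y Q) :=
  p ∘ f = 0 /\ forall W (u : hom Y W), u ∘ f = 0 -> exists! v, v ∘ p = u.

Definition short_exact X Y Z (i : hom X Y) (p : hom Y Z) :=
  is_kernel p i /\ is_cokernel i p.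

Definition is_biproduct X1 X2 Y :=
  exists (i1 : hom X1 Y) (i2 : hom X2 Y) (p1 : hom Y X1) (p2 : hom Y X2),
    [/\ p1 ∘ i1 = idm X1, p2 ∘ i2 = idm X2, p1 ∘ i2 = 0, p2 ∘ i1 = 0
      & i1 ∘ p1 + i2 ∘ p2 = idm Y].

Definition direct_summand X Y := exists X', is_biproduct X X' Y.

Record abelian : Prop := Abelian {
  ab_zero : exists Z : A, is_zero Z;
  ab_biproduct : forall X Y, exists Z, is_biproduct X Y Z;
  ab_kernel : forall X Y (f : hom X Y), exists K (i : hom K X), is_kernel f i;
  ab_cokernel : forall X Y (f : hom X Y),
    exists Q (p : hom Y Q), is_cokernel f p;
  ab_mono : forall X Y (f : hom X Y), mono f ->
    exists Z (g : hom Y Z), is_kernel g f;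
  ab_epi : forall X Y (f : hom X Y), epi f ->
    exists Z (g : hom Z X), is_cokernel g f
}.

(* [H] is Ker g / Im f: the cokernel of the map induced by [f] to [Ker g]. *)
Definition is_homology X Y Z (f : hom X Y) (g : hom Y Z) (H : A) :=
  exists K (i : hom K Y) (f' : hom X K) (p : hom K H),
    [/\ is_kernel g i, i ∘ f' = f & is_cokernel f' p].

Definition homology_vanishes X Y Z (f : hom X Y) (g : hom Y Z) :=
  exists2 H, is_homology f g H & is_zero H.

Definition essentially_small :=
  exists (I : Set) (F : I -> A), forall X, exists i, iso X (F i).

Definition projective P :=
  forall X Y (e : hom X Y), epi e ->
  forall f : hom P Y, exists g : hom P X, e ∘ g = f.

Definition enough_projectives :=
  forall X, exists P (e : hom P X), projective P /\ epi e.

(* There is an exact sequence 0 -> P_n -> ... -> P_0 -> X -> 0 with all P_i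
   projective, presented through its successive syzygies. *)
Fixpoint proj_dim_le (n : nat) X : Prop :=
  if n is m.+1 then
    exists K P (i : hom K P) (p : hom P X),
      [/\ projective P, short_exact i p & proj_dim_le m K]
  else projective X.

Definition gl_dim_le (n : nat) := forall X, proj_dim_le n X.

Definition automorphisms X : set (hom X X) := [set f | is_iso f].

Record extension (M N : A) := Extension {
  ext_mid : A;
  ext_inc : hom N ext_mid;
  ext_proj : hom ext_mid M;
  ext_exact : short_exact ext_inc ext_proj
}.

HB.instance Definition _ M N := gen_eqMixin (extension M N).
HB.instance Definition _ M N := gen_choiceMixin (extension M N).

Definition extension_equivb M N : rel (extension M N) := fun E E' =>
  `[< exists f : hom (ext_mid E) (ext_mid E'),
        [/\ is_iso f, f ∘ ext_inc E = ext_inc E'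
          & ext_proj E' ∘ f = ext_proj E] >].

Lemma extension_equivb_refl M N : reflexive (@extension_equivb M N).
Proof.
move=> E; apply/asboolP; exists (idm _); split; last 2 first.
- exact: comp1m.
- exact: compm1.
by exists (idm _); rewrite comp1m.
Qed.

Lemma extension_equivb_sym M N : symmetric (@extension_equivb M N).
Proof.
suff H E E' : @extension_equivb M N E E' -> extension_equivb E' E.
  by move=> E E'; apply/idP/idP; exact: H.
move=> /asboolP [f [[g [gf fg]] fi pf]]; apply/asboolP; exists g; split.
- by exists f.
- by rewrite -fi compA gf comp1m.
- by rewrite -pf -compA fg compm1.
Qed.

Lemma is_iso_comp X Y Z (g : hom Y Z) (f : hom X Y) :
  is_iso g -> is_iso f -> is_iso (g ∘ f).
Proof.
move=> [g' [g'g gg']] [f' [f'f ff']]; exists (f' ∘ g'); split.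
  by rewrite -compA (compA g' g f) g'g comp1m.
by rewrite -compA (compA f f' g') ff' comp1m.
Qed.

Lemma extension_equivb_trans M N : transitive (@extension_equivb M N).
Proof.
move=> E2 E1 E3 /asboolP [f [fi fa fb]] /asboolP [g [gi ga gb]].
apply/asboolP; exists (g ∘ f); split.
- exact: is_iso_comp.
- by rewrite -compA fa.
- by rewrite compA gb.
Qed.

Canonical extension_equiv M N := EquivRel (@extension_equivb M N)
  (@extension_equivb_refl M N) (@extension_equivb_sym M N)
  (@extension_equivb_trans M N).

Definition Ext1 M N := {eq_quot (@extension_equiv M N)}.

HB.instance Definition _ M N := Choice.on (Ext1 M N).

Definition Ext1_mid M N L : set (Ext1 M N) :=
  [set xi | iso (ext_mid (repr xi)) L].

Record proj_resolution X := ProjResolution {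
  res_ob : nat -> A;
  res_d : forall n, hom (res_ob n.+1) (res_ob n);
  res_aug : hom (res_ob 0) X;
  res_projective : forall n, projective (res_ob n);
  res_aug_coker : is_cokernel (res_d 0) res_aug;
  res_exact : forall n, homology_vanishes (res_d n.+1) (res_d n)
}.

Definition coboundary X (r : proj_resolution X) Y (n : nat) :
    'Hom(hom (res_ob r n) Y, hom (res_ob r n.+1) Y) :=
  linfun (fun f : hom (res_ob r n) Y => f ∘ res_d r n).

(* dim Ext^n(X, Y) = dim H^n(Hom(P, Y)) for the projective resolution P = r. *)
Definition ext_dim X (r : proj_resolution X) Y (n : nat) : nat :=
  (\dim (lker (coboundary r Y n)) -
   (if n is m.+1 then \dim (limg (coboundary r Y m)) else 0))%N.

Definition euler X Y : int :=
  xget 0 [set \sum_(n \in [set: nat]) (-1) ^+ n * (ext_dim r Y n)%:Z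
         | r in [set: proj_resolution X]].

Definition K0_relator (x : {freeg A / int}) :=
  exists X Y Z (i : hom X Y) (p : hom Y Z),
    short_exact i p /\ x = << Y >> - << X >> - << Z >>.

Inductive K0_rel : {freeg A / int} -> Prop :=
| K0_rel0 : K0_rel 0
| K0_relB x y : K0_rel x -> K0_rel y -> K0_rel (x - y)
| K0_rel_gen x : K0_relator x -> K0_rel x.

Definition K0_relb : {pred {freeg A / int}} := fun x => `[< K0_rel x >].

Lemma K0_relb_closed : zmod_closed K0_relb.
Proof.
split; first by apply/asboolP; exact: K0_rel0.
by move=> x y /asboolP hx /asboolP hy; apply/asboolP; exact: K0_relB.
Qed.

HB.instance Definition _ :=
  GRing.isZmodClosed.Build {freeg A / int} K0_relb K0_relb_closed.

Definition K0 : zmodType := @Quotient.quot {freeg A / int} K0_relb.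

Definition K0_class X : K0 := \pi_(@Quotient.quot {freeg A / int} K0_relb) << X >>.

End CatNotions.

Section Complexes.
Variables (k : finFieldType) (A : linCat k).

Record cplx := Cplx {
  c1 : A;
  c0 : A;
  d1 : hom c1 c0;
  d0 : hom c0 c1;
  d0d1 : d0 ∘ d1 = 0;
  d1d0 : d1 ∘ d0 = 0
}.

Definition cplx_pair (M N : cplx) : vectType k :=
  (hom (c1 M) (c1 N) * hom (c0 M) (c0 N))%type.

Definition chain_defect (M N : cplx) (f : cplx_pair M N) :
    (hom (c1 M) (c0 N) * hom (c0 M) (c1 N))%type :=
  (d1 N ∘ f.1 - f.2 ∘ d1 M, d0 N ∘ f.2 - f.1 ∘ d0 M).

Lemma chain_defect_linear M N : linear (@chain_defect M N).
Proof.
move=> a f g; rewrite /chain_defect /= !comp_linear_r !comp_linear_l.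
by congr pair; rewrite /= scalerBr opprD addrACA.
Qed.

HB.instance Definition _ M N := GRing.isLinear.Build k (cplx_pair M N)
  (hom (c1 M) (c0 N) * hom (c0 M) (c1 N))%type _ (@chain_defect M N)
  (@chain_defect_linear M N).

Definition chain_maps (M N : cplx) : {vspace cplx_pair M N} :=
  lker (linfun (@chain_defect M N)).

Lemma chain_mapsP M N (f : cplx_pair M N) :
  reflect (d1 N ∘ f.1 = f.2 ∘ d1 M /\ d0 N ∘ f.2 = f.1 ∘ d0 M)
          (f \in chain_maps M N).
Proof.
rewrite memv_ker lfunE /=; apply: (iffP eqP) => [[/subr0_eq -> /subr0_eq ->] //|].
by case=> e1 e2; rewrite /chain_defect e1 e2 !subrr.
Qed.

Definition chom (M N : cplx) : vectType k := subvs_of (chain_maps M N).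

Lemma cidm_subproof M : (idm (c1 M), idm (c0 M)) \in chain_maps M M.
Proof. by apply/chain_mapsP; rewrite /= !comp1m !compm1. Qed.

Definition cidm M : chom M M := Subvs (cidm_subproof M).

Lemma ccomp_subproof L M N (g : chom M N) (f : chom L M) :
  ((vsval g).1 ∘ (vsval f).1, (vsval g).2 ∘ (vsval f).2) \in chain_maps L N.
Proof.
case: g f => [[g1 g0] /= /chain_mapsP /= [g10 g01]].
case=> [[f1 f0] /= /chain_mapsP /= [f10 f01]].
apply/chain_mapsP => /=; split.
  by rewrite compA g10 -!compA f10.
by rewrite compA g01 -!compA f01.
Qed.

Definition ccomp L M N (g : chom M N) (f : chom L M) : chom L N :=
  Subvs (ccomp_subproof g f).

Lemma ccompA K L M N (h : chom M N) (g : chom L M) (f : chom K L) :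
  ccomp h (ccomp g f) = ccomp (ccomp h g) f.
Proof. by apply: val_inj; rewrite /= !compA. Qed.

Lemma ccomp1m M N (f : chom M N) : ccomp (cidm N) f = f.
Proof. by apply: val_inj; rewrite /= !comp1m; case: (vsval f). Qed.

Lemma ccompm1 M N (f : chom M N) : ccomp f (cidm M) = f.
Proof. by apply: val_inj; rewrite /= !compm1; case: (vsval f). Qed.

Lemma ccomp_linear_l L M N (f : chom L M) :
  linear (fun g : chom M N => ccomp g f).
Proof. by move=> a g h; apply: val_inj; rewrite /= !comp_linear_l. Qed.

Lemma ccomp_linear_r L M N (g : chom M N) :
  linear (fun f : chom L M => ccomp g f).
Proof. by move=> a f h; apply: val_inj; rewrite /= !comp_linear_r. Qed.

Definition cplxCat : linCat k :=
  LinCat ccompA ccomp1m ccompm1 ccomp_linear_l ccomp_linear_r.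

Definition H1_zero (M : cplxCat) := homology_vanishes (d0 M) (d1 M).
Definition H0_zero (M : cplxCat) := homology_vanishes (d1 M) (d0 M).
Definition acyclic (M : cplxCat) := H0_zero M /\ H1_zero M.

Record cplxP := CplxP {
  cplxP_val :> cplxCat;
  cplxP_proj : projective (c1 cplxP_val) /\ projective (c0 cplxP_val)
}.

HB.instance Definition _ := gen_eqMixin cplxP.
HB.instance Definition _ := gen_choiceMixin cplxP.

Definition cplxP_isob : rel cplxP := fun M N => `[< iso M N >].

Lemma cplxP_isob_refl : reflexive cplxP_isob.
Proof.
by move=> M; apply/asboolP; exists (idm _), (idm _); rewrite comp1m.
Qed.

Lemma cplxP_isob_sym : symmetric cplxP_isob.
Proof.
suff H M N : cplxP_isob M N -> cplxP_isob N M by move=> M N; apply/idP/idP; exact: H.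
by move=> /asboolP [f [g [gf fg]]]; apply/asboolP; exists g, f.
Qed.

Lemma cplxP_isob_trans : transitive cplxP_isob.
Proof.
move=> N M L /asboolP [f hf] /asboolP [g hg]; apply/asboolP.
by exists (g ∘ f); exact: is_iso_comp.
Qed.

Canonical cplxP_iso := EquivRel cplxP_isob
  cplxP_isob_refl cplxP_isob_sym cplxP_isob_trans.

Definition IsoCP := {eq_quot cplxP_iso}.

HB.instance Definition _ := Choice.on IsoCP.

Definition iso_class (M : cplxP) : IsoCP := \pi_IsoCP M.

Definition minimal (N : cplxP) :=
  forall X : cplxCat, direct_summand X N -> acyclic X -> is_zero X.

Record projOb := ProjOb { projOb_val :> A; projObP : projective projOb_val }.

Lemma KP_subproof0 (P : A) : (0 : hom P P) ∘ idm P = 0.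
Proof. exact: compm1. Qed.

Lemma KP_subproof1 (P : A) : idm P ∘ (0 : hom P P) = 0.
Proof. exact: comp1m. Qed.

Lemma KPs_subproof0 (P : A) : (- idm P) ∘ (0 : hom P P) = 0.
Proof. exact: compm0. Qed.

Lemma KPs_subproof1 (P : A) : (0 : hom P P) ∘ (- idm P) = 0.
Proof. exact: comp0m. Qed.

Definition KP (P : projOb) : cplxP :=
  @CplxP (@Cplx P P (idm P) 0 (KP_subproof0 P) (KP_subproof1 P))
    (conj (@projObP P) (@projObP P)).

Definition KPs (P : projOb) : cplxP :=
  @CplxP (@Cplx P P 0 (- idm P) (KPs_subproof0 P) (KPs_subproof1 P))
    (conj (@projObP P) (@projObP P)).

Definition inE0 (M N : cplxCat) (E : extension M N) :=
  (~ H0_zero M -> H1_zero N) /\ (~ H1_zero M -> H0_zero N).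

Definition Wset (M N L : cplxCat) : set (Ext1 M N) :=
  [set xi | Ext1_mid L xi /\ inE0 (repr xi)].

End Complexes.

Arguments cplxCat {k} A.
Arguments cplxP {k} A.
Arguments IsoCP {k} A.
Arguments projOb {k} A.
Arguments Wset {k A} M N L.

Section TopologicalCoalgebra.
Variables (F : fieldType) (V : lmodType F) (B : choiceType) (e : B -> V).

Definition expansion (x : V) (c : B -> F) :=
  finite_set [set b | c b != 0] /\ x = \sum_(b \in [set: B]) c b *: e b.

Definition is_basis := forall x, exists! c, expansion x c.

Definition coord (x : V) : B -> F := xget (fun=> 0) [set c | expansion x c].

(* Elements of the completed tensor product V ^⊗ V are represented by their
   coefficients on the tensors [e b ⊗ e b']; likewise for V ^⊗ V ^⊗ V. *)
Definition ctensor2 := B * B -> F.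
Definition ctensor3 := B * B * B -> F.

Definition pure_tensor (x y : V) : ctensor2 :=
  fun p => coord x p.1 * coord y p.2.

(* Continuous extensions of D ⊗ 1 and 1 ⊗ D to V ^⊗ V. *)
Definition tensor_l (D : V -> ctensor2) (u : ctensor2) : ctensor3 :=
  fun p => \sum_(b \in [set: B]) u (b, p.2) * D (e b) p.1.

Definition tensor_r (D : V -> ctensor2) (u : ctensor2) : ctensor3 :=
  fun p => \sum_(b \in [set: B]) u (p.1.1, b) * D (e b) (p.1.2, p.2).

(* The third clause makes the sums defining D ^⊗ 1 and 1 ^⊗ D finite on the
   whole of V ^⊗ V. *)
Definition topological_coassociative (D : V -> ctensor2) :=
  [/\ is_basis,
      forall a x y p, D (a *: x + y) p = a * D x p + D y p,
      forall p, finite_set [set b | D (e b) p != 0]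
    & forall x, tensor_l D (D x) = tensor_r D (D x)].

(* (eps ^⊗ 1) D x = x = (1 ^⊗ eps) D x, both sums being finite coefficientwise. *)
Definition topological_counit (D : V -> ctensor2) (eps : V -> F) :=
  (forall a x y, eps (a *: x + y) = a * eps x + eps y) /\
  forall x b,
    [/\ finite_set [set a | eps (e a) * D x (a, b) != 0],
        \sum_(a \in [set: B]) eps (e a) * D x (a, b) = coord x b,
        finite_set [set a | D x (b, a) * eps (e a) != 0]
      & \sum_(a \in [set: B]) D x (b, a) * eps (e a) = coord x b].

End TopologicalCoalgebra.

(* u * (z ⊗ w), extending (x ⊗ y) * (z ⊗ w) = (x * z) ⊗ (y * w). *)
Definition ctensor_mulr (F : fieldType) (V : algType F) (B : choiceType)
    (e : B -> V) (u : ctensor2 F B) (z w : V) : ctensor2 F B :=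
  fun p => \sum_(b \in [set: B * B]) u b *
    pure_tensor e (e b.1 * z) (e b.2 * w) p.

Definition cexp (R : realType) (z : R[i]) : R[i] :=
  (expR (complex.Re z) * cos (complex.Im z)
   +i* (expR (complex.Re z) * sin (complex.Im z)))%C.

Section HallAlgebra.
Variables (k : finFieldType) (A : linCat k) (R : realType) (t : R[i]).
Local Notation C := R[i].
Local Notation Iso := (IsoCP A).

Definition cobj (M : Iso) : cplxCat A := cplxP_val (repr M).

Definition Htw : lmodType C := {freeg Iso / C}.

Definition bracket (M : cplxP A) : Htw := << iso_class M >>.

Definition hom_card (M N : Iso) : C :=
  (ncard [set: hom (cobj M) (cobj N)])%:R.

Definition hall_coef (M N L : Iso) : C :=
  t ^ (euler (c0 (cobj M)) (c0 (cobj N)) + euler (c1 (cobj M)) (c1 (cobj N))) *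
  ((ncard (@Ext1_mid _ _ (cobj M) (cobj N) (cobj L)))%:R / hom_card M N).

Definition hall_mul_basis (M N : Iso) : Htw :=
  \sum_(L \in [set: Iso]) hall_coef M N L *: (<< L >> : Htw).

Definition hall_mul (x y : Htw) : Htw :=
  fglift (fun M => fglift (hall_mul_basis M) y) x.

(* The multiplicative set generated by the classes of acyclic complexes; it
   contains the unit [0]. *)
Inductive acyclic_monoid : Htw -> Prop :=
| acyclic_gen (M : cplxP A) : acyclic M -> acyclic_monoid (bracket M)
| acyclic_mul s s' : acyclic_monoid s -> acyclic_monoid s' ->
    acyclic_monoid (hall_mul s s').

Record ore_localization (DH : unitAlgType C) (j : {linear Htw -> DH}) : Prop := {
  loc_mul : forall x y, j (hall_mul x y) = j x * j y;
  loc_one : forall Z : cplxP A, is_zero Z -> j (bracket Z) = 1;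
  loc_unit : forall M : cplxP A, acyclic M -> j (bracket M) \is a GRing.unit;
  loc_frac : forall z, exists x s, acyclic_monoid s /\ z = j x / j s;
  loc_ker : forall x,
    j x = 0 <-> exists2 s, acyclic_monoid s & hall_mul x s = 0
}.

End HallAlgebra.

Arguments Htw {k} A R.
Arguments bracket {k A} R M.
Arguments hom_card {k A} R M N.

Section DHCoalgebra.
Variables (k : finFieldType) (A : linCat k) (R : realType).
Local Notation C := R[i].
Local Notation Iso := (IsoCP A).
Variables (DH : unitAlgType C) (j : {linear Htw A R -> DH}).

Definition Kelt (a : K0 A) : DH :=
  xget 0 [set x | exists P Q : projOb A,
    a = K0_class (P : A) - K0_class (Q : A) /\
    x = j (bracket R (KP P)) / j (bracket R (KP Q))].

Definition Kselt (a : K0 A) : DH :=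
  xget 0 [set x | exists P Q : projOb A,
    a = K0_class (P : A) - K0_class (Q : A) /\
    x = j (bracket R (KPs P)) / j (bracket R (KPs Q))].

Definition minIso : choiceType := {N : Iso | `[< minimal (repr N) >]}.

Definition DHindex : choiceType := (minIso * K0 A * K0 A)%type.

Definition DHbasis (b : DHindex) : DH :=
  j << val b.1.1 >> * Kelt b.1.2 * Kselt b.2.

(* [logt] is a logarithm of t; it fixes the meaning of t^z for complex z, and
   t^z is the usual power of t when z is an integer. *)
Variables (logt : C) (chi : Iso -> Iso -> C).

Definition tpow (z : C) : C := cexp (z * logt).

Definition aut_card (M : Iso) : C := (ncard (@automorphisms _ _ (cobj M)))%:R.

Definition Delta_coef (L M N : Iso) : C :=
  tpow (chi M N) *
  ((ncard (Wset (cobj M) (cobj N) (cobj L)))%:R / hom_card R M N) *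
  (aut_card L / (aut_card M * aut_card N)).

Definition Delta_E0 (L : Iso) : ctensor2 C DHindex := fun p =>
  \sum_(MN \in [set: Iso * Iso]) Delta_coef L MN.1 MN.2 *
    pure_tensor DHbasis (j << MN.1 >>) (j << MN.2 >>) p.

Definition Delta_basis (b : DHindex) : ctensor2 C DHindex :=
  ctensor_mulr DHbasis
    (ctensor_mulr DHbasis (Delta_E0 (val b.1.1)) (Kelt b.1.2) (Kelt b.1.2))
    (Kselt b.2) (Kselt b.2).

Definition Delta (x : DH) : ctensor2 C DHindex := fun p =>
  \sum_(b \in [set: DHindex]) coord DHbasis x b * Delta_basis b p.

Definition counit_basis (b : DHindex) : C :=
  if `[< is_zero (cobj (val b.1.1)) >] then 1 else 0.

Definition counit (x : DH) : C :=
  \sum_(b \in [set: DHindex]) coord DHbasis x b * counit_basis b.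

Definition class1 (M : cplxP A) := K0_class (c1 (M : cplxCat A)).
Definition class0 (M : cplxP A) := K0_class (c0 (M : cplxCat A)).

Definition chi_condition :=
  forall M N P Q S : cplxP A,
    class0 M = class0 P + class0 Q -> class1 M = class1 P + class1 Q ->
    class0 S = class0 Q + class0 N -> class1 S = class1 Q + class1 N ->
    chi (iso_class M) (iso_class N) + chi (iso_class P) (iso_class Q) =
    chi (iso_class P) (iso_class S) + chi (iso_class Q) (iso_class N).

(* The normalization t^chi(0,0) = 1 does not follow from [chi_condition], which
   every constant function satisfies.  It is needed for the counit axioms:
   Delta 1 = t^chi(0,0) (1 ⊗ 1) and counit 1 = 1. *)
Definition chi_normalized :=
  forall Z : cplxP A, is_zero Z -> tpow (chi (iso_class Z) (iso_class Z)) = 1.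

End DHCoalgebra.

(* Main.v *)
Require Import Defs.
From HB Require Import structures.
From mathcomp Require Import all_boot all_order all_algebra finmap.
From mathcomp Require Import all_classical all_reals all_analysis.
From mathcomp Require Import complex ring.
From mathcomp.multinomials Require Import freeg.

Import Defs.
Import Order.TTheory GRing.Theory Num.Theory VectorInternalTheory.

Local Open Scope classical_set_scope.
Local Open Scope ring_scope.

Set Implicit Arguments.
Unset Strict Implicit.
Unset Printing Implicit Defensive.

(* Diagrams are chased with maps from projective objects as elements; complexes
   again form an abelian category with enough projectives.

   Basis: an acyclic complex of projectives is KP P + KPs Q, hence contractible,
   and splits off every extension in which it occurs, so multiplying by its class
   only adds a summand, up to a nonzero scalar.  Every complex is a minimal one
   plus an acyclic one, the minimal part is unique by Fitting's lemma, and P, Q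
   are recovered in K_0 from the class of Ker d1.  The elements K_a are well
   defined because P |-> [KP P] extends to an additive function on short exact
   sequences with values in a commutative group of units of DH.

   Coproduct: a minimal complex is an extension of minimal complexes only, so
   Delta only involves tensors [M] K_a K*_b (x) [N] K_a K*_b with the a and b of
   its argument.  By Riedtmann's formula its coefficients count pairs (i, p) of
   short exact sequences, divided by |Aut M| |Aut N|.  Both sides of
   coassociativity then count two-step filtrations of L with subquotients
   M3, M2, M1, presented through L/M3 or through Ker (L -> M1).  For the
   restriction to E0, when E0 holds for (M1, M2) the connecting maps do not
   affect vanishing: H_i of the middle term vanishes iff H_i(M1) and H_i(M2) do.
   So both sides impose E0 on the three pairs (M_i, M_j), i < j, and by the
   condition on chi they carry the same power of t. *)

(** * Categories over a finite field *)

(** Heredity enters because the cycles of a complex of projectives are again projective, which is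
    what splits acyclic complexes. In the localized algebra most products are computed only up to a
    nonzero scalar, which suffices for spanning and independence. The product of [KP P] and [KP Q]
    must be exactly [KP (P + Q)], and likewise for KPs; here t^2 = q makes the twist cancel |Hom|.
    In the resulting basis, right multiplication by K_a (x) K_a and then K*_b (x) K*_b merely
    relabels tensors, so every identity about Delta becomes one between numbers indexed by
    isomorphism classes. Both [ncard] and the sums over infinite index sets return 0 when the set or
    the support is infinite. Hence each count and each exchange of sums carries its own finiteness
    argument. *)

Section LinearCategory.
Variables (k : finFieldType) (B : linCat k).
Implicit Types X Y Z W P Q S : B.

Lemma compDl X Y Z (g h : hom Y Z) (f : hom X Y) :
  (g + h) ∘ f = g ∘ f + h ∘ f.
Proof. by have := comp_linear_l f 1 g h; rewrite !scale1r. Qed.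

Lemma compDr X Y Z (g : hom Y Z) (f h : hom X Y) :
  g ∘ (f + h) = g ∘ f + g ∘ h.
Proof. by have := comp_linear_r g 1 f h; rewrite !scale1r. Qed.

Lemma compNl X Y Z (g : hom Y Z) (f : hom X Y) : (- g) ∘ f = - (g ∘ f).
Proof. by apply/eqP; rewrite -addr_eq0 -compDl addNr comp0m. Qed.

Lemma compNr X Y Z (g : hom Y Z) (f : hom X Y) : g ∘ (- f) = - (g ∘ f).
Proof. by apply/eqP; rewrite -addr_eq0 -compDr addNr compm0. Qed.

Lemma compBl X Y Z (g h : hom Y Z) (f : hom X Y) :
  (g - h) ∘ f = g ∘ f - h ∘ f.
Proof. by rewrite compDl compNl. Qed.

Lemma compBr X Y Z (g : hom Y Z) (f h : hom X Y) :
  g ∘ (f - h) = g ∘ f - g ∘ h.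
Proof. by rewrite compDr compNr. Qed.

Lemma is_zeroE X : is_zero X <-> idm X = 0.
Proof.
split=> [X0|X0 Y]; first exact: (X0 X).1.
split=> f.
  by rewrite -[f]compm1 X0 compm0.
by rewrite -[f]comp1m X0 comp0m.
Qed.

Lemma is_iso_idm X : is_iso (idm X).
Proof. by exists (idm X); rewrite comp1m. Qed.

Lemma iso_sym X Y : iso X Y -> iso Y X.
Proof. by case=> f [g [gf fg]]; exists g, f. Qed.

Lemma iso_trans X Y Z : iso X Y -> iso Y Z -> iso X Z.
Proof. by move=> [f hf] [g hg]; exists (g ∘ f); exact: is_iso_comp. Qed.

Lemma is_zero_iso X Y : iso X Y -> is_zero X -> is_zero Y.
Proof.
move=> [f [g [_ fg]]] /is_zeroE X0; apply/is_zeroE.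
by rewrite -fg -[f]compm1 X0 compm0 comp0m.
Qed.

Lemma zero_iso X Y : is_zero X -> is_zero Y -> iso X Y.
Proof.
move=> /is_zeroE X0 /is_zeroE Y0; exists 0, 0.
by rewrite !comp0m X0 Y0.
Qed.

Lemma is_kernel_mono X Y (f : hom X Y) K (i : hom K X) : is_kernel f i -> mono i.
Proof.
move=> [fi0 iU] W u v iuv.
have [|w [_ wU]] := iU W (i ∘ u); first by rewrite compA fi0 comp0m.
by rewrite -(wU u) // -(wU v).
Qed.

Lemma is_kernel_lift X Y (f : hom X Y) K (i : hom K X) W (u : hom W X) :
  is_kernel f i -> f ∘ u = 0 -> exists v, i ∘ v = u.
Proof. by move=> [_ iU] /iU [v [iv _]]; exists v. Qed.

Lemma is_kernelI X Y (f : hom X Y) K (i : hom K X) :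
  f ∘ i = 0 -> mono i ->
  (forall W (u : hom W X), f ∘ u = 0 -> exists v, i ∘ v = u) -> is_kernel f i.
Proof.
move=> fi0 im iL; split=> // W u /iL [v iv]; exists v; split=> // w iw.
by apply: im; rewrite iv iw.
Qed.

Lemma is_cokernel_epi X Y (f : hom X Y) Q (p : hom Y Q) : is_cokernel f p -> epi p.
Proof.
move=> [pf0 pU] W u v puv.
have [|w [_ wU]] := pU W (u ∘ p); first by rewrite -compA pf0 compm0.
by rewrite -(wU u) // -(wU v).
Qed.

Lemma is_cokernel_desc X Y (f : hom X Y) Q (p : hom Y Q) W (u : hom Y W) :
  is_cokernel f p -> u ∘ f = 0 -> exists v, v ∘ p = u.
Proof. by move=> [_ pU] /pU [v [pv _]]; exists v. Qed.

Lemma is_cokernelI X Y (f : hom X Y) Q (p : hom Y Q) :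
  p ∘ f = 0 -> epi p ->
  (forall W (u : hom Y W), u ∘ f = 0 -> exists v, v ∘ p = u) -> is_cokernel f p.
Proof.
move=> pf0 pe pL; split=> // W u /pL [v pv]; exists v; split=> // w pw.
by apply: pe; rewrite pv pw.
Qed.

Lemma is_kernel_unique X Y (f : hom X Y) K (i : hom K X) K' (i' : hom K' X) :
  is_kernel f i -> is_kernel f i' -> exists2 g : hom K K', is_iso g & i' ∘ g = i.
Proof.
move=> ki ki'.
have [g ig] := is_kernel_lift ki' ki.1.
have [h ih] := is_kernel_lift ki ki'.1.
exists g => //; exists h; split.
  by apply: (is_kernel_mono ki); rewrite compA ih ig compm1.
by apply: (is_kernel_mono ki'); rewrite compA ig ih compm1.
Qed.

Lemma is_cokernel_unique X Y (f : hom X Y) Q (p : hom Y Q) Q' (p' : hom Y Q') :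
  is_cokernel f p -> is_cokernel f p' -> exists2 g : hom Q Q', is_iso g & g ∘ p = p'.
Proof.
move=> kp kp'.
have [g pg] := is_cokernel_desc kp kp'.1.
have [h ph] := is_cokernel_desc kp' kp.1.
exists g => //; exists h; split.
  by apply: (is_cokernel_epi kp); rewrite -compA pg ph comp1m.
by apply: (is_cokernel_epi kp'); rewrite -compA ph pg comp1m.
Qed.

Lemma is_iso_mono X Y (f : hom X Y) : is_iso f -> mono f.
Proof.
by move=> [g [gf _]] W u v fuv; rewrite -[u]comp1m -[v]comp1m -gf -!compA fuv.
Qed.

Lemma is_iso_epi X Y (f : hom X Y) : is_iso f -> epi f.
Proof.
by move=> [g [_ fg]] W u v fuv; rewrite -[u]compm1 -[v]compm1 -fg !compA fuv.
Qed.

Lemma mono0 X Y (f : hom X Y) : (forall W (u : hom W X), f ∘ u = 0 -> u = 0) -> mono f.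
Proof.
by move=> f0 W u v fuv; apply: subr0_eq; apply: f0; rewrite compBr fuv subrr.
Qed.

Lemma epi0 X Y (f : hom X Y) : (forall W (u : hom Y W), u ∘ f = 0 -> u = 0) -> epi f.
Proof.
by move=> f0 W u v fuv; apply: subr0_eq; apply: f0; rewrite compBl fuv subrr.
Qed.

Lemma mono_eq0 X Y (f : hom X Y) W (u : hom W X) : mono f -> f ∘ u = 0 -> u = 0.
Proof. by move=> fm fu; apply: fm; rewrite fu compm0. Qed.

Lemma epi_eq0 X Y (f : hom X Y) W (u : hom Y W) : epi f -> u ∘ f = 0 -> u = 0.
Proof. by move=> fm fu; apply: fm; rewrite fu comp0m. Qed.

Lemma mono_comp X Y Z (g : hom Y Z) (f : hom X Y) : mono g -> mono f -> mono (g ∘ f).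
Proof. by move=> gm fm W u v; rewrite -!compA => /gm /fm. Qed.

Lemma epi_comp X Y Z (g : hom Y Z) (f : hom X Y) : epi g -> epi f -> epi (g ∘ f).
Proof. by move=> gm fm W u v; rewrite !compA => /fm /gm. Qed.

Lemma split_mono X Y (f : hom X Y) (g : hom Y X) : g ∘ f = idm X -> mono f.
Proof. by move=> gf W u v fuv; rewrite -[u]comp1m -[v]comp1m -gf -!compA fuv. Qed.

Lemma split_epi X Y (f : hom X Y) (g : hom Y X) : g ∘ f = idm X -> epi g.
Proof. by move=> gf W u v fuv; rewrite -[u]compm1 -[v]compm1 -gf !compA fuv. Qed.

Lemma projective_retract P Q (i : hom P Q) (p : hom Q P) :
  p ∘ i = idm P -> projective Q -> projective P.
Proof.
move=> pi1 Qp X Y e ee f; have [g eg] := Qp X Y e ee (f ∘ p).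
by exists (g ∘ i); rewrite compA eg -compA pi1 compm1.
Qed.

Lemma projective_biproduct P Q S :
  is_biproduct P Q S -> projective P -> projective Q -> projective S.
Proof.
move=> [i1 [i2 [p1 [p2 [_ _ _ _ e1]]]]] Pp Qp X Y e ee f.
have [g eg] := Pp X Y e ee (f ∘ i1); have [h eh] := Qp X Y e ee (f ∘ i2).
by exists (g ∘ p1 + h ∘ p2); rewrite compDr !compA eg eh -!compA -compDr e1 compm1.
Qed.

Lemma biproduct_sym X Y Z : is_biproduct X Y Z -> is_biproduct Y X Z.
Proof.
move=> [i1 [i2 [p1 [p2 [e1 e2 e3 e4 e5]]]]]; exists i2, i1, p2, p1; split=> //.
by rewrite addrC.
Qed.

Lemma biproduct_iso X Y Z W : is_biproduct X Y Z -> iso Z W -> is_biproduct X Y W.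
Proof.
move=> [i1 [i2 [p1 [p2 [e1 e2 e3 e4 e5]]]]] [f [g [gf fg]]].
exists (f ∘ i1), (f ∘ i2), (p1 ∘ g), (p2 ∘ g).
have E U V (u : hom Z U) (v : hom V Z) : (u ∘ g) ∘ (f ∘ v) = u ∘ v.
  by rewrite -compA (compA g) gf comp1m.
by rewrite !E; split=> //; rewrite -!compA -compDr !compA -compDl e5 comp1m.
Qed.

Lemma biproduct_isol X X' Y Z : iso X X' -> is_biproduct X Y Z -> is_biproduct X' Y Z.
Proof.
move=> [f [g [gf fg]]] [i1 [i2 [p1 [p2 [e1 e2 e3 e4 e5]]]]].
exists (i1 ∘ g), i2, (f ∘ p1), p2; split=> //.
- by rewrite -compA (compA p1) e1 comp1m.
- by rewrite -compA e3 compm0.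
- by rewrite compA e4 comp0m.
- by rewrite -compA (compA g) gf comp1m.
Qed.

Lemma biproduct_isor X Y Y' Z : iso Y Y' -> is_biproduct X Y Z -> is_biproduct X Y' Z.
Proof.
by move=> YY' XYZ; apply: biproduct_sym; apply: (biproduct_isol YY'); apply: biproduct_sym.
Qed.

Lemma biproduct_unique X Y Z W : is_biproduct X Y Z -> is_biproduct X Y W -> iso Z W.
Proof.
move=> [i1 [i2 [p1 [p2 [e1 e2 e3 e4 e5]]]]] [j1 [j2 [q1 [q2 [f1 f2 f3 f4 f5]]]]].
exists (j1 ∘ p1 + j2 ∘ p2), (i1 ∘ q1 + i2 ∘ q2); split.
  rewrite compDl !compDr -!compA !(compA q1) !(compA q2) f1 f2 f3 f4.
  by rewrite !comp1m !comp0m !compm0 addr0 add0r.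
rewrite compDl !compDr -!compA !(compA p1) !(compA p2) e1 e2 e3 e4.
by rewrite !comp1m !comp0m !compm0 addr0 add0r.
Qed.

Lemma biproduct_zerol X Y : is_zero X -> is_biproduct X Y Y.
Proof.
move=> /is_zeroE X0; exists 0, (idm Y), 0, (idm Y).
by split; rewrite ?compm0 ?comp0m ?comp1m ?compm1 ?add0r.
Qed.

Lemma biproduct_short_exact X Y Z : is_biproduct X Y Z ->
  exists (i : hom Y Z) (p : hom Z X), short_exact i p.
Proof.
move=> [i1 [i2 [p1 [p2 [e1 e2 e3 e4 e5]]]]]; exists i2, p1; split.
  apply: is_kernelI => // [|W u pu]; first exact: split_mono e2.
  exists (p2 ∘ u); rewrite -[RHS]comp1m -e5 compDl -!compA pu compm0 add0r //.
apply: is_cokernelI => // [|W u pu]; first exact: split_epi e1.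
by exists (u ∘ i1); rewrite -[RHS]compm1 -e5 compDr !compA pu comp0m addr0.
Qed.

Lemma short_exact_retract X Y Z (i : hom X Y) (p : hom Y Z) (r : hom Y X) :
  short_exact i p -> r ∘ i = idm X ->
  exists s : hom Z Y, [/\ p ∘ s = idm Z, r ∘ s = 0 & s ∘ p + i ∘ r = idm Y].
Proof.
move=> [ki cp] ri.
have [|s sp] := is_cokernel_desc (u := idm Y - i ∘ r) cp.
  by rewrite compBl comp1m -compA ri compm1 subrr.
exists s; split; last by rewrite sp subrK.
  apply: (is_cokernel_epi cp); rewrite -compA sp compBr compm1 compA ki.1 comp0m.
  by rewrite subr0 comp1m.
apply: (is_cokernel_epi cp); rewrite -compA sp compBr compm1 compA ri comp1m.
by rewrite subrr comp0m.
Qed.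

Lemma short_exact_section X Y Z (i : hom X Y) (p : hom Y Z) (s : hom Z Y) :
  short_exact i p -> p ∘ s = idm Z ->
  exists r : hom Y X, [/\ r ∘ i = idm X, r ∘ s = 0 & s ∘ p + i ∘ r = idm Y].
Proof.
move=> [ki cp] ps.
have [|r ir] := is_kernel_lift (u := idm Y - s ∘ p) ki.
  by rewrite compBr compm1 compA ps comp1m subrr.
exists r; split; last by rewrite ir addrC subrK.
  apply: (is_kernel_mono ki); rewrite compA ir compBl comp1m -compA ki.1 compm0.
  by rewrite subr0 compm1.
apply: (is_kernel_mono ki); rewrite compA ir compBl comp1m -compA ps compm1.
by rewrite subrr compm0.
Qed.

Lemma short_exact_split X Y Z (i : hom X Y) (p : hom Y Z) (s : hom Z Y) :
  short_exact i p -> p ∘ s = idm Z -> is_biproduct Z X Y.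
Proof.
move=> ip ps; have [r [e1 e2 e3]] := short_exact_section ip ps.
by exists s, i, p, r; split=> //; exact: ip.1.1.
Qed.

Lemma short_exact_iso X Y Y' Z (i : hom X Y) (p : hom Y Z) (f : hom Y Y') (g : hom Y' Y) :
  g ∘ f = idm Y -> f ∘ g = idm Y' -> short_exact i p -> short_exact (f ∘ i) (p ∘ g).
Proof.
move=> gf fg [ki cp]; split.
  apply: is_kernelI; first by rewrite -compA (compA g) gf comp1m ki.1.
    by apply: mono_comp (is_kernel_mono ki); apply: split_mono gf.
  move=> W u; rewrite -compA => pgu; have [v iv] := is_kernel_lift ki pgu.
  by exists v; rewrite -compA iv compA fg comp1m.
apply: is_cokernelI; first by rewrite -compA (compA g) gf comp1m ki.1.
  by apply: epi_comp (is_cokernel_epi cp) _; apply: split_epi gf.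
move=> W u; rewrite compA => pgu; have [v iv] := is_cokernel_desc cp pgu.
by exists v; rewrite compA iv -compA fg compm1.
Qed.

End LinearCategory.

(** Exactness in the middle phrased by lifting, without images. It agrees with the usual notion in
    an abelian category with enough projectives. *)
Definition exact_at (k : finFieldType) (B : linCat k) (X Y Z : B)
    (f : hom X Y) (g : hom Y Z) :=
  g ∘ f = 0 /\
  forall P (y : hom P Y), projective P -> g ∘ y = 0 -> exists x, f ∘ x = y.

(** * Abelian categories with enough projectives *)

Section AbelianCategory.
Variables (k : finFieldType) (B : linCat k).
Hypotheses (B_ab : abelian B) (B_ep : enough_projectives B).
Implicit Types X Y Z W P Q : B.

Lemma mono_el X Y (f : hom X Y) :
  (forall P (x : hom P X), projective P -> f ∘ x = 0 -> x = 0) -> mono f.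
Proof.
move=> f0; apply: mono0 => W u fu; have [P [e [Pp ee]]] := B_ep W.
by apply: (epi_eq0 ee); apply: f0 => //; rewrite compA fu comp0m.
Qed.

Lemma epi_el X Y (f : hom X Y) :
  (forall P (y : hom P Y), projective P -> exists x, f ∘ x = y) -> epi f.
Proof.
move=> fS; apply: epi0 => W u uf; have [P [e [Pp ee]]] := B_ep Y.
have [x fx] := fS P e Pp.
by apply: (epi_eq0 ee); rewrite -fx compA uf comp0m.
Qed.

(** By [ab_epi], [p] is a cokernel of some [g]. As [g] factors through the kernel [i], a map that
    kills [i] kills [g] and descends along [p]. *)
Lemma epi_is_cokernel X Y Z (p : hom Y Z) (i : hom X Y) :
  epi p -> is_kernel p i -> is_cokernel i p.
Proof.
move=> pe ki; have [W [g cg]] := ab_epi B_ab pe.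
have [w iw] := is_kernel_lift ki cg.1.
apply: is_cokernelI => // [|V u ui]; first exact: ki.1.
by apply: (is_cokernel_desc cg); rewrite -iw compA ui comp0m.
Qed.

Lemma mono_is_kernel X Y Z (i : hom X Y) (p : hom Y Z) :
  mono i -> is_cokernel i p -> is_kernel p i.
Proof.
move=> im cp; have [W [g kg]] := ab_mono B_ab im.
have [w pw] := is_cokernel_desc cp kg.1.
apply: is_kernelI => // [|V u pu]; first exact: cp.1.
by apply: (is_kernel_lift kg); rewrite -pw -compA pu compm0.
Qed.

Lemma mono_epi_is_iso X Y (f : hom X Y) : mono f -> epi f -> is_iso f.
Proof.
move=> fm fe; have [W [g cg]] := ab_epi B_ab fe.
have g0 : g = 0 by apply: (mono_eq0 fm); exact: cg.1.
have [|h hf] := is_cokernel_desc (u := idm X) cg; first by rewrite g0 compm0.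
by exists h; split=> //; apply: fe; rewrite -compA hf compm1 comp1m.
Qed.

(** The comparison map from [X] to a true kernel is mono because [i] is, and epi because elements
    with projective source lift; so it is invertible. *)
Lemma exact_at_kernel X Y Z (i : hom X Y) (p : hom Y Z) :
  mono i -> exact_at i p -> is_kernel p i.
Proof.
move=> im [pi0 ex]; have [K [l kl]] := ab_kernel B_ab p.
have [i0 li0] := is_kernel_lift kl pi0.
have [j [ij ji]] : is_iso i0.
  apply: mono_epi_is_iso.
    by move=> W u v uv; apply: im; rewrite -li0 -!compA uv.
  apply: epi_el => P y Pp; have [|x ix] := ex P (l ∘ y) Pp.
    by rewrite compA kl.1 comp0m.
  by exists x; apply: (is_kernel_mono kl); rewrite compA li0.
apply: is_kernelI => // W u pu; have [v lv] := is_kernel_lift kl pu.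
by exists (j ∘ v); rewrite -li0 -compA (compA i0) ji comp1m.
Qed.

Lemma kernel_exact_at X Y Z (i : hom X Y) (p : hom Y Z) : is_kernel p i -> exact_at i p.
Proof. by move=> ki; split=> [|P y _ /(is_kernel_lift ki) //]; exact: ki.1. Qed.

Lemma short_exactE X Y Z (i : hom X Y) (p : hom Y Z) :
  short_exact i p <-> [/\ mono i, exact_at i p & epi p].
Proof.
split=> [[ki cp]|[im ex pe]].
  split; [exact: is_kernel_mono ki|exact: kernel_exact_at|exact: is_cokernel_epi cp].
have ki := exact_at_kernel im ex.
by split=> //; exact: epi_is_cokernel.
Qed.

Lemma epi_short_exact Y Z (p : hom Y Z) : epi p -> exists X (i : hom X Y), short_exact i p.
Proof.
move=> pe; have [X [i ki]] := ab_kernel B_ab p.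
by exists X, i; split=> //; exact: epi_is_cokernel.
Qed.

Lemma mono_short_exact X Y (i : hom X Y) : mono i -> exists Z (p : hom Y Z), short_exact i p.
Proof.
move=> im; have [Z [p cp]] := ab_cokernel B_ab i.
by exists Z, p; split=> //; exact: mono_is_kernel.
Qed.

Lemma retract_direct_summand X Y (i : hom X Y) (r : hom Y X) :
  r ∘ i = idm X -> direct_summand X Y.
Proof.
move=> ri; have [K [l lr]] := epi_short_exact (split_epi ri).
by exists K; exact: short_exact_split lr ri.
Qed.

Lemma short_exact_id_zero : exists Z : B, is_zero Z /\ forall X,
  short_exact (0 : hom Z X) (idm X).
Proof.
have [Z Z0] := ab_zero B_ab; exists Z; split=> // X; split.
  apply: is_kernelI; first exact: compm0.
    by apply: mono0 => W u _; exact: (Z0 W).2.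
  by move=> W u; rewrite comp1m => ->; exists 0; rewrite compm0.
apply: is_cokernelI; first exact: compm0.
  by apply: split_epi; exact: compm1.
by move=> W u _; exists u; rewrite compm1.
Qed.

(* The two filtrations of L with subquotients M3, M2, M1: the quotient L/M3
   with its subobject M2 against the subobject Ker (L -> M1) containing M3. *)
Lemma noether_sub L M1 M2 M3 X (i : hom M3 L) (p : hom L X) (i' : hom M2 X)
    (p' : hom X M1) :
  short_exact i p -> short_exact i' p' ->
  exists Y (u : hom M3 Y) (v : hom Y M2) (w : hom Y L),
    [/\ short_exact u v, short_exact w (p' ∘ p), w ∘ u = i & i' ∘ v = p ∘ w].
Proof.
move=> /short_exactE [im [pi0 ix] pe] /short_exactE [im' [pi0' ix'] pe'].
have re : epi (p' ∘ p) by exact: epi_comp.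
have [Y [w wr]] := epi_short_exact re; have [kw _] := wr.
have [|u wu] := is_kernel_lift (u := i) kw; first by rewrite -compA pi0 compm0.
have ki' : is_kernel p' i' by exact: exact_at_kernel.
have ki : is_kernel p i by exact: exact_at_kernel.
have [|v iv] := is_kernel_lift (u := p ∘ w) ki'; first by rewrite compA kw.1.
have wm := is_kernel_mono kw.
exists Y, u, v, w; split=> //; apply/short_exactE; split.
- by move=> W a b ab; apply: im; rewrite -wu -!compA ab.
- split=> [|P y Pp vy]; first by apply: im'; rewrite compA iv -compA wu pi0 compm0.
  have [|x ixy] := is_kernel_lift (u := w ∘ y) ki.
    by rewrite compA -iv -compA vy compm0.
  by exists x; apply: wm; rewrite compA wu.
- apply: epi_el => P m Pp; have [l pl] := Pp _ _ _ pe (i' ∘ m).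
  have [|y wy] := is_kernel_lift (u := l) kw.
    by rewrite -compA pl compA pi0' comp0m.
  by exists y; apply: im'; rewrite compA iv -compA wy.
Qed.

Lemma noether_quot L M1 M2 M3 Y (u : hom M3 Y) (v : hom Y M2) (w : hom Y L)
    (r : hom L M1) :
  short_exact u v -> short_exact w r ->
  exists X (p : hom L X) (i' : hom M2 X) (p' : hom X M1),
    [/\ short_exact (w ∘ u) p, short_exact i' p', p' ∘ p = r & i' ∘ v = p ∘ w].
Proof.
move=> uv wr; have [ku cv] := uv; have [kw cr] := wr.
have wm := is_kernel_mono kw.
have um := is_kernel_mono ku.
have re := is_cokernel_epi cr.
have [X [p ip]] := mono_short_exact (mono_comp wm um); have [ki cp] := ip.
have [|p' pp'] := is_cokernel_desc (u := r) cp; first by rewrite compA kw.1 comp0m.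
have [|i' iv'] := is_cokernel_desc (u := p ∘ w) cv; first by rewrite -compA ki.1.
exists X, p, i', p'; split=> //; apply/short_exactE; split.
- apply: mono_el => P m Pp im.
  have [y vy] := Pp _ _ _ (is_cokernel_epi cv) m.
  have [|x ix] := is_kernel_lift (u := w ∘ y) ki.
    by rewrite compA -iv' -compA vy im.
  have -> : m = v ∘ (u ∘ x).
    by rewrite -vy; congr comp; apply: wm; rewrite -ix compA.
  by rewrite compA ku.1 comp0m.
- split.
    apply: (is_cokernel_epi cv); rewrite -compA iv' compA pp' comp0m.
    by rewrite kw.1.
  move=> P x Pp px; have [l pl] := Pp _ _ _ (is_cokernel_epi cp) x.
  have [|y wy] := is_kernel_lift (u := l) kw; first by rewrite -pp' -compA pl.
  by exists (v ∘ y); rewrite compA iv' -compA wy.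
- by move=> W a b ab; apply: re; rewrite -pp' !compA ab.
Qed.

(** Schanuel's lemma. In place of the pullback of [p] and [q], a biproduct of [K] and [Q] is
    exhibited as one of [P] and [K'] by explicit matrices. *)
Lemma schanuel X K P K' Q (i : hom K P) (p : hom P X) (i' : hom K' Q) (q : hom Q X) :
  projective P -> projective Q -> short_exact i p -> short_exact i' q ->
  exists W, is_biproduct K Q W /\ is_biproduct P K' W.
Proof.
move=> Pp Qp [ki cp] [kj cq].
have [s ps] := Qp _ _ _ (is_cokernel_epi cp) q.
have [s' qs] := Pp _ _ _ (is_cokernel_epi cq) p.
have [|a ia] := is_kernel_lift (u := idm P - s ∘ s') ki.
  by rewrite compBr compm1 compA ps qs subrr.
have [|b ib] := is_kernel_lift (u := idm Q - s' ∘ s) kj.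
  by rewrite compBr compm1 compA qs ps subrr.
have [|c ic] := is_kernel_lift (u := s' ∘ i) kj; first by rewrite compA qs ki.1.
have [|c' ic'] := is_kernel_lift (u := s ∘ i') ki; first by rewrite compA ps kj.1.
have im := is_kernel_mono ki; have jm := is_kernel_mono kj.
have [W KQ] := ab_biproduct B_ab K Q; exists W; split=> //.
have [i1 [i2 [p1 [p2 [e1 e2 e3 e4 e5]]]]] := KQ.
(* Here [a] and [b] are 1 - s s' and 1 - s' s viewed as maps into the kernels, and [c], [c'] are the
   restrictions of [s'], [s] to the kernels. [j1], [j2] are the columns and [q1], [q2] the rows of
   mutually inverse 2 by 2 matrices. *)
pose j1 := i1 ∘ a + i2 ∘ s'; pose j2 := i2 ∘ i' - i1 ∘ c'.
pose q1 := i ∘ p1 + s ∘ p2; pose q2 := b ∘ p2 - c ∘ p1.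
have S1 U (f : hom U K) : p1 ∘ (i1 ∘ f) = f by rewrite compA e1 comp1m.
have S2 U (f : hom U Q) : p2 ∘ (i2 ∘ f) = f by rewrite compA e2 comp1m.
have S3 U (f : hom U Q) : p1 ∘ (i2 ∘ f) = 0 by rewrite compA e3 comp0m.
have S4 U (f : hom U K) : p2 ∘ (i1 ∘ f) = 0 by rewrite compA e4 comp0m.
have S := (S1, S2, S3, S4).
exists j1, j2, q1, q2; split.
- rewrite /q1 /j1 compDl !compDr -!compA !S compm0 ?compm0 addr0 add0r.
  by rewrite ia subrK.
- rewrite /q2 /j2 compBl !compBr -!compA !S !compm0 subr0 sub0r opprK.
  apply: jm; rewrite compDr !compA ib ic compBl comp1m compm1 -!compA ic'.
  by rewrite subrK.
- rewrite /q1 /j2 compDl !compBr -!compA !S !compm0 sub0r subr0.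
  by rewrite ic' addNr.
- rewrite /q2 /j1 compBl !compDr -!compA !S !compm0 addr0 add0r.
  apply: jm; rewrite compBr !compA ib ic compm0 compBl comp1m -!compA ia.
  by rewrite compBr compm1 subrr.
- have T1 : a ∘ i + c' ∘ c = idm K.
    apply: im; rewrite compDr !compA ia ic' compBl comp1m -!compA ic.
    by rewrite subrK compm1.
  have T2 : a ∘ s = c' ∘ b.
    apply: im; rewrite !compA ia ic' compBl comp1m -!compA ib.
    by rewrite compBr compm1.
  have T4 : s' ∘ s + i' ∘ b = idm Q by rewrite ib addrC subrK.
  rewrite -e5 -[in RHS](comp1m p1) -[in RHS](comp1m p2) -T1 -T4.
  rewrite /j1 /j2 /q1 /q2 !(compDl, compDr, compBl, compBr) -!compA.
  rewrite (compA a s) T2 (compA s' i) -ic !(compNl, compNr) -!compA opprK.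
  by rewrite (AC ((2*2)*(2*2)) ((1*8)*(4*5)*(2*7)*(3*6))) /= !subrr !addr0.
Qed.

(** Resolve Q/K by K' -> P with both projective. Schanuel's lemma gives K + P isomorphic to Q + K',
    so [K] is a retract of a projective. *)
Lemma hereditary_sub_projective K Q (i : hom K Q) :
  gl_dim_le B 1 -> mono i -> projective Q -> projective K.
Proof.
move=> hB im Qp; have [X [q iq]] := mono_short_exact im.
have [K' [P [j [p [Pp jp K'p]]]]] := hB X.
have [W [PK' KQ]] := schanuel Qp Pp iq jp.
have Wp := projective_biproduct KQ Qp K'p.
by case: PK' => [i1 [_ [p1 [_ [e1 _ _ _ _]]]]]; exact: projective_retract e1 Wp.
Qed.

Lemma hereditary_resolution X : gl_dim_le B 1 ->
  exists K P (i : hom K P) (p : hom P X),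
    [/\ projective K, projective P & short_exact i p].
Proof. by move=> /(_ X) [K [P [i [p [Pp ip Kp]]]]]; exists K, P, i, p. Qed.

End AbelianCategory.

(** * Two-periodic complexes *)

Section ComplexCategory.
Variables (k : finFieldType) (A : linCat k).
Implicit Types M N L : cplxCat A.

Definition ch1 M N (f : hom M N) : hom (c1 M) (c1 N) := (vsval (f : chom M N)).1.
Definition ch0 M N (f : hom M N) : hom (c0 M) (c0 N) := (vsval (f : chom M N)).2.

Lemma ch_d1 M N (f : hom M N) : d1 N ∘ ch1 f = ch0 f ∘ d1 M.
Proof. by have /chain_mapsP [] := valP (f : chom M N). Qed.

Lemma ch_d0 M N (f : hom M N) : d0 N ∘ ch0 f = ch1 f ∘ d0 M.
Proof. by have /chain_mapsP [] := valP (f : chom M N). Qed.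

Lemma ch_ext M N (f g : hom M N) : ch1 f = ch1 g -> ch0 f = ch0 g -> f = g.
Proof.
move=> e1 e0; apply: (@val_inj _ _ (chom M N)); move: e1 e0; rewrite /ch1 /ch0 /=.
by case: (vsval _) => ? ?; case: (vsval _) => ? ? /= -> ->.
Qed.

Definition mkch M N (f1 : hom (c1 M) (c1 N)) (f0 : hom (c0 M) (c0 N))
    (e1 : d1 N ∘ f1 = f0 ∘ d1 M) (e0 : d0 N ∘ f0 = f1 ∘ d0 M) : hom M N :=
  (Subvs (introT (chain_mapsP (f1, f0)) (conj e1 e0)) : chom M N).

Lemma ch1_comp L M N (g : hom M N) (f : hom L M) : ch1 (g ∘ f) = ch1 g ∘ ch1 f.
Proof. by []. Qed.
Lemma ch0_comp L M N (g : hom M N) (f : hom L M) : ch0 (g ∘ f) = ch0 g ∘ ch0 f.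
Proof. by []. Qed.
Lemma ch1_id M : ch1 (idm M) = idm (c1 M). Proof. by []. Qed.
Lemma ch0_id M : ch0 (idm M) = idm (c0 M). Proof. by []. Qed.

Lemma ch1_0 M N : ch1 (0 : hom M N) = 0. Proof. by []. Qed.
Lemma ch0_0 M N : ch0 (0 : hom M N) = 0. Proof. by []. Qed.
Lemma ch1D M N (f g : hom M N) : ch1 (f + g) = ch1 f + ch1 g. Proof. by []. Qed.
Lemma ch0D M N (f g : hom M N) : ch0 (f + g) = ch0 f + ch0 g. Proof. by []. Qed.
End ComplexCategory.

(** * Kernels, cokernels and projectives among complexes *)

Section ComplexAbelian.
Variables (k : finFieldType) (A : linCat k).
Hypotheses (A_ab : abelian A) (A_ep : enough_projectives A).
Implicit Types M N L : cplxCat A.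

Lemma degreewise_kernel K M N (f : hom M N) (i : hom K M) :
  is_kernel (ch1 f) (ch1 i) -> is_kernel (ch0 f) (ch0 i) -> is_kernel f i.
Proof.
move=> k1 k0; apply: is_kernelI.
- by apply: ch_ext; [exact: k1.1 | exact: k0.1].
- move=> W u v uv; apply: ch_ext.
    by apply: (is_kernel_mono k1); rewrite -!ch1_comp uv.
  by apply: (is_kernel_mono k0); rewrite -!ch0_comp uv.
- move=> W u fu.
  have [|v1 e1] := is_kernel_lift (u := ch1 u) k1; first by rewrite -ch1_comp fu.
  have [|v0 e0] := is_kernel_lift (u := ch0 u) k0; first by rewrite -ch0_comp fu.
  have h1 : d1 K ∘ v1 = v0 ∘ d1 W.
    by apply: (is_kernel_mono k0); rewrite !compA -ch_d1 e0 -compA e1 ch_d1.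
  have h0 : d0 K ∘ v0 = v1 ∘ d0 W.
    by apply: (is_kernel_mono k1); rewrite !compA -ch_d0 e1 -compA e0 ch_d0.
  by exists (mkch h1 h0); apply: ch_ext.
Qed.

Lemma degreewise_cokernel Q M N (f : hom M N) (p : hom N Q) :
  is_cokernel (ch1 f) (ch1 p) -> is_cokernel (ch0 f) (ch0 p) -> is_cokernel f p.
Proof.
move=> k1 k0; apply: is_cokernelI.
- by apply: ch_ext; [exact: k1.1 | exact: k0.1].
- move=> W u v uv; apply: ch_ext.
    by apply: (is_cokernel_epi k1); rewrite -!ch1_comp uv.
  by apply: (is_cokernel_epi k0); rewrite -!ch0_comp uv.
- move=> W u fu.
  have [|v1 e1] := is_cokernel_desc (u := ch1 u) k1; first by rewrite -ch1_comp fu.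
  have [|v0 e0] := is_cokernel_desc (u := ch0 u) k0; first by rewrite -ch0_comp fu.
  have h1 : d1 W ∘ v1 = v0 ∘ d1 Q.
    by apply: (is_cokernel_epi k1); rewrite -!compA ch_d1 e1 compA e0 ch_d1.
  have h0 : d0 W ∘ v0 = v1 ∘ d0 Q.
    by apply: (is_cokernel_epi k0); rewrite -!compA ch_d0 e0 compA e1 ch_d0.
  by exists (mkch h1 h0); apply: ch_ext.
Qed.

Lemma cplx_kernel M N (f : hom M N) : exists K (i : hom K M),
  is_kernel (ch1 f) (ch1 i) /\ is_kernel (ch0 f) (ch0 i).
Proof.
have [K1 [i1 k1]] := ab_kernel A_ab (ch1 f).
have [K0 [i0 k0]] := ab_kernel A_ab (ch0 f).
have [|x1 e1] := is_kernel_lift (u := d1 M ∘ i1) k0.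
  by rewrite compA -ch_d1 -compA k1.1 compm0.
have [|x0 e0] := is_kernel_lift (u := d0 M ∘ i0) k1.
  by rewrite compA -ch_d0 -compA k0.1 compm0.
have h1 : x0 ∘ x1 = 0.
  by apply: (is_kernel_mono k1); rewrite compA e0 -compA e1 compA d0d1 comp0m compm0.
have h0 : x1 ∘ x0 = 0.
  by apply: (is_kernel_mono k0); rewrite compA e1 -compA e0 compA d1d0 comp0m compm0.
by exists (Cplx h1 h0 : cplxCat A), (@mkch _ _ (Cplx h1 h0) M i1 i0 (esym e1) (esym e0)).
Qed.

Lemma cplx_cokernel M N (f : hom M N) : exists Q (p : hom N Q),
  is_cokernel (ch1 f) (ch1 p) /\ is_cokernel (ch0 f) (ch0 p).
Proof.
have [Q1 [p1 k1]] := ab_cokernel A_ab (ch1 f).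
have [Q0 [p0 k0]] := ab_cokernel A_ab (ch0 f).
have [|x1 e1] := is_cokernel_desc (u := p0 ∘ d1 N) k1.
  by rewrite -compA ch_d1 compA k0.1 comp0m.
have [|x0 e0] := is_cokernel_desc (u := p1 ∘ d0 N) k0.
  by rewrite -compA ch_d0 compA k1.1 comp0m.
have h1 : x0 ∘ x1 = 0.
  by apply: (is_cokernel_epi k1); rewrite -compA e1 compA e0 -compA d0d1 compm0 comp0m.
have h0 : x1 ∘ x0 = 0.
  by apply: (is_cokernel_epi k0); rewrite -compA e0 compA e1 -compA d1d0 compm0 comp0m.
by exists (Cplx h1 h0 : cplxCat A), (@mkch _ _ N (Cplx h1 h0) p1 p0 e1 e0).
Qed.

Lemma is_iso_degree M N (f : hom M N) : is_iso f -> is_iso (ch1 f) /\ is_iso (ch0 f).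
Proof.
move=> [g [gf fg]]; split.
  by exists (ch1 g); rewrite -!ch1_comp gf fg.
by exists (ch0 g); rewrite -!ch0_comp gf fg.
Qed.

Lemma is_kernel_isor (B : linCat k) (X Y K K' : B) (f : hom X Y) (i : hom K X) (g : hom K' K) :
  is_iso g -> is_kernel f i -> is_kernel f (i ∘ g).
Proof.
move=> gi ki; have [h [hg gh]] := gi; apply: is_kernelI.
- by rewrite compA ki.1 comp0m.
- by apply: mono_comp (is_kernel_mono ki) _; exact: is_iso_mono.
- move=> W u fu; have [v iv] := is_kernel_lift ki fu.
  by exists (h ∘ v); rewrite -compA (compA g) gh comp1m.
Qed.

Lemma is_cokernel_isol (B : linCat k) (X Y Q Q' : B) (f : hom X Y) (p : hom Y Q) (g : hom Q Q') :
  is_iso g -> is_cokernel f p -> is_cokernel f (g ∘ p).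
Proof.
move=> gi ki; have [h [hg gh]] := gi; apply: is_cokernelI.
- by rewrite -compA ki.1 compm0.
- by apply: epi_comp (is_cokernel_epi ki); exact: is_iso_epi.
- move=> W u fu; have [v iv] := is_cokernel_desc ki fu.
  by exists (v ∘ h); rewrite -compA (compA h) hg comp1m.
Qed.

(** Any kernel is isomorphic to the degreewise one built in [cplx_kernel], and isomorphisms of
    complexes are degreewise isomorphisms. *)
Lemma kernel_degreewise K M N (f : hom M N) (i : hom K M) :
  is_kernel f i -> is_kernel (ch1 f) (ch1 i) /\ is_kernel (ch0 f) (ch0 i).
Proof.
move=> ki; have [K' [i' [k1 k0]]] := cplx_kernel f.
have [g gi <-] := is_kernel_unique ki (degreewise_kernel k1 k0).
by have [g1 g0] := is_iso_degree gi; split; apply: is_kernel_isor.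
Qed.

Lemma cokernel_degreewise Q M N (f : hom M N) (p : hom N Q) :
  is_cokernel f p -> is_cokernel (ch1 f) (ch1 p) /\ is_cokernel (ch0 f) (ch0 p).
Proof.
move=> ki; have [Q' [p' [k1 k0]]] := cplx_cokernel f.
have [g gi <-] := is_cokernel_unique (degreewise_cokernel k1 k0) ki.
by have [g1 g0] := is_iso_degree gi; split; apply: is_cokernel_isol.
Qed.

Lemma short_exact_degreewise M N L (i : hom N L) (p : hom L M) :
  short_exact i p <-> short_exact (ch1 i) (ch1 p) /\ short_exact (ch0 i) (ch0 p).
Proof.
split=> [[/kernel_degreewise [k1 k0] /cokernel_degreewise [c1 c0]] //|[[k1 c1] [k0 c0]]].
by split; [exact: degreewise_kernel | exact: degreewise_cokernel].
Qed.

Lemma mono_degreewise M N (f : hom M N) : mono f -> mono (ch1 f) /\ mono (ch0 f).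
Proof.
move=> fm; have [K [i [k1 k0]]] := cplx_kernel f.
have i0 : i = 0 by apply: (mono_eq0 fm); apply: ch_ext; [exact: k1.1|exact: k0.1].
split; apply: mono0 => W u fu.
  by have [v <-] := is_kernel_lift k1 fu; rewrite i0 ch1_0 comp0m.
by have [v <-] := is_kernel_lift k0 fu; rewrite i0 ch0_0 comp0m.
Qed.

Lemma epi_degreewise M N (f : hom M N) : epi f -> epi (ch1 f) /\ epi (ch0 f).
Proof.
move=> fe; have [Q [p [k1 k0]]] := cplx_cokernel f.
have p0 : p = 0 by apply: (epi_eq0 fe); apply: ch_ext; [exact: k1.1|exact: k0.1].
split; apply: epi0 => W u uf.
  by have [v <-] := is_cokernel_desc k1 uf; rewrite p0 ch1_0 compm0.
by have [v <-] := is_cokernel_desc k0 uf; rewrite p0 ch0_0 compm0.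
Qed.

Lemma zero_degreewise M : is_zero M <-> is_zero (c1 M) /\ is_zero (c0 M).
Proof.
rewrite !is_zeroE; split=> [M0|[M1 M0]].
  by rewrite -ch1_id -ch0_id M0.
by apply: ch_ext; [rewrite ch1_id M1|rewrite ch0_id M0].
Qed.

Lemma cplx_biproduct M N : exists L, is_biproduct M N L.
Proof.
have [L1 [i1 [j1 [p1 [q1 [a1 a2 a3 a4 a5]]]]]] := ab_biproduct A_ab (c1 M) (c1 N).
have [L0 [i0 [j0 [p0 [q0 [b1 b2 b3 b4 b5]]]]]] := ab_biproduct A_ab (c0 M) (c0 N).
pose x1 := i0 ∘ d1 M ∘ p1 + j0 ∘ d1 N ∘ q1.
pose x0 := i1 ∘ d0 M ∘ p0 + j1 ∘ d0 N ∘ q0.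
have p0x : p0 ∘ x1 = d1 M ∘ p1 by rewrite compDr !compA b1 b3 comp1m !comp0m addr0.
have q0x : q0 ∘ x1 = d1 N ∘ q1 by rewrite compDr !compA b2 b4 comp1m !comp0m add0r.
have p1x : p1 ∘ x0 = d0 M ∘ p0 by rewrite compDr !compA a1 a3 comp1m !comp0m addr0.
have q1x : q1 ∘ x0 = d0 N ∘ q0 by rewrite compDr !compA a2 a4 comp1m !comp0m add0r.
have xi1 : x1 ∘ i1 = i0 ∘ d1 M by rewrite compDl -!compA a1 a4 compm1 !compm0 addr0.
have xj1 : x1 ∘ j1 = j0 ∘ d1 N by rewrite compDl -!compA a2 a3 compm1 !compm0 add0r.
have xi0 : x0 ∘ i0 = i1 ∘ d0 M by rewrite compDl -!compA b1 b4 compm1 !compm0 addr0.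
have xj0 : x0 ∘ j0 = j1 ∘ d0 N by rewrite compDl -!compA b2 b3 compm1 !compm0 add0r.
have x01 : x0 ∘ x1 = 0.
  rewrite compDl -!compA p0x q0x (compA (d0 M)) (compA (d0 N)) !d0d1.
  by rewrite !comp0m !compm0 addr0.
have x10 : x1 ∘ x0 = 0.
  rewrite compDl -!compA p1x q1x (compA (d1 M)) (compA (d1 N)) !d1d0.
  by rewrite !comp0m !compm0 addr0.
pose L : cplxCat A := Cplx x01 x10.
exists L, (@mkch _ _ M L i1 i0 xi1 xi0), (@mkch _ _ N L j1 j0 xj1 xj0).
exists (@mkch _ _ L M p1 p0 (esym p0x) (esym p1x)).
exists (@mkch _ _ L N q1 q0 (esym q0x) (esym q1x)).
by split; apply: ch_ext.
Qed.

Lemma biproduct_degreewise M N L :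
  is_biproduct M N L -> is_biproduct (c1 M) (c1 N) (c1 L) /\ is_biproduct (c0 M) (c0 N) (c0 L).
Proof.
move=> [i [j [p [q [e1 e2 e3 e4 e5]]]]]; split.
  exists (ch1 i), (ch1 j), (ch1 p), (ch1 q).
  by split; rewrite -!ch1_comp -?ch1D ?e1 ?e2 ?e3 ?e4 ?e5.
exists (ch0 i), (ch0 j), (ch0 p), (ch0 q).
by split; rewrite -!ch0_comp -?ch0D ?e1 ?e2 ?e3 ?e4 ?e5.
Qed.

Lemma abelian_cplx : abelian (cplxCat A).
Proof.
split.
- have [Z Z0] := ab_zero A_ab.
  exists (@Cplx _ A Z Z 0 0 (comp0m _ _) (comp0m _ _) : cplxCat A).
  exact/zero_degreewise.
- exact: cplx_biproduct.
- move=> M N f; have [K [i [k1 k0]]] := cplx_kernel f.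
  by exists K, i; exact: degreewise_kernel.
- move=> M N f; have [K [i [k1 k0]]] := cplx_cokernel f.
  by exists K, i; exact: degreewise_cokernel.
- move=> M N f /mono_degreewise [f1 f0]; have [Q [p [k1 k0]]] := cplx_cokernel f.
  by exists Q, p; apply: degreewise_kernel; apply: mono_is_kernel.
- move=> M N f /epi_degreewise [f1 f0]; have [K [i [k1 k0]]] := cplx_kernel f.
  by exists K, i; apply: degreewise_cokernel; apply: epi_is_cokernel.
Qed.

Lemma KP_map_subproof (P : projOb A) M (a : hom (P : A) (c1 M)) :
  d1 M ∘ a = (d1 M ∘ a) ∘ d1 (KP P : cplxCat A) /\ d0 M ∘ (d1 M ∘ a) = a ∘ d0 (KP P : cplxCat A).
Proof. by rewrite /= compm1 compm0 compA d0d1 comp0m. Qed.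

(** One half of the adjunction Hom(KP P, M) = Hom(P, M_1): since the differential d1 of [KP P] is
    the identity, the degree-zero component is forced. *)
Definition KP_map (P : projOb A) M (a : hom (P : A) (c1 M)) : hom (KP P : cplxCat A) M :=
  @mkch _ _ (KP P : cplxCat A) M a (d1 M ∘ a) (KP_map_subproof a).1 (KP_map_subproof a).2.

Lemma KPs_map_subproof (P : projOb A) M (a : hom (P : A) (c0 M)) :
  d1 M ∘ (- (d0 M ∘ a)) = a ∘ d1 (KPs P : cplxCat A) /\ d0 M ∘ a = (- (d0 M ∘ a)) ∘ d0 (KPs P : cplxCat A).
Proof. by rewrite /= compm0 !compNr compm1 opprK compA d1d0 comp0m oppr0. Qed.

(** The analogue Hom(KPs P, M) = Hom(P, M_0); the sign comes from d0 = -Id in [KPs P]. *)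
Definition KPs_map (P : projOb A) M (a : hom (P : A) (c0 M)) : hom (KPs P : cplxCat A) M :=
  @mkch _ _ (KPs P : cplxCat A) M (- (d0 M ∘ a)) a (KPs_map_subproof a).1 (KPs_map_subproof a).2.

Lemma KP_mapE (P : projOb A) M (f : hom (KP P : cplxCat A) M) : f = KP_map (ch1 f).
Proof.
by apply: ch_ext => //; rewrite -[ch0 f]compm1; exact: esym (ch_d1 f).
Qed.

Lemma KPs_mapE (P : projOb A) M (f : hom (KPs P : cplxCat A) M) : f = KPs_map (ch0 f).
Proof.
apply: ch_ext => //; have := ch_d0 f; rewrite /= compNr compm1 => e.
by rewrite -[ch1 f]opprK -e.
Qed.

Lemma projective_KP (P : projOb A) : projective (KP P : cplxCat A).
Proof.
move=> X Y e /epi_degreewise [e1 e0] f; have [g eg] := @projObP _ _ P _ _ _ e1 (ch1 f).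
exists (KP_map g); apply: ch_ext => //.
rewrite [in RHS](KP_mapE f).
by change (ch0 e ∘ (d1 X ∘ g) = d1 Y ∘ ch1 f); rewrite compA -ch_d1 -compA eg.
Qed.

Lemma projective_KPs (P : projOb A) : projective (KPs P : cplxCat A).
Proof.
move=> X Y e /epi_degreewise [e1 e0] f; have [g eg] := @projObP _ _ P _ _ _ e0 (ch0 f).
exists (KPs_map g); apply: ch_ext => //.
rewrite [in RHS](KPs_mapE f).
change (ch1 e ∘ (- (d0 X ∘ g)) = - (d0 Y ∘ ch0 f)).
by rewrite compNr compA -ch_d0 -compA eg.
Qed.

(** If P1 and P0 cover M_1 and M_0, the sum of KP P1 and KPs P0 covers M: the first summand is
    already onto in degree one, the second in degree zero. *)
Lemma enough_projectives_cplx : enough_projectives (cplxCat A).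
Proof.
move=> M; have [P1 [a1 [P1p a1e]]] := A_ep (c1 M).
have [P0 [a0 [P0p a0e]]] := A_ep (c0 M).
have [L LM] := cplx_biproduct (KP (ProjOb P1p)) (KPs (ProjOb P0p)).
have [i [j [p [q [e1 e2 e3 e4 e5]]]]] := LM.
exists L, (@KP_map (ProjOb P1p) M a1 ∘ p + @KPs_map (ProjOb P0p) M a0 ∘ q); split.
  apply: (projective_biproduct LM); [exact: (projective_KP (P := ProjOb P1p)) | exact: projective_KPs].
apply: epi0 => W u ue.
have u1 : u ∘ @KP_map (ProjOb P1p) M a1 = 0.
  have := f_equal (fun z => z ∘ i) ue.
  by rewrite comp0m -compA compDl -!compA e1 e4 compm0 addr0 compm1.
have u0 : u ∘ @KPs_map (ProjOb P0p) M a0 = 0.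
  have := f_equal (fun z => z ∘ j) ue.
  by rewrite comp0m -compA compDl -!compA e2 e3 compm0 add0r compm1.
apply: ch_ext.
  by apply: (epi_eq0 a1e); exact: (f_equal (@ch1 _ _ _ _) u1).
by apply: (epi_eq0 a0e); exact: (f_equal (@ch0 _ _ _ _) u0).
Qed.

End ComplexAbelian.

(** * Homology and contractible complexes *)

Section Homology.
Variables (k : finFieldType) (A : linCat k).
Hypotheses (A_ab : abelian A) (A_ep : enough_projectives A).
Implicit Types M N L E : cplxCat A.

(** Homology is the cokernel of the induced map from [X] to Ker g; it vanishes exactly when that map
    is epi, which is tested on projectives. *)
Lemma homology_vanishesE (X Y Z : A) (f : hom X Y) (g : hom Y Z) :
  g ∘ f = 0 -> homology_vanishes f g <-> exact_at f g.
Proof.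
move=> gf; split=> [[H [K [i [f' [p [ki if' cp]]]]] H0]|[_ ex]].
  have f'e : epi f'.
    apply: epi0 => W u uf'; have [v <-] := is_cokernel_desc cp uf'.
    by have -> := (H0 W).1 v; rewrite comp0m.
  split=> // P y Pp gy; have [v iv] := is_kernel_lift ki gy.
  by have [x fx] := Pp _ _ _ f'e v; exists x; rewrite -if' -compA fx.
have [K [i ki]] := ab_kernel A_ab g.
have [f' if'] := is_kernel_lift ki gf.
have [H [p cp]] := ab_cokernel A_ab f'.
exists H; first by exists K, i, f', p.
have f'e : epi f'.
  apply: (epi_el A_ep) => P y Pp; have [|x fx] := ex P (i ∘ y) Pp.
    by rewrite compA ki.1 comp0m.
  by exists x; apply: (is_kernel_mono ki); rewrite compA if'.
apply/is_zeroE; apply: (is_cokernel_epi cp).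
by rewrite comp0m comp1m; apply: (epi_eq0 f'e); exact: cp.1.
Qed.

Lemma H0_zeroE M : H0_zero M <-> exact_at (d1 M) (d0 M).
Proof. exact: homology_vanishesE (d0d1 M). Qed.

Lemma H1_zeroE M : H1_zero M <-> exact_at (d0 M) (d1 M).
Proof. exact: homology_vanishesE (d1d0 M). Qed.

(** Exchange of the two degrees, with no sign on the differentials. [H0_zero (shift M)] is
    [H1_zero M] by conversion, so each statement on H_0 yields its twin on H_1. *)
Definition shift M : cplxCat A := Cplx (d1d0 M) (d0d1 M).

Definition shift_map M N (f : hom M N) : hom (shift M) (shift N) :=
  @mkch _ _ (shift M) (shift N) (ch0 f) (ch1 f) (ch_d0 f) (ch_d1 f).

Lemma shift_short_exact M N L (i : hom N L) (p : hom L M) :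
  short_exact i p -> short_exact (shift_map i) (shift_map p).
Proof.
by move=> /(short_exact_degreewise A_ab) [s1 s0]; apply/(short_exact_degreewise A_ab); split.
Qed.

Section LongExact.
Variables (M N L : cplxCat A) (i : hom N L) (p : hom L M).
Hypothesis ip : short_exact i p.

Let ex1 : short_exact (ch1 i) (ch1 p).
Proof. by move/(short_exact_degreewise A_ab): ip => []. Qed.

Let ex0 : short_exact (ch0 i) (ch0 p).
Proof. by move/(short_exact_degreewise A_ab): ip => []. Qed.

(** This and the next two lemmas are three stretches of the exact hexagon H0 N -> H0 L -> H0 M -> H1
    N -> H1 L -> H1 M -> H0 N; the shift supplies the other three. *)
Lemma H0_zero_mid : H0_zero N -> H0_zero M -> H0_zero L.
Proof.
move=> /H0_zeroE [_ hN] /H0_zeroE [_ hM]; apply/H0_zeroE; split; first exact: d0d1.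
move=> P y Pp y0.
have [m dm] : exists m, d1 M ∘ m = ch0 p ∘ y.
  by apply: hM => //; rewrite compA ch_d0 -compA y0 compm0.
have [l pl] := Pp _ _ _ (is_cokernel_epi ex1.2) m.
have [|n inE] := is_kernel_lift (u := y - d1 L ∘ l) ex0.1.
  by rewrite compBr compA -ch_d1 -compA pl dm subrr.
have [|n' dn] := hN P n Pp.
  apply: (mono_eq0 (is_kernel_mono ex1.1)).
  by rewrite compA -ch_d0 -compA inE compBr y0 compA d0d1 comp0m subrr.
exists (l + ch1 i ∘ n').
by rewrite compDr compA ch_d1 -compA dn inE addrC subrK.
Qed.

Lemma H0_zero_sub : H1_zero M -> H0_zero L -> H0_zero N.
Proof.
move=> /H1_zeroE [_ hM] /H0_zeroE [_ hL]; apply/H0_zeroE; split; first exact: d0d1.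
move=> P n Pp n0.
have [l dl] : exists l, d1 L ∘ l = ch0 i ∘ n.
  by apply: hL => //; rewrite compA ch_d0 -compA n0 compm0.
have [m dm] : exists m, d0 M ∘ m = ch1 p ∘ l.
  by apply: hM => //; rewrite compA ch_d1 -compA dl compA ex0.1.1 comp0m.
have [l' pl] := Pp _ _ _ (is_cokernel_epi ex0.2) m.
have [|n' inE] := is_kernel_lift (u := l - d0 L ∘ l') ex1.1.
  by rewrite compBr compA -ch_d0 -compA pl dm subrr.
exists n'; apply: (is_kernel_mono ex0.1).
by rewrite compA -ch_d1 -compA inE compBr dl compA d1d0 comp0m subr0.
Qed.

Lemma H0_zero_quot : H0_zero L -> H1_zero N -> H0_zero M.
Proof.
move=> /H0_zeroE [_ hL] /H1_zeroE [_ hN]; apply/H0_zeroE; split; first exact: d0d1.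
move=> P m Pp m0.
have [l pl] := Pp _ _ _ (is_cokernel_epi ex0.2) m.
have [|n inE] := is_kernel_lift (u := d0 L ∘ l) ex1.1.
  by rewrite compA -ch_d0 -compA pl m0.
have [|n' dn] := hN P n Pp.
  apply: (mono_eq0 (is_kernel_mono ex0.1)).
  by rewrite compA -ch_d1 -compA inE compA d1d0 comp0m.
have [|l' dl] := hL P (l - ch0 i ∘ n') Pp.
  by rewrite compBr compA ch_d0 -compA dn inE subrr.
exists (ch1 p ∘ l').
by rewrite compA ch_d1 -compA dl compBr pl compA ex0.1.1 comp0m subr0.
Qed.

End LongExact.

(** Under the two hypotheses each connecting map has zero source or zero target, so the hexagon
    breaks into two short exact sequences. The cases below decide which end vanishes. *)
Lemma inE0_mid M N L (i : hom N L) (p : hom L M) :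
  short_exact i p -> (~ H0_zero M -> H1_zero N) -> (~ H1_zero M -> H0_zero N) ->
  (H0_zero L <-> H0_zero N /\ H0_zero M) /\ (H1_zero L <-> H1_zero N /\ H1_zero M).
Proof.
move=> ip h01 h10; have sip := shift_short_exact ip; split; split.
- move=> L0; have [M1|M1] := EM (H1_zero M); have [N1|N1] := EM (H1_zero N).
  + by split; [exact: H0_zero_sub ip _ _|exact: H0_zero_quot ip _ _].
  + by split; [exact: H0_zero_sub ip _ _|exact: contra_notP N1].
  + by split; [exact: h10|exact: H0_zero_quot ip _ _].
  + by split; [exact: h10|exact: contra_notP N1].
- by move=> [N0 M0]; exact: H0_zero_mid ip _ _.
- move=> L1; have [M0|M0] := EM (H0_zero M); have [N0|N0] := EM (H0_zero N).
  + by split; [exact: H0_zero_sub sip _ _|exact: H0_zero_quot sip _ _].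
  + by split; [exact: H0_zero_sub sip _ _|exact: contra_notP N0].
  + by split; [exact: h01|exact: H0_zero_quot sip _ _].
  + by split; [exact: h01|exact: contra_notP N0].
- by move=> [N0 M0]; exact: H0_zero_mid sip _ _.
Qed.

(** A homotopy from the identity to zero. Unlike [acyclic], it passes to retracts and biproducts by
    explicit formulas. *)
Definition contractible E := exists (h1 : hom (c1 E) (c0 E)) (h0 : hom (c0 E) (c1 E)),
  h0 ∘ d1 E + d0 E ∘ h1 = idm (c1 E) /\ h1 ∘ d0 E + d1 E ∘ h0 = idm (c0 E).

Lemma contractible_acyclic E : contractible E -> acyclic E.
Proof.
move=> [h1 [h0 [e1 e0]]]; split.
  apply/H0_zeroE; split; first exact: d0d1.
  move=> P y _ y0; exists (h0 ∘ y).
  by rewrite -[RHS]comp1m -e0 compDl -!compA y0 compm0 add0r.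
apply/H1_zeroE; split; first exact: d1d0.
move=> P y _ y0; exists (h1 ∘ y).
by rewrite -[RHS]comp1m -e1 compDl -!compA y0 compm0 add0r.
Qed.

Lemma contractible_retract X E (i : hom X E) (r : hom E X) :
  r ∘ i = idm X -> contractible E -> contractible X.
Proof.
move=> ri [h1 [h0 [e1 e0]]]; exists (ch0 r ∘ h1 ∘ ch1 i), (ch1 r ∘ h0 ∘ ch0 i); split.
  rewrite -!compA -ch_d1 !compA ch_d0 -!compA -compDr !compA -!compDl e1 comp1m.
  by rewrite -ch1_comp ri.
rewrite -!compA -ch_d0 !compA ch_d1 -!compA -compDr !compA -!compDl e0 comp1m.
by rewrite -ch0_comp ri.
Qed.

End Homology.

(** * Acyclic complexes of projectives *)

Section Contractible.
Variables (k : finFieldType) (A : linCat k).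
Hypotheses (A_ab : abelian A) (A_ep : enough_projectives A) (A_her : gl_dim_le A 1).
Implicit Types M N L E : cplxCat A.

(** The cycles Z1, Z0 are projective by heredity, and exactness makes E_1 -> Z0 and E_0 -> Z1 epi.
    Both maps split, so each E_i is a sum of Z1 and Z0. *)
Lemma acyclic_split E : projective (c1 E) -> projective (c0 E) -> acyclic E ->
  exists P Q : projOb A, is_biproduct (KP P : cplxCat A) (KPs Q : cplxCat A) E.
Proof.
move=> E1p E0p [/(H0_zeroE A_ab A_ep) [_ h0] /(H1_zeroE A_ab A_ep) [_ h1]].
have [Z1 [i1 k1]] := ab_kernel A_ab (d1 E).
have [Z0 [i0 k0]] := ab_kernel A_ab (d0 E).
have m1 := is_kernel_mono k1; have m0 := is_kernel_mono k0.
have Z1p : projective Z1 := hereditary_sub_projective A_ab A_her m1 E1p.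
have Z0p : projective Z0 := hereditary_sub_projective A_ab A_her m0 E0p.
have [e1 ie1] := is_kernel_lift k0 (d0d1 E).
have [e0 ie0] := is_kernel_lift k1 (d1d0 E).
have e1e : epi e1.
  apply: (epi_el A_ep) => P y Pp; have [|x dx] := h0 P (i0 ∘ y) Pp.
    by rewrite compA k0.1 comp0m.
  by exists x; apply: m0; rewrite compA ie1.
have e0e : epi e0.
  apply: (epi_el A_ep) => P y Pp; have [|x dx] := h1 P (i1 ∘ y) Pp.
    by rewrite compA k1.1 comp0m.
  by exists x; apply: m1; rewrite compA ie0.
have [s1 es1] := Z0p _ _ _ e1e (idm Z0).
have [s0 es0] := Z1p _ _ _ e0e (idm Z1).
have ed0 : e0 ∘ d1 E = 0 by apply: m1; rewrite compA ie0 d0d1 compm0.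
have ed1 : e1 ∘ d0 E = 0 by apply: m0; rewrite compA ie1 d1d0 compm0.
have ei1 : e1 ∘ i1 = 0 by apply: m0; rewrite compA ie1 k1.1 compm0.
have ei0 : e0 ∘ i0 = 0 by apply: m1; rewrite compA ie0 k0.1 compm0.
have ds1 : d1 E ∘ s1 = i0 by rewrite -ie1 -compA es1 compm1.
have ds0 : d0 E ∘ s0 = i1 by rewrite -ie0 -compA es0 compm1.
have [|r1 ir1] := is_kernel_lift (u := idm _ - s1 ∘ e1) k1.
  by rewrite compBr compm1 compA ds1 ie1 subrr.
have [|r0 ir0] := is_kernel_lift (u := idm _ - s0 ∘ e0) k0.
  by rewrite compBr compm1 compA ds0 ie0 subrr.
have r1i : r1 ∘ i1 = idm _.
  by apply: m1; rewrite compA ir1 compBl comp1m -compA ei1 compm0 subr0 compm1.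
have r0i : r0 ∘ i0 = idm _.
  by apply: m0; rewrite compA ir0 compBl comp1m -compA ei0 compm0 subr0 compm1.
have r1s : r1 ∘ s1 = 0.
  by apply: m1; rewrite compA ir1 compBl comp1m -compA es1 compm1 subrr compm0.
have r0s : r0 ∘ s0 = 0.
  by apply: m0; rewrite compA ir0 compBl comp1m -compA es0 compm1 subrr compm0.
have r0d : r0 ∘ d1 E = e1.
  by apply: m0; rewrite compA ir0 compBl comp1m -compA ed0 compm0 subr0 ie1.
have r1d : r1 ∘ d0 E = e0.
  by apply: m1; rewrite compA ir1 compBl comp1m -compA ed1 compm0 subr0 ie0.
(* [KP Z0] is spanned by [s1] in degree one and its image [i0] under [d1], [KPs Z1] by [s0] and its
   image [i1] under [d0]. The signs on [s0] and [e0] absorb d0 = -Id in [KPs]. *)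
pose P := ProjOb Z0p; pose Q := ProjOb Z1p; exists P, Q.
have p1 : d1 (KP P : cplxCat A) ∘ e1 = r0 ∘ d1 E by rewrite r0d comp1m.
have p0 : d0 (KP P : cplxCat A) ∘ r0 = e1 ∘ d0 E by rewrite ed1 comp0m.
have q1 : d1 (KPs Q : cplxCat A) ∘ r1 = (- e0) ∘ d1 E.
  by rewrite compNl ed0 oppr0 comp0m.
have q0 : d0 (KPs Q : cplxCat A) ∘ (- e0) = r1 ∘ d0 E.
  by rewrite r1d compNl comp1m opprK.
exists (@KP_map _ _ P E s1), (@KPs_map _ _ Q E (- s0)).
exists (@mkch _ _ E (KP P) e1 r0 p1 p0), (@mkch _ _ E (KPs Q) r1 (- e0) q1 q0).
split; apply: ch_ext.
- exact: es1.
- by change (r0 ∘ (d1 E ∘ s1) = idm Z0); rewrite ds1.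
- by change (r1 ∘ - (d0 E ∘ - s0) = idm Z1); rewrite !compNr ds0 opprK.
- by change ((- e0) ∘ (- s0) = idm Z1); rewrite compNr compNl opprK.
- by change (e1 ∘ - (d0 E ∘ - s0) = 0); rewrite !compNr ds0 opprK.
- by change (r0 ∘ - s0 = 0); rewrite compNr r0s oppr0.
- exact: r1s.
- by change ((- e0) ∘ (d1 E ∘ s1) = 0); rewrite ds1 compNl ei0 oppr0.
- change (s1 ∘ e1 + (- (d0 E ∘ - s0)) ∘ r1 = idm (c1 E)).
  by rewrite !compNr ds0 opprK ir1 addrC subrK.
- change (d1 E ∘ s1 ∘ r0 + (- s0) ∘ (- e0) = idm (c0 E)).
  by rewrite ds1 compNl compNr opprK ir0 subrK.
Qed.

Lemma contractible_KP (P : projOb A) : contractible (KP P).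
Proof. by exists 0, (idm _); rewrite /= !comp0m !comp1m addr0 add0r. Qed.

Lemma contractible_KPs (P : projOb A) : contractible (KPs P).
Proof.
exists (- idm _), 0; rewrite /= !comp0m add0r addr0.
by rewrite compNr !compNl !compm1 opprK.
Qed.

Lemma contractible_biproduct M N L : is_biproduct M N L ->
  contractible M -> contractible N -> contractible L.
Proof.
move=> [i [j [p [q [e1 e2 e3 e4 e5]]]]] [h1 [h0 [a1 a0]]] [g1 [g0 [b1 b0]]].
exists (ch0 i ∘ h1 ∘ ch1 p + ch0 j ∘ g1 ∘ ch1 q).
exists (ch1 i ∘ h0 ∘ ch0 p + ch1 j ∘ g0 ∘ ch0 q); split.
  rewrite -ch1_id -e5 ch1D !ch1_comp -[in RHS](comp1m (ch1 p)) -[in RHS](comp1m (ch1 q)).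
  rewrite -a1 -b1 compDl !compDr -!compA -!ch_d1 !(compA (d0 L)) !ch_d0 !compDl !compDr.
  by rewrite -!compA addrACA.
rewrite -ch0_id -e5 ch0D !ch0_comp -[in RHS](comp1m (ch0 p)) -[in RHS](comp1m (ch0 q)).
rewrite -a0 -b0 compDl !compDr -!compA -!ch_d0 !(compA (d1 L)) !ch_d1 !compDl !compDr.
by rewrite -!compA addrACA.
Qed.

Lemma acyclicE E : projective (c1 E) -> projective (c0 E) -> acyclic E <-> contractible E.
Proof.
move=> E1 E0; split=> [/(acyclic_split E1 E0) [P [Q PQ]]|]; last exact: contractible_acyclic.
exact: contractible_biproduct PQ (contractible_KP P) (contractible_KPs Q).
Qed.

Lemma projective_acyclic E : projective (c1 E) -> projective (c0 E) -> acyclic E -> projective E.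
Proof.
move=> E1 E0 /(acyclic_split E1 E0) [P [Q PQ]]; apply: (projective_biproduct PQ).
  exact: projective_KP.
exact: projective_KPs.
Qed.

(** Contractible complexes are injective relative to degreewise split sequences. The degreewise
    extension f r need not be a chain map, but d h f r + h f r d is one, and on N it restricts to (d
    h + h d) f = f. *)
Lemma contractible_extend M N L E (i : hom N L) (p : hom L M) (f : hom N E) :
  short_exact i p -> projective (c1 M) -> projective (c0 M) -> contractible E ->
  exists g : hom L E, g ∘ i = f.
Proof.
move=> /(short_exact_degreewise A_ab) [ip1 ip0] M1 M0 [h1 [h0 [e1 e0]]].
have [s1 ps1] := M1 _ _ _ (is_cokernel_epi ip1.2) (idm _).
have [s0 ps0] := M0 _ _ _ (is_cokernel_epi ip0.2) (idm _).
have [r1 [ri1 _ _]] := short_exact_section ip1 ps1.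
have [r0 [ri0 _ _]] := short_exact_section ip0 ps0.
pose g1 := d0 E ∘ h1 ∘ ch1 f ∘ r1 + h0 ∘ ch0 f ∘ r0 ∘ d1 L.
pose g0 := d1 E ∘ h0 ∘ ch0 f ∘ r0 + h1 ∘ ch1 f ∘ r1 ∘ d0 L.
have gd1 : d1 E ∘ g1 = g0 ∘ d1 L.
  by rewrite compDr compDl !compA d1d0 !comp0m add0r -!compA d0d1 !compm0 addr0.
have gd0 : d0 E ∘ g0 = g1 ∘ d0 L.
  by rewrite compDr compDl !compA d0d1 !comp0m add0r -!compA d1d0 !compm0 addr0.
exists (@mkch _ _ L E g1 g0 gd1 gd0); apply: ch_ext.
  change (g1 ∘ ch1 i = ch1 f).
  rewrite compDl -!compA ch_d1 ri1 (compA r0) ri0 comp1m compm1 -ch_d1 !compA -compDl.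
  by rewrite addrC e1 comp1m.
change (g0 ∘ ch0 i = ch0 f).
rewrite compDl -!compA ch_d0 ri0 (compA r1) ri1 comp1m compm1 -ch_d0 !compA -compDl.
by rewrite addrC e0 comp1m.
Qed.

Lemma proj_summand M X : direct_summand X M -> projective (c1 M) -> projective (c0 M) ->
  projective (c1 X) /\ projective (c0 X).
Proof.
move=> [X' [i [_ [p [_ [e _ _ _ _]]]]]] M1 M0; split.
  by apply: (projective_retract (i := ch1 i) (p := ch1 p)) M1; rewrite -ch1_comp e.
by apply: (projective_retract (i := ch0 i) (p := ch0 p)) M0; rewrite -ch0_comp e.
Qed.

Lemma proj_mid M N L (i : hom N L) (p : hom L M) : short_exact i p ->
  projective (c1 M) -> projective (c0 M) -> projective (c1 N) -> projective (c0 N) ->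
  projective (c1 L) /\ projective (c0 L).
Proof.
move=> /(short_exact_degreewise A_ab) [ip1 ip0] M1 M0 N1 N0.
have [s1 ps1] := M1 _ _ _ (is_cokernel_epi ip1.2) (idm _).
have [s0 ps0] := M0 _ _ _ (is_cokernel_epi ip0.2) (idm _).
by split; [exact: projective_biproduct (short_exact_split ip1 ps1) _ _
  |exact: projective_biproduct (short_exact_split ip0 ps0) _ _].
Qed.

Lemma minimal_iso (M N : cplxP A) : iso (M : cplxCat A) N -> minimal M -> minimal N.
Proof.
move=> MN Mm X [X' XN]; apply: Mm; exists X'.
exact: biproduct_iso XN (iso_sym MN).
Qed.

(** An acyclic summand of [M] lifts along [p] because it is projective; the retraction of [N] onto
    an acyclic summand extends to [L] by relative injectivity. Either way it becomes a summand of
    [L]. *)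
Lemma minimal_short_exact (M N L : cplxP A) (i : hom (N : cplxCat A) L)
    (p : hom (L : cplxCat A) M) :
  short_exact i p -> minimal L -> minimal M /\ minimal N.
Proof.
move=> ip Lm; have [M1 M0] := cplxP_proj M; have [N1 N0] := cplxP_proj N; split=> X sX aX.
  have [X1 X0] := proj_summand sX M1 M0.
  case: sX => X' [s [_ [r [_ [rs _ _ _ _]]]]].
  have [t pt] := projective_acyclic X1 X0 aX (is_cokernel_epi ip.2) s.
  apply: Lm aX; apply: (retract_direct_summand (abelian_cplx A_ab) (i := t) (r := r ∘ p)).
  by rewrite -compA pt.
have [X1 X0] := proj_summand sX N1 N0.
case: sX => X' [s [_ [r [_ [rs _ _ _ _]]]]].
have [t ti] := contractible_extend r ip M1 M0 ((acyclicE X1 X0).1 aX).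
apply: Lm (aX); apply: (retract_direct_summand (abelian_cplx A_ab) (i := i ∘ s) (r := t)).
by rewrite compA ti.
Qed.

End Contractible.

(** * Counting in finite sets *)

Section Cardinality.
Implicit Types T : choiceType.

Lemma ncard_seq T (S : set T) (r : seq T) :
  uniq r -> (forall x, S x <-> x \in r) -> ncard S = size r.
Proof.
move=> ur Sr; have SE : S = [set` r] by apply/seteqP; split=> x /Sr.
have fS : finite_set S by rewrite SE.
apply/perm_size/uniq_perm => // x.
by rewrite in_fset_set // SE; apply/idP/idP; rewrite inE.
Qed.

Lemma finite_set_seq T (S : set T) : finite_set S ->
  exists2 r : seq T, uniq r & forall x, S x <-> x \in r.
Proof.
move=> fS; exists (fset_set S) => [|x]; first exact: fset_uniq.
by rewrite in_fset_set // inE.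
Qed.

Lemma ncard_unique T (S : set T) x : S x -> (forall y, S y -> y = x) -> ncard S = 1%N.
Proof.
move=> Sx Su; rewrite (@ncard_seq _ _ [:: x]) // => y; rewrite inE.
by split=> [/Su ->|/eqP ->].
Qed.

Lemma ncard_set0 T : ncard (set0 : set T) = 0%N.
Proof. exact: (@ncard_seq _ _ [::]). Qed.

Lemma ncard_gt0 T (S : set T) x : finite_set S -> S x -> (0 < ncard S)%N.
Proof.
by move=> /finite_set_seq [[|y r] ur Sr] /Sr; rewrite // (ncard_seq ur Sr).
Qed.

Lemma ncard_image T T' (S : set T) (f : T -> T') : finite_set S ->
  {in S &, injective f} -> ncard (f @` S) = ncard S.
Proof.
move=> /finite_set_seq [r ur Sr] fi.
rewrite (ncard_seq ur Sr) -(size_map f); apply: ncard_seq.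
  by rewrite map_inj_in_uniq // => x y /Sr Sx /Sr Sy; apply: fi; rewrite inE.
move=> y; split=> [[x Sx <-]|/mapP [x /Sr Sx ->]]; last by exists x.
by apply: map_f; apply/Sr.
Qed.

Lemma ncard_sum T (S : set T) (P : T -> Prop) (r : seq T) :
  uniq r -> (forall x, S x <-> x \in r) ->
  ncard [set x | S x /\ P x] = (\sum_(x <- r) `[< P x >])%N.
Proof.
move=> ur Sr; rewrite (@ncard_seq _ _ [seq x <- r | `[< P x >]]).
- by rewrite size_filter; elim: r {ur Sr} => [|x r IH] /=; rewrite ?big_nil // big_cons IH.
- exact: filter_uniq.
- move=> x; rewrite mem_filter /=; split=> [[/Sr -> Px]|/andP [/asboolP Px /Sr //]].
  by rewrite andbT; apply/asboolP.
Qed.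

Lemma double_count T T' (S : set T) (S' : set T') (r : T -> T' -> Prop) a b :
  finite_set S -> finite_set S' ->
  (forall x, S x -> ncard [set y | S' y /\ r x y] = a) ->
  (forall y, S' y -> ncard [set x | S x /\ r x y] = b) ->
  (ncard S * a = ncard S' * b)%N.
Proof.
move=> /finite_set_seq [s us Ss] /finite_set_seq [s' us' Ss'] ra rb.
have E1 : (\sum_(x <- s) ncard [set y | S' y /\ r x y] = ncard S * a)%N.
  rewrite (ncard_seq us Ss) -sum1_size big_distrl /= big_seq [RHS]big_seq.
  by apply: eq_bigr => x xs; rewrite mul1n ra //; apply/Ss.
have E2 : (\sum_(y <- s') ncard [set x | S x /\ r x y] = ncard S' * b)%N.
  rewrite (ncard_seq us' Ss') -sum1_size big_distrl /= big_seq [RHS]big_seq.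
  by apply: eq_bigr => x xs; rewrite mul1n rb //; apply/Ss'.
rewrite -E1 -E2; under eq_bigr do rewrite (ncard_sum _ us' Ss').
rewrite exchange_big /=; apply: eq_bigr => y _.
by rewrite (ncard_sum (fun x => r x y) us Ss).
Qed.

(** The bijection is a relation, functional in both directions, so that maps obtained from universal
    properties need not be chosen. *)
Lemma ncard_bij T T' (S : set T) (S' : set T') (r : T -> T' -> Prop) :
  finite_set S -> finite_set S' ->
  (forall x, S x -> exists y, [/\ S' y, r x y & forall y', S' y' -> r x y' -> y' = y]) ->
  (forall y, S' y -> exists x, [/\ S x, r x y & forall x', S x' -> r x' y -> x' = x]) ->
  ncard S = ncard S'.
Proof.
move=> fS fS' h h'; rewrite -[LHS]muln1 -[RHS]muln1; apply: (double_count (r := r)) => //.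
  by move=> x /h [y [Sy ry u]]; apply: (@ncard_unique _ _ y) => // y' [? ?]; exact: u.
by move=> y /h' [x [Sy ry u]]; apply: (@ncard_unique _ _ x) => // y' [? ?]; exact: u.
Qed.

Lemma ncard_fibers T T' (S : set T) (f : T -> T') (s : seq T') : finite_set S ->
  uniq s -> (forall x, S x -> f x \in s) ->
  ncard S = (\sum_(y <- s) ncard [set x | S x /\ f x = y])%N.
Proof.
move=> /finite_set_seq [r ur Sr] us fs; rewrite (ncard_seq ur Sr).
under eq_bigr do rewrite (ncard_sum _ ur Sr).
rewrite exchange_big /= -sum1_size big_seq [RHS]big_seq; apply: eq_bigr => x /Sr /fs fx.
rewrite (bigD1_seq _ fx us) /= asboolT // big1 // => y yf.
by rewrite asboolF // => fxy; rewrite fxy eqxx in yf.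
Qed.

Lemma ncardX T T' (S : set T) (S' : set T') : finite_set S -> finite_set S' ->
  ncard (S `*` S') = (ncard S * ncard S')%N.
Proof.
move=> /finite_set_seq [r ur Sr] /finite_set_seq [r' ur' Sr'].
rewrite (ncard_seq ur Sr) (ncard_seq ur' Sr') -(size_allpairs (fun x y => (x, y))).
apply: ncard_seq; first by apply: allpairs_uniq => // [] [? ?] [? ?] _ _.
move=> [x y]; split=> [[/= /Sr xr /Sr' yr]|/allpairsP [[a b] /= [/Sr ha /Sr' hb [-> ->]]] //].
by apply/allpairsP; exists (x, y).
Qed.

Lemma vect_card (k : finFieldType) (V : vectType k) :
  finite_set [set: V] /\ ncard [set: V] = (#|k| ^ dim V)%N.
Proof.
pose s := [seq r2v v | v <- enum {: 'rV[k]_(dim V)}] : seq V.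
have us : uniq s by rewrite map_inj_uniq ?enum_uniq //; exact: can_inj r2vK.
have sT (x : V) : [set: V] x <-> x \in s.
  by split=> // _; rewrite -[x]v2rK map_f // mem_enum.
have fT : finite_set [set: V].
  by apply: (sub_finite_set (B := [set` s])) => // x /sT.
by split=> //; rewrite (ncard_seq us sT) size_map -cardE card_mx mul1n.
Qed.

Lemma vect_finite (k : finFieldType) (V : vectType k) (S : set V) : finite_set S.
Proof. by apply: sub_finite_set (vect_card V).1. Qed.

Lemma vect_finite2 (k : finFieldType) (V W : vectType k) (S : set (V * W)) : finite_set S.
Proof.
apply: (sub_finite_set (B := setT `*` setT)) => //.
exact: finite_setX (vect_finite _) (vect_finite _).
Qed.

Lemma vect_pigeonhole (k : finFieldType) (V : vectType k) (u : nat -> V) :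
  exists m n, (m < n)%N /\ u m = u n.
Proof.
pose N := #|{: 'rV[k]_(dim V)}|.
pose f (i : 'I_N.+1) := v2r (u i).
have /injectivePn [i [j ij fij]] : ~~ injectiveb f.
  apply/negP => /injectiveP /leq_card; rewrite card_ord => h.
  by have := leq_trans (ltnSn N) h; rewrite ltnn.
have uij : u i = u j by exact: (can_inj v2rK) fij.
have [lij|lji|/val_inj eij] := ltngtP i j.
- by exists i, j.
- by exists j, i.
- by rewrite eij eqxx in ij.
Qed.

End Cardinality.

(** * Minimal complexes *)

Section EndomorphismPowers.
Variables (k : finFieldType) (B : linCat k) (X : B) (f : hom X X).

Definition epow n : hom X X := iter n (comp f) (idm X).

Lemma epowD m n : epow (m + n) = epow m ∘ epow n.
Proof.
by elim: m => [|m IH]; rewrite ?comp1m // addSn /epow !iterS -/(epow _) IH compA.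
Qed.

(** End(X) is finite, so the powers of [f] are eventually periodic; a power whose exponent is a
    multiple of the period, beyond the preperiod, is idempotent. *)
Lemma epow_idempotent : exists2 n, (0 < n)%N & epow n ∘ epow n = epow n.
Proof.
have [m [n [mn e]]] := vect_pigeonhole epow.
pose b := (n - m)%N; have b0 : (0 < b)%N by rewrite subn_gt0.
have per1 r : (m <= r)%N -> epow (r + b) = epow r.
  by move=> mr; rewrite -(subnK mr) -addnA !epowD -epowD /b subnKC ?(ltnW mn) // e.
have per a r : (m <= r)%N -> epow (r + a * b) = epow r.
  move=> mr; elim: a => [|a IH]; first by rewrite addn0.
  by rewrite mulSn addnCA addnC per1 // (leq_trans mr) // leq_addr.
(* A multiple of the period [b] that is at least [m]; the factor [m.+1] keeps it positive when m =
   0. *)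
exists (m.+1 * b)%N; first by rewrite muln_gt0.
rewrite -epowD per // (leq_trans (leqnSn m)) // -{1}[m.+1]muln1 leq_mul2l b0.
by rewrite orbT.
Qed.

Lemma epow_fix n W (u : hom W X) : f ∘ u = u -> epow n ∘ u = u.
Proof.
by move=> fu; elim: n => [|n IH]; rewrite ?comp1m // /epow iterS -/(epow _) -compA IH.
Qed.

Lemma epowSr n : epow n.+1 = epow n ∘ f.
Proof. by rewrite -addn1 epowD /epow /= compm1. Qed.

Lemma epow_fixr n W (u : hom X W) : u ∘ f = u -> u ∘ epow n = u.
Proof. by move=> fu; elim: n => [|n IH]; rewrite ?compm1 // epowSr compA IH. Qed.

End EndomorphismPowers.

Lemma idempotent_split (k : finFieldType) (B : linCat k) (B_ab : abelian B) (X : B)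
    (e : hom X X) : e ∘ e = e ->
  exists Y (i : hom Y X) (p : hom X Y), i ∘ p = e /\ p ∘ i = idm Y.
Proof.
move=> ee; have [Y [i ki]] := ab_kernel B_ab (idm X - e).
have ei : e ∘ i = i.
  by apply/esym/subr0_eq; have := ki.1; rewrite compBl comp1m.
have [|p ip] := is_kernel_lift (u := e) ki; first by rewrite compBl comp1m ee subrr.
exists Y, i, p; split=> //; apply: (is_kernel_mono ki).
by rewrite compA ip ei compm1.
Qed.

Section MinimalComplexes.
Variables (k : finFieldType) (A : linCat k).
Hypotheses (A_ab : abelian A) (A_ep : enough_projectives A) (A_her : gl_dim_le A 1).
Implicit Types M N L E : cplxCat A.

Let C_ab := abelian_cplx A_ab.

(* Fitting: a power of b a is an idempotent whose image is a summand of N that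
   factors through E, hence vanishes. *)
Lemma minimal_iso_sub (N : cplxP A) E (a : hom (N : cplxCat A) E) (b : hom E (N : cplxCat A)) :
  minimal N -> contractible E -> is_iso (idm (N : cplxCat A) - b ∘ a).
Proof.
move=> Nm Ec; pose f := b ∘ a.
have [[//|n] _ ee] := epow_idempotent f.
have [Y [i [p [ip pi1]]]] := idempotent_split C_ab ee.
have Y0 : is_zero Y.
  apply: Nm; first exact: retract_direct_summand pi1.
  apply: (contractible_acyclic A_ab A_ep).
  (* The composite is p f^(n+1) i = p i p i = 1. A positive exponent is essential here: one factor f
     = b a provides the passage through [E]. *)
  apply: (contractible_retract (i := a ∘ epow f n ∘ i) (r := p ∘ b)) Ec.
  rewrite -!compA (compA b a) -/f (compA f) -[f ∘ epow f n]/(epow f n.+1) -ip.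
  by rewrite -!compA pi1 compm1.
have e0 : epow f n.+1 = 0 by rewrite -ip ((Y0 _).1 i) comp0m.
apply: (mono_epi_is_iso C_ab).
  apply: mono0 => W u; rewrite compBl comp1m => /subr0_eq fu.
  by rewrite -(epow_fix n.+1 (esym fu)) e0 comp0m.
apply: epi0 => W u; rewrite compBr compm1 => /subr0_eq fu.
by rewrite -(epow_fixr n.+1 (esym fu)) e0 compm0.
Qed.

(** The identity of [Y] is the sum of its detours through [Y'] and through [Z]. For [Y] minimal and
    [Z] contractible, [minimal_iso_sub] makes the detour through [Y'] invertible. *)
Lemma biproduct_cross (B : linCat k) (Y Y' Z W : B) (i : hom Y W) (p : hom W Y)
    (j : hom Y' W) (q : hom W Y') (j2 : hom Z W) (q2 : hom W Z) :
  p ∘ i = idm Y -> j ∘ q + j2 ∘ q2 = idm W ->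
  (p ∘ j) ∘ (q ∘ i) = idm Y - (p ∘ j2) ∘ (q2 ∘ i).
Proof.
move=> pi1 jq; rewrite -!compA (compA j) (compA j2) -pi1 -compBr -[X in p ∘ (X - _)]comp1m.
by rewrite -compBl -jq addrK.
Qed.

(** Both composites of the cross maps N -> N' and N' -> N are the identity minus a map through a
    contractible complex, hence invertible; so the first is split mono and split epi. *)
Lemma minimal_part_unique (N N' : cplxP A) E E' M :
  minimal N -> minimal N' -> contractible E -> contractible E' ->
  is_biproduct (N : cplxCat A) E M -> is_biproduct (N' : cplxCat A) E' M ->
  iso (N : cplxCat A) N'.
Proof.
move=> Nm Nm' Ec Ec' [i [i2 [p [p2 [e1 _ _ _ e5]]]]].
move=> [j [j2 [q [q2 [f1 _ _ _ f5]]]]]; exists (q ∘ i).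
apply: (mono_epi_is_iso C_ab).
  have [h [hgf _]] : is_iso ((p ∘ j) ∘ (q ∘ i)).
    by rewrite (biproduct_cross e1 f5); exact: minimal_iso_sub.
  by apply: (split_mono (g := h ∘ (p ∘ j))); rewrite -compA.
have [h [_ fgh]] : is_iso ((q ∘ i) ∘ (p ∘ j)).
  by rewrite (biproduct_cross f1 e5); exact: minimal_iso_sub.
by apply: (split_epi (f := (p ∘ j) ∘ h)); rewrite compA.
Qed.

Lemma biproductA (B : linCat k) (X X' Y Z V M : B) :
  is_biproduct X X' M -> is_biproduct Y Z X' -> is_biproduct Z X V -> is_biproduct Y V M.
Proof.
move=> [i1 [i2 [p1 [p2 [e1 e2 e3 e4 e5]]]]] [j1 [j2 [q1 [q2 [f1 f2 f3 f4 f5]]]]].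
move=> [k1 [k2 [r1 [r2 [g1 g2 g3 g4 g5]]]]].
exists (i2 ∘ j1), (i2 ∘ j2 ∘ r1 + i1 ∘ r2), (q1 ∘ p2), (k1 ∘ q2 ∘ p2 + k2 ∘ p1); split.
- by rewrite -!compA (compA p2) e2 comp1m f1.
- rewrite compDl !compDr -!compA !(compA p2) !(compA p1) e1 e2 e3 e4.
  by rewrite !comp1m !comp0m !compm0 addr0 add0r !(compA q2) f2 comp1m g5.
- rewrite compDr -!compA !(compA p2) e2 e4 comp1m comp0m compm0 addr0.
  by rewrite compA f3 comp0m.
- rewrite compDl -!compA !(compA p2) !(compA p1) e2 e3 comp1m comp0m compm0 addr0.
  by rewrite f4 compm0.
- rewrite compDl !compDr -!compA !(compA r1) !(compA r2) g1 g2 g3 g4.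
  rewrite !comp1m !comp0m !compm0 addr0 add0r addrA.
  by rewrite -compDr !compA -compDl f5 comp1m addrC.
Qed.

(** Termination measure for splitting off acyclic summands. End(X') embeds in End(M), and the
    projector onto the nonzero [X] lies outside the image. *)
Lemma direct_summand_card (B : linCat k) (X X' M : B) :
  is_biproduct X X' M -> ~ is_zero X ->
  (ncard [set: hom X' X'] < ncard [set: hom M M])%N.
Proof.
move=> [i [i' [p [p' [e1 e2 e3 e4 e5]]]]] X0.
have [s us Ss] := finite_set_seq (vect_finite [set: hom M M]).
have [s' us' Ss'] := finite_set_seq (vect_finite [set: hom X' X']).
rewrite (ncard_seq us Ss) (ncard_seq us' Ss').
pose F (f : hom X' X') := i' ∘ f ∘ p'.
have Fi : injective F.
  move=> f g /(f_equal (fun z => p' ∘ z ∘ i')).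
  by rewrite /F !compA e2 !comp1m -!compA e2 !compm1.
rewrite -(size_map F); have -> : (size (map F s')).+1 = size (i ∘ p :: map F s') by [].
apply: uniq_leq_size => [|x _]; last exact/Ss.
rewrite /= map_inj_uniq // us' andbT; apply/mapP => [[f _ ipf]]; apply: X0.
apply/is_zeroE; have := f_equal (fun z => p ∘ z ∘ i) ipf.
by rewrite /F !compA e1 comp1m e1 e3 !comp0m.
Qed.

Lemma minimal_decomposition (M : cplxP A) : exists N E : cplxP A,
  [/\ minimal N, acyclic E & is_biproduct (N : cplxCat A) E M].
Proof.
have [n] := ubnP (ncard [set: hom (M : cplxCat A) M]); elim: n M => // n IH M leMn.
have [Mm|] := EM (minimal M).
  have [Z Z0] := ab_zero C_ab.
  have Zp X : is_zero X -> projective (X : A).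
    move=> X0 Y W e _ f; exists 0; have := (X0 W).1 f => ->.
    exact: compm0.
  have [Z1 Z2] := (zero_degreewise _).1 Z0.
  exists M, (CplxP (conj (Zp _ Z1) (Zp _ Z2))); split=> //.
    apply: (contractible_acyclic A_ab A_ep); exists 0, 0.
    by rewrite !comp0m !compm0 !addr0; split; apply/esym/is_zeroE.
  exact/biproduct_sym/biproduct_zerol.
move=> /existsNP [X /not_implyP [[X' XM] /not_implyP [aX X0]]].
have [M1 M0] := cplxP_proj M.
have pX : projective (c1 X) /\ projective (c0 X).
  by apply: proj_summand M1 M0; exists X'.
have pX' : projective (c1 X') /\ projective (c0 X').
  by apply: proj_summand M1 M0; exists X; exact: biproduct_sym.
have [N [E [Nm aE NE]]] := IH (CplxP pX') (leq_trans (direct_summand_card XM X0) leMn).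
have [V EX] := ab_biproduct C_ab (E : cplxCat A) X.
have [E1 E0] := cplxP_proj E.
have [EX1 EX0] := biproduct_degreewise EX.
have pV : projective (c1 V) /\ projective (c0 V).
  by split; [exact: projective_biproduct EX1 E1 pX.1|exact: projective_biproduct EX0 E0 pX.2].
exists N, (CplxP pV); split=> //; last exact: biproductA XM NE EX.
apply/(acyclicE A_ab A_ep A_her pV.1 pV.2); apply: (contractible_biproduct EX).
  exact/(acyclicE A_ab A_ep A_her E1 E0).
exact/(acyclicE A_ab A_ep A_her pX.1 pX.2).
Qed.

End MinimalComplexes.

(** * Grothendieck classes *)

Section FreeLift.
Variables (R : nzRingType) (K : choiceType) (M : lmodType R) (f : K -> M).

Lemma fgliftB x y : fglift f (x - y) = fglift f x - fglift f y.
Proof. exact: lift_is_additive. Qed.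

Lemma fglift0 : fglift f 0 = 0.
Proof. by rewrite -(subrr 0) fgliftB subrr. Qed.

Lemma fgliftD x y : fglift f (x + y) = fglift f x + fglift f y.
Proof. by rewrite -{1}[y]opprK fgliftB -sub0r fgliftB fglift0 sub0r opprK. Qed.

Lemma fglift_sum (I : Type) (r : seq I) (F : I -> {freeg K / R}) :
  fglift f (\sum_(i <- r) F i) = \sum_(i <- r) fglift f (F i).
Proof.
by elim: r => [|i r IH]; rewrite ?big_nil ?fglift0 // !big_cons fgliftD IH.
Qed.

Lemma fgliftZ c x : fglift f (c *: x) = c *: fglift f x.
Proof.
rewrite -[in RHS](freeg_sumE x) !fglift_sum scaler_sumr.
by apply: eq_bigr => i _; rewrite !liftU scalerA.
Qed.

Lemma fglift1 x : fglift f << x >> = f x.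
Proof. by rewrite liftU scale1r. Qed.

End FreeLift.

Lemma freegZU (R : nzRingType) (K : choiceType) (c : R) (x : K) :
  << c *g x >> = c *: << x >> :> {freeg K / R}.
Proof. by apply/eqP/freeg_eqP => y; rewrite coeffZ !coeffU mul1r. Qed.

Section Grothendieck.
Local Open Scope quotient_scope.
Variables (k : finFieldType) (A : linCat k).
Hypotheses (A_ab : abelian A) (A_ep : enough_projectives A) (A_her : gl_dim_le A 1).

Let pi := \pi_(@Quotient.quot {freeg A / int} (@K0_relb k A)).

Lemma K0_class_short_exact (X Y Z : A) (i : hom X Y) (p : hom Y Z) :
  short_exact i p -> K0_class Y = K0_class X + K0_class Z.
Proof.
move=> ip; apply/eqP; rewrite -subr_eq0 opprD addrA /K0_class -!raddfB -(raddf0 pi) /pi.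
rewrite -Quotient.idealrBE subr0; apply/asboolP; apply: K0_rel_gen.
by exists X, Y, Z, i, p.
Qed.

Lemma K0_class_zero (X : A) : is_zero X -> K0_class X = 0.
Proof.
move=> /(biproduct_zerol X) /biproduct_short_exact [i [p /K0_class_short_exact e]].
by apply: (addrI (K0_class X)); rewrite addr0 -e.
Qed.

Lemma K0_class_biproduct (X Y Z : A) : is_biproduct X Y Z ->
  K0_class Z = K0_class X + K0_class Y.
Proof.
by move=> /biproduct_short_exact [i [p /K0_class_short_exact]]; rewrite addrC.
Qed.

Lemma K0_class_iso (X Y : A) : iso X Y -> K0_class X = K0_class Y.
Proof.
move=> XY; have [Z Z0] := ab_zero A_ab.
have /K0_class_biproduct := biproduct_iso (biproduct_zerol X Z0) XY.
by rewrite (K0_class_zero Z0) add0r.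
Qed.

(* This invariant separates the families KP and KPs. *)
Definition kerK (M : cplxCat A) : K0 A :=
  xget 0 [set x | exists K (i : hom K (c1 M)), is_kernel (d1 M) i /\ x = K0_class K].

Lemma kerKE (M : cplxCat A) K (i : hom K (c1 M)) : is_kernel (d1 M) i -> kerK M = K0_class K.
Proof.
move=> ki; rewrite /kerK; case: xgetP => [x _ [K' [i' [ki' ->]]]|/(_ (K0_class K))].
  by have [g gi _] := is_kernel_unique ki' ki; apply: K0_class_iso; exists g.
by case; exists K, i.
Qed.

Lemma kerK_biproduct (M N L : cplxCat A) : is_biproduct M N L -> kerK L = kerK M + kerK N.
Proof.
move=> [i [j [p [q [e1 e2 e3 e4 e5]]]]].
have [K [a ka]] := ab_kernel A_ab (d1 M); have [K' [b kb]] := ab_kernel A_ab (d1 N).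
have [S KS] := ab_biproduct A_ab K K'; have [s [s' [r [r' [h1 h2 h3 h4 h5]]]]] := KS.
rewrite (kerKE ka) (kerKE kb) -(K0_class_biproduct KS).
have pa : ch1 p ∘ ch1 i = idm _ by rewrite -ch1_comp e1.
have qa : ch1 q ∘ ch1 j = idm _ by rewrite -ch1_comp e2.
have pj : ch1 p ∘ ch1 j = 0 by rewrite -ch1_comp e3.
have qi : ch1 q ∘ ch1 i = 0 by rewrite -ch1_comp e4.
apply: (@kerKE L S (ch1 i ∘ a ∘ r + ch1 j ∘ b ∘ r')); apply: is_kernelI.
- rewrite compDr !compA !ch_d1 -(compA (ch0 i)) -(compA (ch0 j)) ka.1 kb.1.
  by rewrite !compm0 !comp0m addr0.
- apply: mono0 => W u /[dup] /(f_equal (fun z => ch1 p ∘ z)) + /(f_equal (fun z => ch1 q ∘ z)).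
  rewrite !compm0 !compDl !compDr -!compA !(compA (ch1 p)) !(compA (ch1 q)) pa qa pj qi.
  rewrite !comp0m !comp1m addr0 add0r => /(mono_eq0 (is_kernel_mono ka)) ru.
  move=> /(mono_eq0 (is_kernel_mono kb)) r'u.
  by rewrite -[u]comp1m -h5 compDl -!compA ru r'u !compm0 addr0.
- move=> W u du.
  have [|v av] := is_kernel_lift (u := ch1 p ∘ u) ka.
    by rewrite compA ch_d1 -compA du compm0.
  have [|w bw] := is_kernel_lift (u := ch1 q ∘ u) kb.
    by rewrite compA ch_d1 -compA du compm0.
  exists (s ∘ v + s' ∘ w); rewrite compDl !compDr -!compA !(compA r) !(compA r').
  rewrite h1 h2 h3 h4 !comp1m !comp0m !compm0 addr0 add0r av bw !compA -compDl.
  by rewrite -!ch1_comp -ch1D e5 comp1m.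
Qed.

Lemma kerK_iso (M N : cplxCat A) : iso M N -> kerK M = kerK N.
Proof.
move=> MN; have [Z Z0] := ab_zero (abelian_cplx A_ab).
have kZ : kerK Z = 0.
  by apply: (addrI (kerK Z)); rewrite addr0 -(kerK_biproduct (biproduct_zerol Z Z0)).
have := kerK_biproduct (biproduct_iso (biproduct_zerol M Z0) MN).
by rewrite kZ add0r.
Qed.

(** The class of the image of [d1]. On a sum of KP P and KPs Q it reads off the class of P, while
    [kerK] reads off that of Q. *)
Definition coimK (M : cplxCat A) : K0 A := K0_class (c1 M) - kerK M.

Lemma coimK_biproduct (M N L : cplxCat A) : is_biproduct M N L -> coimK L = coimK M + coimK N.
Proof.
move=> MN; rewrite /coimK (kerK_biproduct MN) (K0_class_biproduct (biproduct_degreewise MN).1).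
by rewrite opprD addrACA.
Qed.

Lemma coimK_iso (M N : cplxCat A) : iso M N -> coimK M = coimK N.
Proof.
move=> MN; rewrite /coimK (kerK_iso MN); congr (_ - _); apply: K0_class_iso.
by case: MN => f /is_iso_degree [f1 _]; exists (ch1 f).
Qed.

Lemma kerK_KP (P : projOb A) : kerK (KP P) = 0.
Proof.
have [Z [Z0 _]] := short_exact_id_zero A_ab.
rewrite -(K0_class_zero Z0).
apply: (@kerKE (KP P) Z (0 : hom Z P)); apply: is_kernelI => [||W u].
- exact: compm0.
- by apply: mono0 => W u _; exact: (Z0 W).2.
- by rewrite /= comp1m => ->; exists 0; rewrite compm0.
Qed.

Lemma kerK_KPs (P : projOb A) : kerK (KPs P) = K0_class (P : A).
Proof.
apply: (@kerKE (KPs P) P (idm P)); apply: is_kernelI => [||W u _].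
- exact: comp0m.
- exact: is_iso_mono (is_iso_idm _).
- by exists u; rewrite comp1m.
Qed.

Lemma coimK_KP (P : projOb A) : coimK (KP P) = K0_class (P : A).
Proof. by rewrite /coimK kerK_KP subr0. Qed.

Lemma coimK_KPs (P : projOb A) : coimK (KPs P) = 0.
Proof. by rewrite /coimK kerK_KPs subrr. Qed.

Lemma zero_projective (X : A) : is_zero X -> projective X.
Proof. by move=> X0 Y Z e _ f; exists 0; rewrite compm0 ((X0 Z).1 f). Qed.

(** Such differences form a subgroup, and it contains every generator because each object has a
    projective resolution of length one. *)
Lemma K0_projective (x : K0 A) : exists P Q : projOb A, x = K0_class (P : A) - K0_class (Q : A).
Proof.
pose S (x : K0 A) := exists P Q : projOb A, x = K0_class (P : A) - K0_class (Q : A).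
have SB y z : S y -> S z -> S (y - z).
  move=> [P [Q ->]] [P' [Q' ->]].
  have [U PU] := ab_biproduct A_ab P Q'; have [V QV] := ab_biproduct A_ab Q P'.
  have Up : projective U by apply: (projective_biproduct PU); exact: projObP.
  have Vp : projective V by apply: (projective_biproduct QV); exact: projObP.
  exists (ProjOb Up), (ProjOb Vp); rewrite /= (K0_class_biproduct PU) (K0_class_biproduct QV).
  by rewrite opprB opprD addrACA [- _ + _]addrC addrA -!addrA; congr (_ + _); rewrite addrCA.
have S0 : S 0.
  have [Z Z0] := ab_zero A_ab.
  by exists (ProjOb (zero_projective Z0)), (ProjOb (zero_projective Z0)); rewrite subrr.
have SN y : S y -> S (- y) by move=> Sy; rewrite -sub0r; exact: SB.
have SD y z : S y -> S z -> S (y + z) by move=> Sy Sz; rewrite -[z]opprK; apply/SB/SN.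
have Sc (X : A) : S (K0_class X).
  have [K [P [i [p [Kp Pp ip]]]]] := hereditary_resolution X A_her.
  exists (ProjOb Pp), (ProjOb Kp); rewrite (K0_class_short_exact ip) addrC addKr //.
elim/quotW: x => x; rewrite -(freeg_sumE x).
elim: (dom x) => [|X s IH]; first by rewrite big_nil raddf0.
rewrite big_cons raddfD; apply/SD => //.
have Sn n : S (pi (<< X >> *+ n)).
  elim: n => [|n IHn]; first by rewrite mulr0n /pi raddf0.
  by rewrite mulrS /pi raddfD; apply: SD; [exact: Sc|exact: IHn].
have -> : << coeff X x *g X >> = << X >> *~ coeff X x :> {freeg A / int}.
  by rewrite freegU_mulz intz.
case: (coeff X x) => n; first exact: Sn.
by rewrite NegzE mulrNz raddfN; apply: SN; exact: Sn.
Qed.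

End Grothendieck.

(** A sum over an infinite set is meaningful only through its finite support; this lemma and the
    next reduce it to one point or to a list carrying the support. *)
Lemma fsum_single (V : nmodType) (I : choiceType) (a : I) (f : I -> V) :
  (forall x, x <> a -> f x = 0) -> \sum_(x \in [set: I]) f x = f a.
Proof.
move=> f0; rewrite -(fsbig_widen [set a]) ?fsbig_set1 // => x /= [_ xa].
exact: f0.
Qed.

Lemma fsum_seq (V : nmodType) (I : choiceType) (r : seq I) (f : I -> V) :
  uniq r -> (forall x, x \notin r -> f x = 0) ->
  \sum_(x \in [set: I]) f x = \sum_(x <- r) f x.
Proof.
move=> ur f0; rewrite [RHS]fsbig_seq //; apply/esym/fsbig_widen => // x /= [_ /negP].
exact: f0.
Qed.

(** * Split extensions in the Hall algebra *)

Section EulerForm.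
Variables (k : finFieldType) (A : linCat k).
Hypotheses (A_ab : abelian A) (A_ep : enough_projectives A).
Implicit Types X Y Z P Q : A.

(** The map f' from [X] to Ker p is epi: if u f' = 0, then [f] factors through the subobject Ker u
    of [Y]. That subobject is the kernel of some [g], which descends along [p], hence kills Ker p;
    so Ker u is all of Ker p and u = 0. *)
Lemma cokernel_exact_at X Y Z (f : hom X Y) (p : hom Y Z) : is_cokernel f p -> exact_at f p.
Proof.
move=> cp; have [K [i ki]] := ab_kernel A_ab p.
have [f' if'] := is_kernel_lift ki cp.1.
have im := is_kernel_mono ki.
have f'e : epi f'.
  apply: epi0 => W u uf; have [K2 [j kj]] := ab_kernel A_ab u.
  have [f2 jf] := is_kernel_lift kj uf.
  have [V [g kg]] := ab_mono A_ab (mono_comp im (is_kernel_mono kj)).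
  have [|g' gp] := is_cokernel_desc (u := g) cp.
    by rewrite -if' -jf !compA -(compA g) kg.1 comp0m.
  have [|w jw] := is_kernel_lift (u := i) kg; first by rewrite -gp -compA ki.1 compm0.
  have jw1 : j ∘ w = idm K by apply: im; rewrite compA jw compm1.
  by rewrite -[u]compm1 -jw1 compA kj.1 comp0m.
split=> [|P y Pp py]; first exact: cp.1.
have [v iv] := is_kernel_lift ki py; have [x fx] := Pp _ _ _ f'e v.
by exists x; rewrite -if' -compA fx.
Qed.

Lemma resolution_dd X (r : proj_resolution X) n : res_d r n ∘ res_d r n.+1 = 0.
Proof.
have [H [K [i [f' [p [ki if' _]]]]] _] := res_exact r n.
by rewrite -if' compA ki.1 comp0m.
Qed.

Lemma resolution_lift X (r : proj_resolution X) n P (y : hom P (res_ob r n.+1)) :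
  projective P -> res_d r n ∘ y = 0 -> exists x, res_d r n.+1 ∘ x = y.
Proof.
have /(homology_vanishesE A_ab A_ep) [|_ h] := res_exact r n; last exact: h.
exact: resolution_dd.
Qed.

(* A projective resolution of a projective object is contractible. *)
Lemma resolution_split X (r : proj_resolution X) n : projective X ->
  exists s, res_d r n ∘ s ∘ res_d r n = res_d r n.
Proof.
move=> Xp; elim: n => [|n [s dsd]].
  have cp := res_aug_coker r.
  have [s as1] := Xp _ _ _ (is_cokernel_epi cp) (idm X).
  have [|s0 ds] := (cokernel_exact_at cp).2 _ (idm _ - s ∘ res_aug r) (@res_projective _ _ _ r 0).
    by rewrite compBr compA as1 comp1m compm1 subrr.
  by exists s0; rewrite ds compBl -compA cp.1 compm0 subr0 comp1m.
have [|s' ds] := @resolution_lift _ r n _ (idm _ - s ∘ res_d r n) (@res_projective _ _ _ r _).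
  by rewrite compBr compA dsd compm1 subrr.
by exists s'; rewrite ds compBl -compA resolution_dd compm0 subr0 comp1m.
Qed.

Definition precomp X Y Z (f : hom X Y) (g : hom Y Z) : hom X Z := g ∘ f.

HB.instance Definition _ X Y Z (f : hom X Y) :=
  GRing.isLinear.Build k (hom Y Z) (hom X Z) *:%R (@precomp X Y Z f) (comp_linear_l f).

Lemma coboundaryE X (r : proj_resolution X) Y n f : coboundary r Y n f = f ∘ res_d r n.
Proof. exact: (lfunE (precomp (res_d r n))). Qed.

Lemma ext_dim0 X (r : proj_resolution X) Y : ext_dim r Y 0 = dim (hom X Y).
Proof.
have cp := res_aug_coker r; pose F := linfun (@precomp _ _ Y (res_aug r)).
have FE f : F f = f ∘ res_aug r by rewrite lfunE.
have F0 : lker F = 0%VS.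
  apply/eqP/lker0P => f g; rewrite !FE; exact: is_cokernel_epi cp _ _ _.
rewrite /ext_dim subn0 -dimvf -(@limg_dim_eq _ _ _ F fullv) ?F0 ?capv0 //; congr (\dim _).
apply/vspaceP => f; rewrite memv_ker coboundaryE; apply/eqP/memv_imgP.
  by move=> /(is_cokernel_desc cp) [v <-]; exists v; rewrite ?memvf ?FE.
by move=> [v _ ->]; rewrite FE -compA cp.1 compm0.
Qed.

Lemma ext_dimS X (r : proj_resolution X) Y n : projective X -> ext_dim r Y n.+1 = 0%N.
Proof.
move=> Xp; apply/eqP; rewrite subn_eq0; apply/dimvS/subvP => f.
rewrite memv_ker coboundaryE => /eqP fd.
have [s dsd] := resolution_split r n Xp.
have [|s' ds] := @resolution_lift _ r n _ (idm _ - s ∘ res_d r n) (@res_projective _ _ _ r _).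
  by rewrite compBr compA dsd compm1 subrr.
apply/memv_imgP; exists (f ∘ s); rewrite ?memvf // coboundaryE -compA.
apply: subr0_eq; rewrite -[X in X - _]compm1 -compBr -ds compA fd comp0m //.
Qed.

Lemma projective_resolution X : projective X -> exists r : proj_resolution X, True.
Proof.
move=> Xp; have [Z [Z0 ex]] := short_exact_id_zero A_ab.
pose ob n : A := if n is 0 then X else Z.
have obp n : projective (ob n) by case: n => //= n; exact: zero_projective.
have hv n : homology_vanishes (0 : hom (ob n.+2) (ob n.+1)) (0 : hom (ob n.+1) (ob n)).
  apply/homology_vanishesE => //; first exact: comp0m.
  split=> [|P y _ _]; first exact: comp0m.
  by exists 0; rewrite compm0; apply/esym; exact: (Z0 P).2.
by exists (@ProjResolution _ _ X ob (fun n => 0) (idm X) obp (ex X).2 hv).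
Qed.

(** [euler] picks an arbitrary resolution. For projective [X] each one gives Ext^0 = Hom and no
    higher Ext, and one exists, which rules out the default value 0 of [xget]. *)
Lemma euler_projective X Y : projective X -> euler X Y = (dim (hom X Y))%:Z.
Proof.
move=> Xp; rewrite /euler; case: xgetP => [x _ [r _ <-]|/= h].
  rewrite (@fsum_single _ _ 0%N); first by rewrite ext_dim0 expr0 mul1r.
  by case=> // n _; rewrite ext_dimS // mulr0.
have [r _] := projective_resolution Xp.
by case: (h _ (ex_intro2 _ _ r I erefl)).
Qed.

End EulerForm.

Section SplitExtensions.
Variables (k : finFieldType) (B : linCat k).
Implicit Types M N L X Y : B.

Lemma ncard_hom_iso X X' Y Y' : iso X X' -> iso Y Y' ->
  ncard [set: hom X Y] = ncard [set: hom X' Y'].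
Proof.
move=> [a [a' [a'a aa']]] [b [b' [b'b bb']]].
rewrite -(ncard_image (f := fun f : hom X Y => b ∘ f ∘ a')); first 1 last.
- exact: vect_finite.
- move=> f g _ _ /(f_equal (fun z => b' ∘ z ∘ a)).
  by rewrite !compA b'b !comp1m -!compA a'a !compm1.
congr ncard; apply/seteqP; split=> // f _; exists (b' ∘ f ∘ a) => //.
by rewrite !compA bb' comp1m -compA aa' compm1.
Qed.

Lemma split_extension_equiv M N (E E' : extension M N)
    (s : hom M (ext_mid E)) (s' : hom M (ext_mid E')) :
  ext_proj E ∘ s = idm M -> ext_proj E' ∘ s' = idm M -> extension_equivb E E'.
Proof.
move=> ps ps'; have [r [ri rs e]] := short_exact_section (ext_exact E) ps.
have [r' [ri' rs' e']] := short_exact_section (ext_exact E') ps'.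
have pi0 := (ext_exact E).1.1; have pi0' := (ext_exact E').1.1.
apply/asboolP; exists (s' ∘ ext_proj E + ext_inc E' ∘ r); split.
- exists (s ∘ ext_proj E' + ext_inc E ∘ r'); split.
    rewrite compDl !compDr -!compA (compA (ext_proj E')) (compA _ (ext_inc E')) ps' pi0'.
    by rewrite (compA r') (compA r' (ext_inc E')) rs' ri' !comp0m !comp1m !compm0 addr0 add0r.
  rewrite compDl !compDr -!compA (compA (ext_proj E)) (compA _ (ext_inc E)) ps pi0.
  by rewrite (compA r) (compA r (ext_inc E)) rs ri !comp0m !comp1m !compm0 addr0 add0r.
- by rewrite compDl -!compA pi0 ri compm0 compm1 add0r.
- by rewrite compDr !compA ps' pi0' comp1m comp0m addr0.
Qed.

(** All split extensions are equivalent, so [Ext1 M N] is a single point, whose middle term is the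
    biproduct. *)
Lemma Ext1_mid_split M N L L' : is_biproduct M N L ->
  (forall E : extension M N, exists s, ext_proj E ∘ s = idm M) ->
  ncard (Ext1_mid L' : set (Ext1 M N)) = `[< iso L L' >].
Proof.
move=> MN h; have [i [p ip]] := biproduct_short_exact MN.
have mid (E : extension M N) : iso (ext_mid E) L.
  have [s ps] := h E; exact: biproduct_unique (short_exact_split (ext_exact E) ps) MN.
have [LL'|LL'] := asboolP (iso L L'); last first.
  rewrite (_ : Ext1_mid L' = set0) ?ncard_set0 //; apply/seteqP; split=> // xi.
  by move=> /(iso_trans (iso_sym (mid _))).
pose x : Ext1 M N := \pi_(Ext1 M N)%qT (Extension ip).
apply: (@ncard_unique _ _ x) => [|y _].
  exact: iso_trans (mid _) LL'.
rewrite -[y]reprK; apply/eqmodP.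
have [s ps] := h (repr y); have [s' ps'] := h (Extension ip).
exact: split_extension_equiv ps ps'.
Qed.

End SplitExtensions.

(** * The elements K_a are well defined *)

Section ProjectiveCharacter.
Variables (k : finFieldType) (A : linCat k).
Hypotheses (A_ab : abelian A) (A_ep : enough_projectives A) (A_her : gl_dim_le A 1).
Variables (D : unitRingType) (kap : projOb A -> D).
Implicit Types P Q S T : projOb A.
Hypothesis kap_unit : forall P, kap P \is a GRing.unit.
Hypothesis kap_zero : forall P : projOb A, is_zero (P : A) -> kap P = 1.
Hypothesis kapD : forall P Q S : projOb A,
  is_biproduct (P : A) (Q : A) (S : A) -> kap P * kap Q = kap S.

Lemma kap_biproduct P Q : exists2 S : projOb A,
  is_biproduct (P : A) (Q : A) (S : A) & kap P * kap Q = kap S.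
Proof.
have [S PQ] := ab_biproduct A_ab P Q.
have Sp : projective S := projective_biproduct PQ (@projObP _ _ P) (@projObP _ _ Q).
by exists (ProjOb Sp) => //; exact: kapD.
Qed.

Lemma kapC P Q : kap P * kap Q = kap Q * kap P.
Proof.
have [S PQ ->] := kap_biproduct P Q; apply/esym/kapD; exact: biproduct_sym.
Qed.

Lemma kapCV P Q : kap P * (kap Q)^-1 = (kap Q)^-1 * kap P.
Proof. by apply: commrV; exact: kapC. Qed.

Lemma kap_div P Q P' Q' S T :
  kap P * kap P' = kap S -> kap Q * kap Q' = kap T ->
  kap P / kap Q * (kap P' / kap Q') = kap S / kap T.
Proof.
move=> <- <-; rewrite (kapC Q) invrM ?kap_unit // mulrA -(mulrA (kap P)) -kapCV.
by rewrite !mulrA.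
Qed.

Lemma kap_div_eq P Q P' Q' : kap P * kap Q' = kap P' * kap Q ->
  kap P / kap Q = kap P' / kap Q'.
Proof.
move=> e; apply: (mulIr (kap_unit Q)); rewrite divrK ?kap_unit //.
apply: (mulIr (kap_unit Q')); rewrite e -!mulrA; congr (_ * _).
by rewrite (kapC Q) !mulrA mulVr ?kap_unit // mul1r.
Qed.

(** The fractions form a commutative group of units. It is given an additive structure, so that
    functions into it extend to the free abelian group by [fglift]. Keeping [kap] abstract serves
    both [KP] and [KPs]. *)
Definition kap_frac : Type := {x : D | `[< exists P Q, x = kap P / kap Q >]}.

HB.instance Definition _ := Choice.on kap_frac.

Definition mk_frac P Q : kap_frac :=
  exist (fun x : D => `[< exists P Q, x = kap P / kap Q >]) (kap P / kap Q)
    (asboolT (ex_intro _ P (ex_intro _ Q erefl))).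

Lemma kap_fracP (x : kap_frac) : exists P Q, x = mk_frac P Q.
Proof. by case: x => x h; have /asboolP [P [Q e]] := h; exists P, Q; apply: val_inj. Qed.

Lemma frac_add_subproof (x y : kap_frac) :
  `[< exists P Q, val x * val y = kap P / kap Q >].
Proof.
have [P [Q ->]] := kap_fracP x; have [P' [Q' ->]] := kap_fracP y.
have [S _ PS] := kap_biproduct P P'; have [T _ QT] := kap_biproduct Q Q'.
by apply/asboolP; exists S, T; exact: kap_div.
Qed.

Definition frac_add (x y : kap_frac) : kap_frac :=
  exist (fun x : D => `[< exists P Q, x = kap P / kap Q >]) _ (frac_add_subproof x y).

Lemma frac_opp_subproof (x : kap_frac) : `[< exists P Q, (val x)^-1 = kap P / kap Q >].
Proof.
have [P [Q ->]] := kap_fracP x; apply/asboolP; exists Q, P => /=.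
by rewrite invrM ?unitrV ?kap_unit // invrK.
Qed.

Definition frac_opp (x : kap_frac) : kap_frac :=
  exist (fun x : D => `[< exists P Q, x = kap P / kap Q >]) _ (frac_opp_subproof x).

Definition frac_zero : kap_frac := let P := ProjOb
  (zero_projective (svalP (cid (ab_zero A_ab)))) in mk_frac P P.

Lemma frac_addA : associative frac_add.
Proof. by move=> x y z; apply: val_inj; rewrite /= mulrA. Qed.

Lemma frac_addC : commutative frac_add.
Proof.
move=> x y; apply: val_inj => /=.
have [P [Q ->]] := kap_fracP x; have [P' [Q' ->]] := kap_fracP y => /=.
have [S _ PS] := kap_biproduct P P'; have [T _ QT] := kap_biproduct Q Q'.
by rewrite (kap_div PS QT) (@kap_div _ _ _ _ S T) // kapC.
Qed.

Lemma frac_add0 : left_id frac_zero frac_add.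
Proof. by move=> x; apply: val_inj; rewrite /= divrr ?mul1r. Qed.

Lemma frac_addN : left_inverse frac_zero frac_opp frac_add.
Proof.
move=> x; apply: val_inj; rewrite /= divrr //.
have [P [Q ->]] := kap_fracP x; by rewrite /= mulVr // unitrMl ?unitrV ?kap_unit.
Qed.

HB.instance Definition _ := GRing.isZmodule.Build kap_frac
  frac_addA frac_addC frac_add0 frac_addN.

(** Independence of the resolution: Schanuel's lemma identifies K + P' with P + K', and [kap] is
    multiplicative on biproducts. *)
Lemma resolution_frac (X : A) : exists x : kap_frac, forall (P K : projOb A)
    (i : hom (K : A) P) (p : hom (P : A) X), short_exact i p -> x = mk_frac P K.
Proof.
have [K [P [i [p [Kp Pp ip]]]]] := hereditary_resolution X A_her.
exists (mk_frac (ProjOb Pp) (ProjOb Kp)) => P' K' i' p' ip'; apply: val_inj.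
have [W [KP' PK']] := schanuel A_ab Pp (@projObP _ _ P') ip ip'.
have Wp : projective W := projective_biproduct KP' Kp (@projObP _ _ P').
apply: kap_div_eq; rewrite [RHS]kapC.
rewrite (@kapD (ProjOb Kp) P' (ProjOb Wp) KP') (@kapD (ProjOb Pp) K' (ProjOb Wp) PK') //.
Qed.

Definition euler_frac (X : A) : kap_frac := sval (cid (resolution_frac X)).

Lemma euler_fracE (X : A) (P K : projOb A) (i : hom (K : A) P) (p : hom (P : A) X) :
  short_exact i p -> euler_frac X = mk_frac P K.
Proof. exact: svalP (cid (resolution_frac X)) P K i p. Qed.

(* If Q -> Y is epi with kernel K, Q projective, and K' is the kernel of Q -> Z,
   then K -> K' resolves X and K' -> Q resolves Z. *)
Lemma euler_frac_short_exact (X Y Z : A) (i : hom X Y) (p : hom Y Z) :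
  short_exact i p -> euler_frac Y = euler_frac X + euler_frac Z.
Proof.
move=> ip; have [K [Q [l [q [Kp Qp lq]]]]] := hereditary_resolution Y A_her.
have [K' [u [v [w [uv wr _ _]]]]] := noether_sub A_ab A_ep lq ip.
have K'p : projective K' := hereditary_sub_projective A_ab A_her (is_kernel_mono wr.1) Qp.
rewrite (@euler_fracE Y (ProjOb Qp) (ProjOb Kp) _ _ lq).
rewrite (@euler_fracE X (ProjOb K'p) (ProjOb Kp) _ _ uv).
rewrite (@euler_fracE Z (ProjOb Qp) (ProjOb K'p) _ _ wr).
rewrite addrC; apply: val_inj; rewrite /= mulrA divrK //.
Qed.

Lemma euler_frac_projective (P : projOb A) : val (euler_frac P) = kap P.
Proof.
have [Z [Z0 /(_ P) ex]] := short_exact_id_zero A_ab.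
rewrite (@euler_fracE P P (ProjOb (zero_projective Z0)) _ _ ex) /=.
by rewrite [X in _ / X]kap_zero // divr1.
Qed.

Lemma K0_rel_euler_frac (x : {freeg A / int}) :
  K0_rel x -> fglift (euler_frac : A -> zmodule kap_frac) x = 0.
Proof.
elim=> [|y z _ y0 _ z0|y [X [Y [Z [i [p [ip ->]]]]]]]; first exact: fglift0.
  by rewrite fgliftB y0 z0 subr0.
rewrite !fgliftB !fglift1 (euler_frac_short_exact ip) addrAC.
by rewrite addrK subrr.
Qed.

(** An equality in [K0 A] may come from exact sequences of objects that are not projective. So [kap]
    is first extended to all objects as [euler_frac], which kills the relators, and then read back
    on projectives. *)
Lemma kap_K0 (P Q P' Q' : projOb A) :
  K0_class (P : A) - K0_class (Q : A) = K0_class (P' : A) - K0_class (Q' : A) ->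
  kap P / kap Q = kap P' / kap Q'.
Proof.
move=> e; apply: kap_div_eq.
suff /(f_equal val) : euler_frac P + euler_frac Q' = euler_frac P' + euler_frac Q.
  by rewrite /= !euler_frac_projective.
have : K0_rel ((<< (P : A) >> - << (Q : A) >>) - (<< (P' : A) >> - << (Q' : A) >>)).
  apply/asboolP.
  have /eqP := e; rewrite /K0_class -!raddfB => h.
  by rewrite -[_ - _ - _]/(_ - _) -[asbool _]/(_ \in (@K0_relb k A)) Quotient.idealrBE.
move=> /K0_rel_euler_frac; rewrite !fgliftB !fglift1 => /subr0_eq h.
by rewrite -[euler_frac P](subrK (euler_frac Q)) h addrAC subrK.
Qed.

End ProjectiveCharacter.

(** * The basis of the localized Hall algebra *)

Section Expansion.
Variables (F : fieldType) (V : lmodType F) (B : choiceType) (e : B -> V).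

Lemma expansionP x c : expansion e x c <-> exists r : seq B,
  [/\ uniq r, forall b, c b != 0 -> b \in r & x = \sum_(b <- r) c b *: e b].
Proof.
split=> [[fc ->]|[r [ur cr ->]]].
  have [r ur Sr] := finite_set_seq fc; exists r; split=> // [b /Sr //|].
  apply: fsum_seq => // b br; have [->|/Sr cb] := eqVneq (c b) 0; first by rewrite scale0r.
  by rewrite cb in br.
split; first by apply: (sub_finite_set (B := [set` r])) => // b /cr.
apply/esym/fsum_seq => // b br; have [->|/cr cb] := eqVneq (c b) 0; first by rewrite scale0r.
by rewrite cb in br.
Qed.

Lemma expansion_widen x c (r : seq B) : expansion e x c -> uniq r ->
  (forall b, c b != 0 -> b \in r) -> x = \sum_(b <- r) c b *: e b.
Proof.
move=> [_ ->] ur cr; apply: fsum_seq => // b br.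
by have [->|/cr cb] := eqVneq (c b) 0; [rewrite scale0r | rewrite cb in br].
Qed.

Lemma expansionD a x y c d : expansion e x c -> expansion e y d ->
  expansion e (a *: x + y) (fun b => a * c b + d b).
Proof.
move=> xc yd; have /expansionP [r [ur cr _]] := xc; have /expansionP [s [us ds _]] := yd.
pose w := undup (r ++ s); have uw : uniq w := undup_uniq _.
have cw b : c b != 0 -> b \in w by move=> /cr h; rewrite mem_undup mem_cat h.
have dw b : d b != 0 -> b \in w by move=> /ds h; rewrite mem_undup mem_cat h orbT.
apply/expansionP; exists w; split=> // [b|].
  by apply: contraR => bw; rewrite (contraNeq (cw b) bw) (contraNeq (dw b) bw) mulr0 addr0.
rewrite (expansion_widen xc uw cw) (expansion_widen yd uw dw) scaler_sumr -big_split /=.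
by apply: eq_bigr => b _; rewrite scalerA scalerDl.
Qed.

Lemma expansion0 : expansion e 0 (fun=> 0).
Proof. by apply/expansionP; exists [::]; rewrite big_nil; split=> // b; rewrite eqxx. Qed.

Lemma expansion1 b : expansion e (e b) (fun b' => (b == b')%:R).
Proof.
apply/expansionP; exists [:: b]; split=> // [b'|]; last by rewrite big_seq1 eqxx scale1r.
by rewrite inE [b == b']eq_sym; case: (b' == b); rewrite //= eqxx.
Qed.

Lemma is_basisI :
  (forall x, exists c, expansion e x c) ->
  (forall (r : seq B) c, uniq r -> \sum_(b <- r) c b *: e b = 0 -> {in r, forall b, c b = 0}) ->
  is_basis e.
Proof.
move=> sp ind x; have [c xc] := sp x; exists c; split=> // d xd.
have xcd : expansion e 0 (fun b => (-1) * c b + d b).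
  by have := expansionD (-1) xc xd; rewrite scaleN1r addNr.
have /expansionP [r [ur cr /esym z]] := xcd.
apply/funext => b; apply/eqP; rewrite -subr_eq0 -[_ == 0]negbK.
have -> : c b - d b = - ((-1) * c b + d b) by rewrite mulN1r opprD opprK.
rewrite oppr_eq0; apply/negP => h.
by move: (h); rewrite (ind r _ ur z b (cr _ h)) eqxx.
Qed.

Hypothesis eB : is_basis e.

Lemma coordP x : expansion e x (coord e x).
Proof. by rewrite /coord; apply: xgetPex; have [c [xc _]] := eB x; exists c. Qed.

Lemma coord_unique x c : expansion e x c -> coord e x = c.
Proof. by move=> xc; have [d [_ du]] := eB x; rewrite -(du _ xc) (du _ (coordP x)). Qed.

Lemma coordE b b' : coord e (e b) b' = (b == b')%:R.
Proof. by rewrite (coord_unique (expansion1 b)). Qed.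

Lemma coord_linear a x y b : coord e (a *: x + y) b = a * coord e x b + coord e y b.
Proof. by rewrite (coord_unique (expansionD a (coordP x) (coordP y))). Qed.

End Expansion.

(** * Products with classes of acyclic complexes *)

Section LocalizedHall.
Variables (k : finFieldType) (A : linCat k).
Hypotheses (A_ab : abelian A) (A_ep : enough_projectives A) (A_her : gl_dim_le A 1).
Variables (R : realType) (t : R[i]).
Hypothesis t_sqrt : t ^+ 2 = #|k|%:R.
Local Notation C := R[i].
Implicit Types M N L E : cplxP A.

Lemma iso_classP M N : iso_class M = iso_class N <-> iso (M : cplxCat A) N.
Proof. by split=> [/eqmodP/asboolP|h] //; apply/eqmodP/asboolP. Qed.

Lemma cobj_iso M : iso (cobj (iso_class M)) (M : cplxCat A).
Proof. by apply/iso_classP; rewrite /iso_class reprK. Qed.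

Lemma card_k_gt1 : (1 < #|k|)%N.
Proof. exact: card_finNzRing_gt1. Qed.

Lemma t_neq0 : t != 0.
Proof.
apply/eqP => t0; have /esym/eqP := t_sqrt; rewrite t0 expr0n pnatr_eq0 => /eqP k0.
by have := card_k_gt1; rewrite k0.
Qed.

Lemma ncard_hom_neq0 (B : linCat k) (X Y : B) : (ncard [set: hom X Y])%:R != 0 :> C.
Proof.
rewrite pnatr_eq0 (vect_card _).2 -lt0n expn_gt0.
by rewrite (ltn_trans _ card_k_gt1).
Qed.

Lemma dim_hom_iso (B : linCat k) (X X' Y Y' : B) : iso X X' -> iso Y Y' ->
  dim (hom X Y) = dim (hom X' Y').
Proof.
move=> XX' YY'; have := ncard_hom_iso XX' YY'; rewrite !(vect_card _).2.
by move/eqP; rewrite eqn_exp2l ?card_k_gt1 // => /eqP.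
Qed.

Lemma iso_degree (M N : cplxCat A) : iso M N -> iso (c1 M) (c1 N) /\ iso (c0 M) (c0 N).
Proof.
by move=> [f /is_iso_degree [f1 f0]]; split; [exists (ch1 f) | exists (ch0 f)].
Qed.

Lemma acyclicPE E : acyclic E <-> contractible E.
Proof. by have [E1 E0] := cplxP_proj E; exact: acyclicE. Qed.

Lemma acyclic_iso E M : iso (E : cplxCat A) M -> acyclic E -> acyclic M.
Proof.
move=> [f [g [gf fg]]] /acyclicPE Ec; apply/acyclicPE.
exact: contractible_retract fg Ec.
Qed.

Lemma cplxP_biproduct M N : exists L, is_biproduct (M : cplxCat A) N L.
Proof.
have [L MN] := cplx_biproduct A_ab (M : cplxCat A) N.
have [M1 M0] := cplxP_proj M; have [N1 N0] := cplxP_proj N.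
have [L1 L0] := biproduct_degreewise MN.
have Lp : projective (c1 L) /\ projective (c0 L).
  by split; [exact: projective_biproduct L1 M1 N1|exact: projective_biproduct L0 M0 N0].
by exists (CplxP Lp).
Qed.

Lemma acyclic_biproduct M N L : is_biproduct (M : cplxCat A) N L ->
  acyclic M -> acyclic N -> acyclic L.
Proof.
by move=> MN /acyclicPE Mc /acyclicPE Nc; apply/acyclicPE; exact: contractible_biproduct MN Mc Nc.
Qed.

(** An acyclic [M] is a projective complex; an acyclic [N] is relatively injective, so the inclusion
    has a retraction, hence the projection a section. *)
Lemma extension_section M N (E : extension (M : cplxCat A) N) : acyclic M \/ acyclic N ->
  exists s, ext_proj E ∘ s = idm _.
Proof.
have [M1 M0] := cplxP_proj M; have [N1 N0] := cplxP_proj N.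
case=> [aM|/acyclicPE Nc].
  exact: (projective_acyclic A_ab A_ep A_her M1 M0 aM (is_cokernel_epi (ext_exact E).2)).
have [r ri] := contractible_extend A_ab (idm _) (ext_exact E) M1 M0 Nc.
by have [s [ps _ _]] := short_exact_retract (ext_exact E) ri; exists s.
Qed.

(** The one Hall coefficient left when all extensions split; on projective components the Euler form
    is dim Hom. *)
Definition split_coef (M N : cplxCat A) : C :=
  t ^ ((dim (hom (c0 M) (c0 N)))%:Z + (dim (hom (c1 M) (c1 N)))%:Z) /
  (ncard [set: hom M N])%:R.

Lemma split_coef_neq0 (M N : cplxCat A) : split_coef M N != 0.
Proof.
by rewrite mulf_neq0 ?invr_eq0 ?ncard_hom_neq0 // expfz_neq0 // t_neq0.
Qed.

Lemma hall_mul_split M N L : is_biproduct (M : cplxCat A) N L -> acyclic M \/ acyclic N ->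
  hall_mul t (bracket R M) (bracket R N) = split_coef M N *: bracket R L.
Proof.
move=> MN aMN; rewrite /hall_mul /bracket !fglift1 /hall_mul_basis.
set m := iso_class M; set n := iso_class N.
have mM : iso (cobj m) M := cobj_iso M; have nN : iso (cobj n) N := cobj_iso N.
have bip : is_biproduct (cobj m) (cobj n) L.
  exact: biproduct_isol (iso_sym mM) (biproduct_isor (iso_sym nN) MN).
have amn : acyclic (repr m) \/ acyclic (repr n).
  by case: aMN => [/(acyclic_iso (iso_sym mM))|/(acyclic_iso (iso_sym nN))]; [left|right].
have sec (E : extension (cobj m) (cobj n)) : exists s, ext_proj E ∘ s = idm _.
  exact: extension_section.
have [m1 m0] := cplxP_proj (repr m).
have [mM1 mM0] := iso_degree mM; have [nN1 nN0] := iso_degree nN.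
rewrite (@fsum_single _ _ (iso_class L)) => [|L' LL'].
  congr (_ *: _); rewrite /hall_coef /split_coef (Ext1_mid_split _ bip sec).
  rewrite asboolT ?mul1r; last exact: iso_sym (cobj_iso L).
  rewrite !(euler_projective A_ab A_ep) // (dim_hom_iso mM0 nN0) (dim_hom_iso mM1 nN1).
  by rewrite /hom_card (ncard_hom_iso mM nN).
rewrite /hall_coef (Ext1_mid_split _ bip sec) asboolF ?mul0r ?mulr0 ?scale0r //.
move=> LL; apply: LL'; rewrite -[L']reprK; apply/iso_classP; exact: iso_sym.
Qed.

End LocalizedHall.

Section ContractibleHoms.
Variables (k : finFieldType) (A : linCat k).

Lemma ncard_KP_hom (P : projOb A) (M : cplxCat A) :
  ncard [set: hom (KP P : cplxCat A) M] = ncard [set: hom (P : A) (c1 M)].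
Proof.
rewrite -(ncard_image (f := @KP_map _ _ P M)); first 1 last.
- exact: vect_finite.
- by move=> f g _ _ /(f_equal (@ch1 _ _ _ _)).
congr ncard; apply/seteqP; split=> // f _; exists (ch1 f) => //.
exact/esym/KP_mapE.
Qed.

Lemma ncard_KPs_hom (P : projOb A) (M : cplxCat A) :
  ncard [set: hom (KPs P : cplxCat A) M] = ncard [set: hom (P : A) (c0 M)].
Proof.
rewrite -(ncard_image (f := @KPs_map _ _ P M)); first 1 last.
- exact: vect_finite.
- by move=> f g _ _ /(f_equal (@ch0 _ _ _ _)).
congr ncard; apply/seteqP; split=> // f _; exists (ch0 f) => //.
exact/esym/KPs_mapE.
Qed.

Lemma KP_biproduct (P Q S : projOb A) : is_biproduct (P : A) (Q : A) (S : A) ->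
  is_biproduct (KP P : cplxCat A) (KP Q : cplxCat A) (KP S).
Proof.
move=> [i [j [p [q [e1 e2 e3 e4 e5]]]]].
have m X Y (f : hom (projOb_val X) (projOb_val Y)) :
    d1 (KP Y : cplxCat A) ∘ f = f ∘ d1 (KP X : cplxCat A) /\
    d0 (KP Y : cplxCat A) ∘ f = f ∘ d0 (KP X : cplxCat A).
  by rewrite /= comp1m compm1 comp0m compm0.
pose F X Y f := @mkch _ _ (KP X) (KP Y) f f (m X Y f).1 (m X Y f).2.
by exists (F P S i), (F Q S j), (F S P p), (F S Q q); split; apply: ch_ext.
Qed.

Lemma KPs_biproduct (P Q S : projOb A) : is_biproduct (P : A) (Q : A) (S : A) ->
  is_biproduct (KPs P : cplxCat A) (KPs Q : cplxCat A) (KPs S).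
Proof.
move=> [i [j [p [q [e1 e2 e3 e4 e5]]]]].
have m X Y (f : hom (projOb_val X) (projOb_val Y)) :
    d1 (KPs Y : cplxCat A) ∘ f = f ∘ d1 (KPs X : cplxCat A) /\
    d0 (KPs Y : cplxCat A) ∘ f = f ∘ d0 (KPs X : cplxCat A).
  by rewrite /= compNl compNr comp1m compm1 comp0m compm0.
pose F X Y f := @mkch _ _ (KPs X) (KPs Y) f f (m X Y f).1 (m X Y f).2.
by exists (F P S i), (F Q S j), (F S P p), (F S Q q); split; apply: ch_ext.
Qed.

End ContractibleHoms.

(** * Spanning and linear independence in the localization *)

Section DerivedHall.
Variables (k : finFieldType) (A : linCat k).
Hypotheses (A_ab : abelian A) (A_ep : enough_projectives A) (A_her : gl_dim_le A 1).
Variables (R : realType) (t : R[i]).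
Hypothesis t_sqrt : t ^+ 2 = #|k|%:R.
Variables (DH : unitAlgType R[i]) (j : {linear Htw A R -> DH}).
Hypothesis DH_loc : ore_localization t j.
Local Notation C := R[i].
Implicit Types M N L E : cplxP A.
Implicit Types P Q S : projOb A.

(** With d = dim Hom(P, Q), the twist is t^(2d) = q^d, which equals |Hom(KP P, KP Q)| by
    adjunction. *)
Lemma split_coef_KP P Q : split_coef t (KP P : cplxCat A) (KP Q) = 1.
Proof.
rewrite /split_coef ncard_KP_hom (vect_card _).2 natrX -t_sqrt -exprM.
by rewrite -PoszD addnn -mul2n divff // expf_neq0 // (t_neq0 t_sqrt).
Qed.

Lemma split_coef_KPs P Q : split_coef t (KPs P : cplxCat A) (KPs Q) = 1.
Proof.
rewrite /split_coef ncard_KPs_hom (vect_card _).2 natrX -t_sqrt -exprM.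
by rewrite -PoszD addnn -mul2n divff // expf_neq0 // (t_neq0 t_sqrt).
Qed.

Local Notation jb M := (j (bracket R M)).

Lemma jb_mul M N L : is_biproduct (M : cplxCat A) N L -> acyclic M \/ acyclic N ->
  jb M * jb N = split_coef t (M : cplxCat A) N *: jb L.
Proof.
move=> MN aMN; rewrite -(loc_mul DH_loc) (hall_mul_split A_ab A_ep A_her t MN aMN).
by rewrite linearZ.
Qed.

Lemma acyclic_KP P : acyclic (KP P).
Proof. exact/(contractible_acyclic A_ab A_ep)/contractible_KP. Qed.

Lemma acyclic_KPs P : acyclic (KPs P).
Proof. exact/(contractible_acyclic A_ab A_ep)/contractible_KPs. Qed.

Definition kap P := jb (KP P).
Definition kaps P := jb (KPs P).

Lemma kap_unit P : kap P \is a GRing.unit.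
Proof. exact/(loc_unit DH_loc)/acyclic_KP. Qed.

Lemma kaps_unit P : kaps P \is a GRing.unit.
Proof. exact/(loc_unit DH_loc)/acyclic_KPs. Qed.

Lemma kap_zero P : is_zero (P : A) -> kap P = 1.
Proof. by move=> P0; apply: (loc_one DH_loc); apply/zero_degreewise. Qed.

Lemma kaps_zero P : is_zero (P : A) -> kaps P = 1.
Proof. by move=> P0; apply: (loc_one DH_loc); apply/zero_degreewise. Qed.

Lemma kapM P Q S : is_biproduct (P : A) (Q : A) (S : A) -> kap P * kap Q = kap S.
Proof.
move=> /KP_biproduct PQ; rewrite (jb_mul PQ); last by left; exact: acyclic_KP.
by rewrite split_coef_KP scale1r.
Qed.

Lemma kapsM P Q S : is_biproduct (P : A) (Q : A) (S : A) -> kaps P * kaps Q = kaps S.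
Proof.
move=> /KPs_biproduct PQ; rewrite (jb_mul PQ); last by left; exact: acyclic_KPs.
by rewrite split_coef_KPs scale1r.
Qed.

(** [Kelt] selects some presentation of [a] through [xget]; [kap_K0] shows that the value does not
    depend on it. *)
Lemma KeltE (a : K0 A) P Q : a = K0_class (P : A) - K0_class (Q : A) ->
  Kelt j a = kap P / kap Q.
Proof.
move=> aPQ; rewrite /Kelt; case: xgetP => [x _ [P' [Q' [e ->]]]|/= h].
  by apply: (kap_K0 A_ab A_ep A_her kap_unit kap_zero kapM); rewrite -e.
by case: (h (kap P / kap Q)); exists P, Q.
Qed.

Lemma KseltE (a : K0 A) P Q : a = K0_class (P : A) - K0_class (Q : A) ->
  Kselt j a = kaps P / kaps Q.
Proof.
move=> aPQ; rewrite /Kselt; case: xgetP => [x _ [P' [Q' [e ->]]]|/= h].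
  by apply: (kap_K0 A_ab A_ep A_her kaps_unit kaps_zero kapsM); rewrite -e.
by case: (h (kaps P / kaps Q)); exists P, Q.
Qed.

Lemma Kelt0 : Kelt j (0 : K0 A) = 1.
Proof.
have [Z Z0] := ab_zero A_ab; pose P := ProjOb (zero_projective Z0).
by rewrite (@KeltE _ P P) ?subrr // divrr // kap_unit.
Qed.

Lemma Kselt0 : Kselt j (0 : K0 A) = 1.
Proof.
have [Z Z0] := ab_zero A_ab; pose P := ProjOb (zero_projective Z0).
by rewrite (@KseltE _ P P) ?subrr // divrr // kaps_unit.
Qed.

Lemma Kelt_mul (a : K0 A) P : Kelt j a * kap P = Kelt j (a + K0_class (P : A)).
Proof.
have [P' [Q' ->]] := K0_projective A_ab A_her a.
have [S PS PSE] := kap_biproduct A_ab kapM P' P.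
rewrite (@KeltE (_ - _) P' Q') // (@KeltE (_ + _) S Q'); last first.
  by rewrite (K0_class_biproduct PS) addrAC.
by rewrite -PSE -!mulrA (kapCV A_ab kapM).
Qed.

Lemma Kselt_mul (a : K0 A) P : Kselt j a * kaps P = Kselt j (a + K0_class (P : A)).
Proof.
have [P' [Q' ->]] := K0_projective A_ab A_her a.
have [S PS PSE] := kap_biproduct A_ab kapsM P' P.
rewrite (@KseltE (_ - _) P' Q') // (@KseltE (_ + _) S Q'); last first.
  by rewrite (K0_class_biproduct PS) addrAC.
by rewrite -PSE -!mulrA (kapCV A_ab kapsM).
Qed.

(** Both orders give nonzero multiples of the class of the same biproduct. *)
Lemma kaps_kap P Q : exists2 c : C, c != 0 & kaps Q * kap P = c *: (kap P * kaps Q).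
Proof.
have [L PQ] := cplxP_biproduct A_ab (KP P) (KPs Q).
rewrite /kaps /kap (jb_mul PQ); last by left; exact: acyclic_KP.
rewrite (jb_mul (biproduct_sym PQ)); last by left; exact: acyclic_KPs.
have n1 := split_coef_neq0 t_sqrt (KPs Q : cplxCat A) (KP P).
have n2 := split_coef_neq0 t_sqrt (KP P : cplxCat A) (KPs Q).
exists (split_coef t (KPs Q : cplxCat A) (KP P) / split_coef t (KP P : cplxCat A) (KPs Q)).
  by rewrite mulf_neq0 ?invr_eq0.
by rewrite scalerA divfK.
Qed.

Lemma Kselt_kap (b : K0 A) P : exists2 c : C, c != 0 & Kselt j b * kap P = c *: (kap P * Kselt j b).
Proof.
have [P' [Q' bE]] := K0_projective A_ab A_her b; rewrite (KseltE bE).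
have [c c0 ec] := kaps_kap P P'; have [d d0 ed] := kaps_kap P Q'.
exists (c / d); first by rewrite mulf_neq0 ?invr_eq0.
have -> : kaps P' / kaps Q' * kap P = d^-1 *: (kaps P' * kap P / kaps Q').
  rewrite -!mulrA; have -> : (kaps Q')^-1 * kap P = d^-1 *: (kap P / kaps Q').
    apply: (mulIr (kaps_unit Q')); rewrite -scalerAl divrK ?kaps_unit //.
    apply: (mulrI (kaps_unit Q')); rewrite -scalerAr ed scalerA mulVf // scale1r.
    by rewrite !mulrA divrr ?kaps_unit // mul1r.
  by rewrite -scalerAr.
by rewrite ec -scalerAl scalerA mulrC -!mulrA.
Qed.

Local Notation e := (DHbasis j).
Implicit Types b : DHindex A.

Definition shift_index b (E : cplxP A) : DHindex A :=
  (b.1.1, b.1.2 + coimK E, b.2 + kerK E).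

(** The label of a complex: its minimal part, together with the two classes read off from its
    acyclic part. The class of [M] is then a nonzero multiple of [e b]. *)
Definition has_index M b := exists E : cplxP A,
  [/\ acyclic E, is_biproduct (repr (val b.1.1) : cplxCat A) E M,
      b.1.2 = coimK E & b.2 = kerK E].

Lemma acyclic_index E : acyclic E -> exists P Q,
  [/\ is_biproduct (KP P : cplxCat A) (KPs Q) E, coimK E = K0_class (P : A)
    & kerK E = K0_class (Q : A)].
Proof.
move=> aE; have [E1 E0] := cplxP_proj E.
have [P [Q PQ]] := acyclic_split A_ab A_ep A_her E1 E0 aE; exists P, Q; split=> //.
  by rewrite (coimK_biproduct A_ab PQ) coimK_KP // coimK_KPs // addr0.
by rewrite (kerK_biproduct A_ab PQ) kerK_KP // kerK_KPs // add0r.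
Qed.

Lemma jb_mulE M N L : is_biproduct (M : cplxCat A) N L -> acyclic M \/ acyclic N ->
  exists2 c : C, c != 0 & jb M * jb N = c *: jb L.
Proof.
move=> MN aMN; rewrite (jb_mul MN aMN).
by exists (split_coef t (M : cplxCat A) N) => //; exact: split_coef_neq0.
Qed.

Lemma scale_inv (V : lmodType C) (c : C) (x y : V) : c != 0 -> x = c *: y -> y = c^-1 *: x.
Proof. by move=> c0 ->; rewrite scalerA mulVf // scale1r. Qed.

Lemma jb_acyclic E P Q : is_biproduct (KP P : cplxCat A) (KPs Q) E ->
  exists2 c : C, c != 0 & jb E = c *: (kap P * kaps Q).
Proof.
move=> PQ; have [|c c0 /(scale_inv c0) ->] := jb_mulE PQ.
  by left; exact: acyclic_KP.
by exists c^-1 => //; rewrite invr_eq0.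
Qed.

Lemma bracket_repr (m : IsoCP A) : bracket R (repr m) = << m >>.
Proof. by rewrite /bracket /iso_class reprK. Qed.

Lemma DHbasis_mul b E : acyclic E ->
  exists2 c : C, c != 0 & e b * jb E = c *: e (shift_index b E).
Proof.
move=> aE; have [P [Q [PQ aP bQ]]] := acyclic_index aE.
have [c c0 ->] := jb_acyclic PQ.
have [d d0 ed] := Kselt_kap b.2 P.
exists (c * d); first exact: mulf_neq0.
rewrite /DHbasis /= aP bQ -(Kelt_mul).
rewrite -(Kselt_mul).
by rewrite -scalerAr -!mulrA (mulrA (Kselt _ _)) ed -!scalerAl -!scalerAr scalerA !mulrA.
Qed.

Lemma has_index_jb M b : has_index M b -> exists2 c : C, c != 0 & jb M = c *: e b.
Proof.
move=> [E [aE bM bc bk]]; have [|c c0 /(scale_inv c0) jM] := jb_mulE bM; first by right.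
have [P [Q [PQ aP bQ]]] := acyclic_index aE.
have [d d0 jE] := jb_acyclic PQ.
exists (c^-1 * d); first by rewrite mulf_neq0 ?invr_eq0.
rewrite jM jE bracket_repr /DHbasis bc bk aP bQ -scalerAr scalerA mulrA.
have -> : K0_class (P : A) = 0 + K0_class (P : A) by rewrite add0r.
have -> : K0_class (Q : A) = 0 + K0_class (Q : A) by rewrite add0r.
rewrite -(Kelt_mul) -(Kselt_mul).
by rewrite Kelt0 Kselt0 !mul1r.
Qed.

(** The minimal parts agree by [minimal_part_unique]. The other two entries follow by cancellation,
    as [coimK] and [kerK] are additive isomorphism invariants of the whole complex. *)
Lemma has_index_unique M M' b b' :
  has_index M b -> has_index M' b' -> iso (M : cplxCat A) M' -> b = b'.
Proof.
case: b b' => [[[n nm] x] y] [[[n' nm'] x'] y'].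
move=> [E [aE bM /= -> ->]] [E' [aE' bM' /= -> ->]] MM' /=.
have bM2 := biproduct_iso bM MM'.
have /asboolP nm1 := nm; have /asboolP nm1' := nm'.
have nn' : iso (repr n : cplxCat A) (repr n').
  apply: (minimal_part_unique A_ab A_ep nm1 nm1' _ _ bM2 bM').
    exact/(acyclicPE A_ab A_ep A_her).
  exact/(acyclicPE A_ab A_ep A_her).
have nE : n = n' by rewrite -[n]reprK -[n']reprK; apply/iso_classP.
congr (_, _, _); first by apply: val_inj.
  apply: (addrI (coimK (repr n))); rewrite -(coimK_biproduct A_ab bM2).
  by rewrite (coimK_iso A_ab nn') -(coimK_biproduct A_ab bM').
apply: (addrI (kerK (repr n))); rewrite -(kerK_biproduct A_ab bM2).
by rewrite (kerK_iso A_ab nn') -(kerK_biproduct A_ab bM').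
Qed.

Lemma has_index_exists M : exists b, has_index M b.
Proof.
have [N [E [Nm aE NE]]] := minimal_decomposition A_ab A_ep A_her M.
have nN := iso_sym (cobj_iso N).
have nm : `[< minimal (repr (iso_class N)) >] by apply/asboolP; exact: minimal_iso nN Nm.
exists (exist (fun N : IsoCP A => `[< minimal (repr N) >]) _ nm, coimK E, kerK E), E.
by split=> //; exact: biproduct_isol nN NE.
Qed.

Lemma has_index_shift M E L b : acyclic E -> is_biproduct (M : cplxCat A) E L ->
  has_index M b -> has_index L (shift_index b E).
Proof.
move=> aE ME [E' [aE' bM bc bk]].
have [V EV] := cplxP_biproduct A_ab E' E.
exists V; split=> /=.
- exact: acyclic_biproduct EV aE' aE.
- apply: (biproductA (biproduct_sym ME) bM EV).
- by rewrite bc (coimK_biproduct A_ab EV).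
- by rewrite bk (kerK_biproduct A_ab EV).
Qed.

(* Every finite family of basis elements becomes, up to scalars, a family of
   classes of complexes after multiplication by a common acyclic class. *)
Lemma common_denominator (r : seq (DHindex A)) : exists2 E : cplxP A, acyclic E &
  forall b, b \in r -> exists M, has_index M (shift_index b E).
Proof.
elim: r => [|b r [E aE IH]].
  have [Z Z0] := ab_zero A_ab; pose P := ProjOb (zero_projective Z0).
  by exists (KP P) => //; exact: acyclic_KP.
have [P [Q bc]] := K0_projective A_ab A_her b.1.2.
have [P' [Q' bk]] := K0_projective A_ab A_her b.2.
(* [F] clears the denominators Q, Q' of the two entries of [b]; the numerators P, P' remain and form
   the acyclic part [G]. *)
have [F PF] := cplxP_biproduct A_ab (KP Q) (KPs Q').
have aF : acyclic F.
  by apply: (acyclic_biproduct A_ab A_ep A_her PF); [exact: acyclic_KP|exact: acyclic_KPs].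
have [G PG] := cplxP_biproduct A_ab (KP P) (KPs P').
have aG : acyclic G.
  by apply: (acyclic_biproduct A_ab A_ep A_her PG); [exact: acyclic_KP|exact: acyclic_KPs].
have shM b1 E1 E2 E3 : is_biproduct (E1 : cplxCat A) E2 E3 ->
    shift_index b1 E3 = shift_index (shift_index b1 E1) E2.
  move=> E12; rewrite /shift_index (coimK_biproduct A_ab E12) (kerK_biproduct A_ab E12).
  by rewrite /= !addrA.
have [V EV] := cplxP_biproduct A_ab E F.
have aV : acyclic V := acyclic_biproduct A_ab A_ep A_her EV aE aF.
exists V => // b1; rewrite inE => /orP [/eqP ->|/IH [M bM]].
  have [M bM] := cplxP_biproduct A_ab (repr (val b.1.1)) G.
  have [L ML] := cplxP_biproduct A_ab M E.
  exists L; rewrite (shM _ _ _ _ (biproduct_sym EV)); apply: has_index_shift aE ML _.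
  exists G; split=> //=; rewrite ?bc ?bk.
    rewrite (coimK_biproduct A_ab PF) (coimK_biproduct A_ab PG) !coimK_KP // !coimK_KPs //.
    by rewrite !addr0 subrK.
  rewrite (kerK_biproduct A_ab PF) (kerK_biproduct A_ab PG) !kerK_KP // !kerK_KPs //.
  by rewrite !add0r subrK.
have [L ML] := cplxP_biproduct A_ab M F.
by exists L; rewrite (shM _ _ _ _ EV); apply: has_index_shift aF ML bM.
Qed.

(** Products of acyclic classes are multiples of the class of one biproduct, so each denominator may
    be taken to be a single bracket. *)
Lemma acyclic_monoid_bracket s : acyclic_monoid t s ->
  exists (E : cplxP A) (c : C), [/\ acyclic E, c != 0 & s = c *: bracket R E].
Proof.
elim=> [M aM|x y _ [E [c [aE c0 ->]]] _ [F [d [aF d0 ->]]]].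
  by exists M, 1; rewrite oner_neq0 scale1r.
have [G EF] := cplxP_biproduct A_ab E F.
exists G, (c * d * split_coef t (E : cplxCat A) F); split.
- exact: acyclic_biproduct EF aE aF.
- by apply: mulf_neq0; [exact: mulf_neq0|exact: split_coef_neq0].
- have := hall_mul_split A_ab A_ep A_her t EF (or_introl aE).
  rewrite /hall_mul /bracket !fglift1 => h.
  by rewrite fgliftZ fglift1 fgliftZ fglift1 h !scalerA.
Qed.

Lemma DHbasis_div b E : acyclic E -> exists c b', e b / jb E = c *: e b'.
Proof.
move=> aE; pose b' : DHindex A := (b.1.1, b.1.2 - coimK E, b.2 - kerK E).
have [c c0] := DHbasis_mul b' aE.
have -> : shift_index b' E = b by rewrite /shift_index /= !subrK; case: b {b'} => [[]].
move=> /(scale_inv c0) ->; exists c^-1, b'.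
by rewrite -scalerAl mulrK // (loc_unit DH_loc).
Qed.

Lemma DHbasis_span x : exists c, expansion e x c.
Proof.
have [y [s [ms ->]]] := loc_frac DH_loc x.
have [E [d [aE d0 ->]]] := acyclic_monoid_bracket ms.
have uE : jb E \is a GRing.unit := loc_unit DH_loc aE.
have -> : j y / j (d *: bracket R E) = d^-1 *: (j y / jb E).
  by rewrite linearZ /= invrZ ?unitfE // -scalerAr.
have expZ c z : (exists f, expansion e z f) -> exists f, expansion e (c *: z) f.
  move=> [f zf]; exists (fun b => c * f b + 0).
  by have := expansionD c zf (expansion0 e); rewrite addr0.
apply: expZ; rewrite -(freeg_sumE y) linear_sum mulr_suml.
elim: (dom y) => [|m r [f IH]]; first by rewrite big_nil; exists (fun=> 0); exact: expansion0.
rewrite big_cons freegZU linearZ -scalerAl -bracket_repr /=.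
have [b /has_index_jb [c c0 ->]] := has_index_exists (repr m).
rewrite -scalerAl scalerA; have [c' [b' ->]] := DHbasis_div b aE; rewrite scalerA.
eexists; exact: expansionD (expansion1 e b') IH.
Qed.

(** A common acyclic factor turns the relation into one between images of brackets. By [loc_ker] it
    already holds in [Htw] after one more acyclic factor [G], and there distinct isomorphism classes
    are independent. *)
Lemma DHbasis_free (r : seq (DHindex A)) (c : DHindex A -> C) : uniq r ->
  \sum_(b <- r) c b *: e b = 0 -> {in r, forall b, c b = 0}.
Proof.
move=> ur c0; have [E aE hE] := common_denominator r.
have /choice [f hf] b : exists Mu : cplxP A * C, b \in r ->
    [/\ has_index Mu.1 (shift_index b E), Mu.2 != 0 & e b * jb E = Mu.2 *: jb Mu.1].
  have [br|] := boolP (b \in r); last by exists (E, 0).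
  have [M bM] := hE b br; have [d d0 jM] := has_index_jb bM.
  have [d' d'0 eE] := DHbasis_mul b aE.
  exists (M, d' / d) => _; split=> //=; first by rewrite mulf_neq0 ?invr_eq0.
  by rewrite eE jM scalerA divfK.
have : j (\sum_(b <- r) (c b * (f b).2) *: bracket R (f b).1) = 0.
  transitivity ((\sum_(b <- r) c b *: e b) * jb E); last by rewrite c0 mul0r.
  rewrite linear_sum mulr_suml big_seq [RHS]big_seq; apply: eq_bigr => b /hf [_ _ eE].
  by rewrite linearZ -scalerAl eE scalerA.
move=> /(loc_ker DH_loc) [s ms]; have [G [d [aG d0 ->]]] := acyclic_monoid_bracket ms.
have /choice [g hg] b : exists Lv : cplxP A * C,
    [/\ is_biproduct ((f b).1 : cplxCat A) G Lv.1, Lv.2 != 0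
      & hall_mul t (bracket R (f b).1) (bracket R G) = Lv.2 *: bracket R Lv.1].
  have [L ML] := cplxP_biproduct A_ab (f b).1 G.
  exists (L, split_coef t ((f b).1 : cplxCat A) G); split=> //.
    exact: split_coef_neq0.
  by apply: hall_mul_split => //; right.
(* Adding acyclic complexes only translates the label, and the label is an isomorphism invariant, so
   different indices stay different. *)
have gi b b' : b \in r -> b' \in r -> iso_class (g b).1 = iso_class (g b').1 -> b = b'.
  move=> /hf [bM _ _] /hf [bM' _ _] /iso_classP gg.
  have [bL _ _] := hg b; have [bL' _ _] := hg b'.
  have := has_index_unique (has_index_shift aG bL bM) (has_index_shift aG bL' bM') gg.
  case: b b' {bM bM' bL bL' gg} => [[n x] y] [[n' x'] y'] [-> /addIr /addIr -> /addIr /addIr ->].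
  by [].
rewrite /hall_mul fglift_sum.
under eq_bigr => b _.
  have [_ _] := hg b; rewrite /hall_mul /bracket !fglift1 fgliftZ fglift1 fgliftZ fglift1 => ->.
  rewrite !scalerA; over.
move=> z b br; have [_ fb _] := hf b br; have [_ gb _] := hg b.
have := f_equal (coeff (iso_class (g b).1)) z; rewrite raddf0 raddf_sum (bigD1_seq b) //=.
rewrite big_seq_cond big1 => [|b' /andP [b'r b'b]].
  rewrite addr0 coeffZ coeffU eqxx !mulr1 => /eqP.
  by rewrite !mulf_eq0 (negPf fb) (negPf gb) (negPf d0) !orbF => /eqP.
rewrite coeffZ coeffU mul1r; case: eqP => [/(gi _ _ b'r br) bb|_]; last by rewrite mulr0.
by rewrite bb eqxx in b'b.
Qed.

Lemma DHbasis_is_basis : is_basis e.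
Proof. by apply: is_basisI; [exact: DHbasis_span|exact: DHbasis_free]. Qed.

End DerivedHall.

(** * Counting extensions and filtrations *)

Section Riedtmann.
Variables (k : finFieldType) (B : linCat k).
Implicit Types X Y L M N : B.

Definition ses_set M N L : set (hom N L * hom L M) := [set ip | short_exact ip.1 ip.2].

Lemma ext_transport M N L (E : extension M N) (f : hom (ext_mid E) L) : is_iso f ->
  exists ip : hom N L * hom L M,
    [/\ ses_set ip, f ∘ ext_inc E = ip.1 & ip.2 ∘ f = ext_proj E].
Proof.
move=> [g [gf fg]]; exists (f ∘ ext_inc E, ext_proj E ∘ g); split=> //=.
  exact: short_exact_iso gf fg (ext_exact E).
by rewrite -compA gf compm1.
Qed.

(* Aut L acts on the set of pairs (i, p); its orbits are the extension classes
   with middle term L and the stabilizer of (i, p) is {1 + i phi p | phi}. *)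
Lemma riedtmann M N L :
  (ncard (@ses_set M N L) * ncard [set: hom M N] =
   ncard (Ext1_mid L : set (Ext1 M N)) * ncard (@automorphisms _ _ L))%N.
Proof.
pose T : set (hom N L * hom L M) := @ses_set M N L.
have /choice [rep hrep] (xi : Ext1 M N) : exists ip : hom N L * hom L M, Ext1_mid L xi ->
    T ip /\ exists f : hom (ext_mid (repr xi)) L,
      [/\ is_iso f, f ∘ ext_inc (repr xi) = ip.1 & ip.2 ∘ f = ext_proj (repr xi)].
  have [[f fi]|h] := EM (Ext1_mid L xi); last by exists (0, 0).
  have [ip [Tip e1 e2]] := ext_transport fi.
  by exists ip => _; split=> //; exists f.
have repI xi xi' : Ext1_mid L xi -> Ext1_mid L xi' ->
    (exists g, [/\ is_iso g, g ∘ (rep xi).1 = (rep xi').1 & (rep xi').2 ∘ g = (rep xi).2]) ->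
    xi = xi'.
  move=> /hrep [_ [f [fi f1 f2]]] /hrep [_ [f' [[g' [g'f' f'g']] f1' f2']]] [g [gi g1 g2]].
  rewrite -[xi]reprK -[xi']reprK; apply/eqmodP/asboolP.
  exists (g' ∘ (g ∘ f)); split.
  - by apply: is_iso_comp (is_iso_comp gi fi); exists f'.
  - by rewrite -!compA f1 g1 -f1' compA g'f' comp1m.
  - by rewrite -f2' -!compA (compA f') f'g' comp1m compA g2 f2.
(* [Ext1] is a quotient of a possibly infinite type of extensions; the chosen pairs embed the
   classes with middle term [L] into a finite set. *)
have fE : finite_set (Ext1_mid L : set (Ext1 M N)).
  have ri : {in (Ext1_mid L : set (Ext1 M N)) &, injective rep}.
    move=> xi xi'; rewrite !inE => hx hx' e; apply: repI => //.
    by exists (idm _); rewrite e comp1m compm1; split=> //; exact: is_iso_idm.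
  by rewrite -(eq_finite_set (inj_card_eq ri)); exact: vect_finite2.
have fA : finite_set (@automorphisms _ _ L) by exact: vect_finite.
rewrite -[RHS]muln1 -(ncardX fE fA).
(* The relation says that the automorphism carries the chosen pair of the class to (i, p). A pair
   (i, p) has |Hom(M, N)| partners, while a class with an automorphism has exactly one. *)
apply: (double_count (r := fun (ip : hom N L * hom L M) (y : Ext1 M N * hom L L) =>
  y.2 ∘ (rep y.1).1 = ip.1 /\ ip.2 ∘ y.2 = (rep y.1).2)).
- exact: vect_finite2.
- exact: finite_setX.
- move=> ip Tip; pose E := Extension Tip; pose xi : Ext1 M N := \pi_(Ext1 M N)%qT E.
  have [f [fi f1 f2]] : exists f : hom (ext_mid (repr xi)) (ext_mid E),
      [/\ is_iso f, f ∘ ext_inc (repr xi) = ext_inc E & ext_proj E ∘ f = ext_proj (repr xi)].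
    by have /eqmodP/asboolP : repr xi = E %[mod Ext1 M N]%qT by rewrite reprK.
  have xiL : Ext1_mid L xi by exists f.
  have [[kr cr] [f' [f'i f1' f2']]] := hrep _ xiL; have [f'' [f''f f'f'']] := f'i.
  pose g0 : hom L L := f ∘ f''.
  have g0i : is_iso g0 by apply: is_iso_comp fi _; exists f'.
  have [g' [g'g gg']] := g0i.
  have g1 : g0 ∘ (rep xi).1 = ip.1 by rewrite -f1' -compA (compA f'') f''f comp1m f1.
  have g2 : ip.2 ∘ g0 = (rep xi).2 by rewrite compA (f2 : ip.2 ∘ f = _) -f2' -compA f'f'' compm1.
  have [ki ci] := Tip; have rm := is_kernel_mono kr; have re := is_cokernel_epi cr.
  rewrite -(ncard_image (f := fun phi : hom M N => (xi, g0 + ip.1 ∘ phi ∘ (rep xi).2)));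
    first 1 last.
  + exact: vect_finite.
  + move=> phi psi _ _ [] /addrI h; apply: (is_kernel_mono ki).
    by apply: re; exact: h.
  congr ncard; apply/seteqP; split=> [[xi' g] /= [[xi'L [h [hg gh]]] [e1 e2]]|y [phi _ <-]] /=.
    have xixi : xi' = xi.
      apply: repI => //; exists (g' ∘ g); split.
      + by apply: is_iso_comp; [exists g0 | exists h].
      + by rewrite -compA e1 -g1 compA g'g comp1m.
      + by rewrite -g2 -compA (compA g0) gg' comp1m e2.
    rewrite {}xixi in e1 e2 *.
    have [|u uE] := is_cokernel_desc (u := g - g0) cr; first by rewrite compBl e1 g1 subrr.
    have [|phi phiE] := is_kernel_lift (u := u) ki.
      by apply: (epi_eq0 re); rewrite -compA uE compBr e2 g2 subrr.
    by exists phi => //; rewrite phiE uE addrC subrK.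
  split; [split=> //|split].
  (* [n] has square zero, so 1 + n is invertible with inverse 1 - n. *)
  + pose n := (rep xi).1 ∘ phi ∘ (rep xi).2.
    have nn : n ∘ n = 0 by rewrite /n -!compA (compA (rep xi).2) kr.1 comp0m !compm0.
    have -> : g0 + ip.1 ∘ phi ∘ (rep xi).2 = g0 ∘ (idm L + n).
      by rewrite compDr compm1 /n !compA g1.
    apply: is_iso_comp g0i _; exists (idm L - n).
    by split; rewrite ?(compBl, compBr) ?(compDl, compDr) ?(compBl, compBr) !comp1m
      ?compm1 nn ?addr0 ?subr0 ?addrK ?subrK.
  + by rewrite compDl g1 -!compA kr.1 !compm0 addr0.
  + by rewrite compDr g2 !compA ki.1 !comp0m addr0.
- move=> [xi g] /= [xiL [g' [g'g gg']]]; have [Txi _] := hrep _ xiL.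
  apply: (@ncard_unique _ _ (g ∘ (rep xi).1, (rep xi).2 ∘ g')).
    split=> //=; first exact: short_exact_iso g'g gg' Txi.
    by rewrite -compA g'g compm1.
  move=> [i p] /= [_ [<- <-]]; by rewrite -compA gg' compm1.
Qed.

End Riedtmann.

(** * Two-step filtrations with prescribed outer maps *)

Section Filtrations.
Variables (k : finFieldType) (B : linCat k).
Hypotheses (B_ab : abelian B) (B_ep : enough_projectives B).
Variables M1 M2 M3 L : B.
Implicit Types (X Y : B) (z : hom M3 L * hom L M1).

(** [z] records the inclusion of [M3] in [L] and the projection of [L] onto [M1]: the data common to
    both presentations of a filtration. *)
Definition quot_filtrations X z : set ((hom M3 L * hom L X) * (hom M2 X * hom X M1)) :=
  [set q | (@ses_set _ _ X M3 L `*` @ses_set _ _ M1 M2 X) q /\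
           (q.1.1, q.2.2 ∘ q.1.2) = z].

Definition sub_filtrations Y z : set ((hom M3 Y * hom Y M2) * (hom Y L * hom L M1)) :=
  [set q | (@ses_set _ _ M2 M3 Y `*` @ses_set _ _ M1 Y L) q /\
           (q.2.1 ∘ q.1.1, q.2.2) = z].

Arguments quot_filtrations : clear implicits.
Arguments sub_filtrations : clear implicits.

Lemma vect_finite4 (V1 V2 V3 V4 : vectType k) (S : set ((V1 * V2) * (V3 * V4))) : finite_set S.
Proof.
apply: (sub_finite_set (B := setT `*` setT)) => //.
exact: finite_setX (vect_finite2 _) (vect_finite2 _).
Qed.

(** A nonempty fibre is a torsor under Aut X and Aut M2: L -> X is a cokernel of a fixed map, and M2
    -> X is then a kernel. The pair (g, h) sends the base point (p0, j0, q0) to (g p0, g j0 h, q0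
    g^-1). *)
Lemma quot_filtrations_card X z q : quot_filtrations X z q ->
  ncard (quot_filtrations X z) = (ncard (@automorphisms _ _ X) * ncard (@automorphisms _ _ M2))%N.
Proof.
case: z q => [i r] [[i0 p0] [j0 q0]] [[/= s1 s2] [ei er]]; subst i r.
rewrite -ncardX; try exact: vect_finite.
apply: (ncard_bij (r := fun q y => [/\ y.1 ∘ p0 = q.1.2, q.2.1 = y.1 ∘ j0 ∘ y.2
  & q.2.2 ∘ y.1 = q0])).
- exact: vect_finite4.
- exact: vect_finite2.
- move=> [[i1 p] [j q]] [[/= t1 t2] [ei er]]; rewrite {}ei in t1 *.
  have [g [g' [g'g gg']] gp] := is_cokernel_unique s1.2 t1.2.
  have qg : q ∘ g = q0 by apply: (is_cokernel_epi s1.2); rewrite -compA gp.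
  have kj : is_kernel q (g ∘ j0).
    have := (short_exact_iso g'g gg' s2).1; rewrite -qg -compA gg' compm1 //.
  have [h hi jh] := is_kernel_unique t2.1 kj.
  exists (g, h); split=> //=; first by split=> //; exists g'.
  move=> [g2 h2] _ /= [gp2 jE _].
  have gE : g2 = g by apply: (is_cokernel_epi s1.2); rewrite gp2 gp.
  congr (_, _); first by [].
  by apply: (is_kernel_mono kj); rewrite jh -gE -jE.
- move=> [g h] [/= [g' [g'g gg']] [h' [h'h hh']]].
  exists ((i0, g ∘ p0), (g ∘ j0 ∘ h, q0 ∘ g')); split=> /=.
  + split; last by rewrite /= -compA (compA g') g'g comp1m.
    split=> /=.
      have := short_exact_iso (comp1m (idm L)) (comp1m (idm L)) s1.
      move=> _; split.
        apply: is_kernelI; first by rewrite -compA s1.1.1 compm0.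
          exact: is_kernel_mono s1.1.
        move=> W u; rewrite -compA => /(mono_eq0 (split_mono g'g)).
        exact: is_kernel_lift s1.1.
      by apply: is_cokernel_isol s1.2; exists g'.
    have [kj cj] := short_exact_iso g'g gg' s2; split.
      by apply: is_kernel_isor kj; exists h'.
    apply: is_cokernelI.
    * by rewrite !compA -[q0 ∘ g' ∘ g ∘ j0]compA kj.1 comp0m.
    * exact: is_cokernel_epi cj.
    * move=> W u; rewrite compA => /(epi_eq0 (split_epi hh')); exact: is_cokernel_desc cj.
  + by split=> //; rewrite -compA g'g compm1.
  + move=> [[i1 p] [j q]] /= [_ [-> _]] [<- -> <-].
    by rewrite -(compA q) gg' compm1.
Qed.

Lemma sub_filtrations_card Y z q : sub_filtrations Y z q ->
  ncard (sub_filtrations Y z) = (ncard (@automorphisms _ _ Y) * ncard (@automorphisms _ _ M2))%N.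
Proof.
case: z q => [i r] [[u0 v0] [w0 r0]] [[/= s1 s2] [ei er]]; subst i r.
rewrite -ncardX; try exact: vect_finite.
apply: (ncard_bij (r := fun q y => [/\ y.1 ∘ u0 = q.1.1, q.1.2 ∘ y.1 = y.2 ∘ v0
  & q.2.1 ∘ y.1 = w0])).
- exact: vect_finite4.
- exact: vect_finite2.
- move=> [[u v] [w r1]] [[/= t1 t2] [ei er]]; rewrite {}er in t2 *.
  have [g [g' [g'g gg']] wg] := is_kernel_unique s2.1 t2.1.
  have gu : g ∘ u0 = u by apply: (is_kernel_mono t2.1); rewrite compA wg.
  have cv : is_cokernel u0 (v ∘ g).
    have := (short_exact_iso gg' g'g t1).2; rewrite -gu compA g'g comp1m //.
  have [h hi hv] := is_cokernel_unique s1.2 cv.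
  exists (g, h); split=> //=; first by split=> //; exists g'.
  move=> [g2 h2] _ /= [_ vE wg2].
  have gE : g2 = g by apply: (is_kernel_mono t2.1); rewrite wg2 wg.
  congr (_, _); first by [].
  by apply: (is_cokernel_epi s1.2); rewrite -vE gE hv.
- move=> [g h] [/= [g' [g'g gg']] [h' [h'h hh']]].
  exists ((g ∘ u0, h ∘ v0 ∘ g'), (w0 ∘ g', r0)); split=> /=.
  + split; last by rewrite /= -compA (compA g') g'g comp1m.
    split=> /=.
      have [kj cj] := short_exact_iso g'g gg' s1; rewrite -compA; split.
        apply: is_kernelI; first by rewrite -compA kj.1 compm0.
          exact: is_kernel_mono kj.
        move=> W u; rewrite -compA => /(mono_eq0 (split_mono h'h)).
        exact: is_kernel_lift kj.
      by apply: is_cokernel_isol cj; exists h'.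
    split; first by apply: is_kernel_isor s2.1; exists g.
    apply: is_cokernelI; first by rewrite compA s2.1.1 comp0m.
      exact: is_cokernel_epi s2.2.
    move=> W u; rewrite compA => /(epi_eq0 (split_epi g'g)); exact: is_cokernel_desc s2.2.
  + by split=> //; rewrite -compA g'g compm1.
  + move=> [[u v] [w r1]] /= [_ [_ ->]] [<- e <-].
    by rewrite -e -!compA gg' !compm1.
Qed.

(** [X] is a cokernel of [z.1], so each [z] occurs for one isomorphism class only. *)
Lemma quot_filtrations_iso X X' z q q' :
  quot_filtrations X z q -> quot_filtrations X' z q' -> iso X X'.
Proof.
case: z q q' => [i r] [[i0 p] [j s]] [[i1 p'] [j' s']] [[/= a _] [ei _]] [[/= b _] [ei' _]].
rewrite {}ei in a; rewrite {}ei' in b.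
by have [g gi _] := is_cokernel_unique a.2 b.2; exists g.
Qed.

Lemma sub_filtrations_iso Y Y' z q q' :
  sub_filtrations Y z q -> sub_filtrations Y' z q' -> iso Y Y'.
Proof.
case: z q q' => [i r] [[u v] [w s]] [[u' v'] [w' s']] [[/= _ a] [_ er]] [[/= _ b] [_ er']].
rewrite {}er in a; rewrite {}er' in b.
by have [g gi _] := is_kernel_unique a.1 b.1; exists g.
Qed.

Lemma quot_filtrations_transport X X' z q : iso X X' ->
  quot_filtrations X z q -> exists q', quot_filtrations X' z q'.
Proof.
move=> [f [g [gf fg]]]; case: q => [[i p] [j s]] [[/= a b] e].
exists ((i, f ∘ p), (f ∘ j, s ∘ g)); split=> /=; last first.
  by rewrite -compA (compA g) gf comp1m.
split=> /=; last exact: short_exact_iso gf fg b.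
split; last by apply: is_cokernel_isol a.2; exists g.
apply: is_kernelI; first by rewrite -compA a.1.1 compm0.
  exact: is_kernel_mono a.1.
move=> W u; rewrite -compA => /(mono_eq0 (split_mono gf)).
exact: is_kernel_lift a.1.
Qed.

Lemma sub_filtrations_transport Y Y' z q : iso Y Y' ->
  sub_filtrations Y z q -> exists q', sub_filtrations Y' z q'.
Proof.
move=> [f [g [gf fg]]]; case: q => [[u v] [w s]] [[/= a b] e].
exists ((f ∘ u, v ∘ g), (w ∘ g, s)); split=> /=; last first.
  by rewrite -compA (compA g) gf comp1m.
split=> /=; first exact: short_exact_iso gf fg a.
split; first by apply: is_kernel_isor b.1; exists f.
apply: is_cokernelI; first by rewrite compA b.1.1 comp0m.
  exact: is_cokernel_epi b.2.
move=> W x; rewrite compA => /(epi_eq0 (split_epi gf)).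
exact: is_cokernel_desc b.2.
Qed.

Lemma filtrations_sub X z q : quot_filtrations X z q -> exists Y q', sub_filtrations Y z q'.
Proof.
case: q => [[i p] [j s]] [[/= a b] <-] /=.
have [Y [u [v [w [uv wr wu _]]]]] := noether_sub B_ab B_ep a b.
by exists Y, ((u, v), (w, s ∘ p)); split=> //=; rewrite wu.
Qed.

Lemma filtrations_quot Y z q : sub_filtrations Y z q -> exists X q', quot_filtrations X z q'.
Proof.
case: q => [[u v] [w r]] [[/= a b] <-] /=.
have [X [p [j [s [up js sp _]]]]] := noether_quot B_ab B_ep a b.
by exists X, ((w ∘ u, p), (j, s)); split=> //=; rewrite sp.
Qed.

End Filtrations.

(** * The coproduct *)

Section LinearExtension.
Variables (F : fieldType) (V : lmodType F) (B : choiceType) (e : B -> V).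
Hypothesis eB : is_basis e.

Lemma coord_sumE (f : B -> F) x (r : seq B) : uniq r -> (forall b, coord e x b != 0 -> b \in r) ->
  \sum_(b \in [set: B]) coord e x b * f b = \sum_(b <- r) coord e x b * f b.
Proof.
move=> ur cr; apply: fsum_seq => // b br.
by have [->|/cr cb] := eqVneq (coord e x b) 0; [rewrite mul0r | rewrite cb in br].
Qed.

Lemma coord_support x : exists2 r : seq B, uniq r & forall b, coord e x b != 0 -> b \in r.
Proof. by have /expansionP [r [ur cr _]] := coordP eB x; exists r. Qed.

Lemma coord_sum_linear (f : B -> F) a x y :
  \sum_(b \in [set: B]) coord e (a *: x + y) b * f b =
  a * (\sum_(b \in [set: B]) coord e x b * f b) + \sum_(b \in [set: B]) coord e y b * f b.
Proof.
have [r ur cr] := coord_support x; have [s us ds] := coord_support y.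
pose w := undup (r ++ s); have uw : uniq w := undup_uniq _.
have cw b : coord e x b != 0 -> b \in w by move=> /cr h; rewrite mem_undup mem_cat h.
have dw b : coord e y b != 0 -> b \in w by move=> /ds h; rewrite mem_undup mem_cat h orbT.
rewrite (coord_sumE _ uw cw) (coord_sumE _ uw dw) (@coord_sumE _ _ w) // => [|b].
  rewrite big_distrr -big_split /=; apply: eq_bigr => b _.
  by rewrite coord_linear // mulrDl mulrA.
apply: contraR => bw; rewrite coord_linear //.
by rewrite (contraNeq (cw b) bw) (contraNeq (dw b) bw) mulr0 addr0.
Qed.

Lemma coord_sum_basis (f : B -> F) b : \sum_(b' \in [set: B]) coord e (e b) b' * f b' = f b.
Proof.
rewrite (@fsum_single _ _ b) ?coordE // ?eqxx ?mul1r // => b' /eqP bb.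
by rewrite coordE // eq_sym (negPf bb) mul0r.
Qed.

End LinearExtension.

(** The outer support is contained in the image of the list [s] under [a], hence finite. *)
Lemma fsum_exchange_single (F : nmodType) (I J : choiceType) (s : seq J) (f : I -> J -> F) (a : J -> I) :
  (forall i z, i <> a z -> f i z = 0) ->
  \sum_(i \in [set: I]) \sum_(z <- s) f i z = \sum_(z <- s) \sum_(i \in [set: I]) f i z.
Proof.
move=> fa; pose r := undup (map a s); have ur : uniq r := undup_uniq _.
have ar z : z \in s -> a z \in r by move=> zs; rewrite mem_undup map_f.
rewrite (@fsum_seq _ _ r) // => [|i ir].
  rewrite exchange_big big_seq [RHS]big_seq; apply: eq_bigr => z zs.
  rewrite (@fsum_seq _ _ r) // => i ir; apply: fa => ia.
  by rewrite ia ar in ir.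
rewrite big_seq big1 // => z zs; apply: fa => ia.
by rewrite ia ar in ir.
Qed.

Section FiniteExtensions.
Variables (k : finFieldType) (B : linCat k).
Hypotheses (B_ab : abelian B) (B_ep : enough_projectives B).

(* An extension of M by N is the pushout of 0 -> K -> P -> M -> 0 along a map
   K -> N, and this map determines the middle term. *)
Lemma extension_mid_finite (M N : B) : exists (K : B) (r : forall L, hom N L * hom L M -> hom K N),
  forall L L' ip ip', @ses_set _ _ M N L ip -> @ses_set _ _ M N L' ip' ->
    r L ip = r L' ip' -> iso L L'.
Proof.
have [P [pi [Pp pie]]] := B_ep M; have [K [io io_pi]] := epi_short_exact B_ab pie.
have [S NP] := ab_biproduct B_ab N P; have [i1 [i2 [p1 [p2 [e1 e2 e3 e4 e5]]]]] := NP.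
have ex L (ip : hom N L * hom L M) : exists f : hom K N, ses_set ip ->
    exists q : hom S L, is_cokernel (i2 ∘ io - i1 ∘ f) q.
  have [[/= ki cp]|h] := EM (ses_set ip); last by exists 0.
  have pe := is_cokernel_epi cp; have [g pg] := Pp _ _ _ pe pi.
  have [|f fE] := is_kernel_lift (u := g ∘ io) ki; first by rewrite compA pg io_pi.1.1.
  exists f => _; pose q := ip.1 ∘ p1 + g ∘ p2; exists q.
  have qi1 : q ∘ i1 = ip.1 by rewrite /q compDl -!compA e1 e4 compm1 compm0 addr0.
  have qi2 : q ∘ i2 = g by rewrite /q compDl -!compA e2 e3 compm1 compm0 add0r.
  apply: (epi_is_cokernel B_ab).
    apply: epi0 => W z zq; have z1 : z ∘ ip.1 = 0 by rewrite -qi1 compA zq comp0m.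
    have z2 : z ∘ g = 0 by rewrite -qi2 compA zq comp0m.
    have [z' z'E] := is_cokernel_desc cp z1.
    by rewrite -z'E (epi_eq0 pie (u := z')) ?comp0m // -pg compA z'E.
  apply: is_kernelI.
  - by rewrite compBr !compA qi1 qi2 fE subrr.
  - apply: mono0 => W u /(f_equal (fun x => p2 ∘ x)).
    rewrite compm0 compA compBr !compA e2 e4 comp1m comp0m subr0.
    exact: mono_eq0 (is_kernel_mono io_pi.1).
  - move=> W u; rewrite /q compDl => qu.
    have [|v vE] := is_kernel_lift (u := p2 ∘ u) io_pi.1.
      have := f_equal (fun x => ip.2 ∘ x) qu.
      by rewrite compm0 compDr !compA ki.1 pg !comp0m add0r.
    have p1u : p1 ∘ u = - (f ∘ v).
      apply: (is_kernel_mono ki); rewrite compNr !compA fE -(compA g) vE.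
      by apply/eqP; rewrite -addr_eq0 compA; apply/eqP.
    exists v; rewrite compBl -!compA vE -[RHS]comp1m -e5 compDl -!compA p1u compNr.
    by rewrite addrC.
have [r hr] : {r : forall L, hom N L * hom L M -> hom K N | forall L ip, ses_set ip ->
    exists q : hom S L, is_cokernel (i2 ∘ io - i1 ∘ r L ip) q}.
  exists (fun L ip => sval (cid (ex L ip))) => L ip; exact: svalP (cid (ex L ip)).
exists K, r => L L' ip ip' /hr [q cq] /hr [q' cq'] e; rewrite e in cq.
by have [g gi _] := is_cokernel_unique cq cq'; exists g.
Qed.

End FiniteExtensions.

Section ComplexExponential.
Variable R : realType.

Lemma cexpD (x y : R[i]) : cexp (x + y) = cexp x * cexp y.
Proof.
case: x y => [a b] [c d]; rewrite /cexp /= expRD cosD sinD.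
by apply/eqP; rewrite eq_complex /=; apply/andP; split; apply/eqP; ring.
Qed.

End ComplexExponential.

(** * Structure constants of the coproduct *)

Section Coalgebra.
Variables (k : finFieldType) (A : linCat k).
Hypotheses (A_ab : abelian A) (A_ep : enough_projectives A) (A_her : gl_dim_le A 1).
Variables (R : realType) (logt : R[i]) (chi : IsoCP A -> IsoCP A -> R[i]).
Hypothesis chi_cond : chi_condition chi.
Local Notation C := R[i].
Implicit Types L M N X Y Z : IsoCP A.

Let C_ab := abelian_cplx A_ab.
Let C_ep := enough_projectives_cplx A_ab A_ep.

Local Notation Dc := (Delta_coef logt chi).
Local Notation tpow := (tpow logt).

Definition ses_count L M N : nat := ncard (@ses_set _ _ (cobj M) (cobj N) (cobj L)).

Definition E0_pair (M N : cplxCat A) := (~ H0_zero M -> H1_zero N) /\ (~ H1_zero M -> H0_zero N).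

Lemma tpowD x y : tpow (x + y) = tpow x * tpow y.
Proof. by rewrite /Defs.tpow mulrDl cexpD. Qed.

Lemma aut_card_neq0 M : aut_card R M != 0.
Proof.
rewrite pnatr_eq0 -lt0n; apply: (@ncard_gt0 _ _ (idm _)); first exact: vect_finite.
exact: is_iso_idm.
Qed.

Lemma ncard_hom_gt0 (X Y : cplxCat A) : (0 < ncard [set: hom X Y])%N.
Proof. by apply: (@ncard_gt0 _ _ 0) => //; exact: vect_finite. Qed.

(** Membership in E0 depends only on the end terms, so W is empty or all of Ext^1 with middle term
    [L]. Riedtmann's formula then absorbs |Hom| and |Aut L| into a count of short exact
    sequences. *)
Lemma Delta_coefE L M N : Dc L M N =
  tpow (chi M N) * `[< E0_pair (cobj M) (cobj N) >]%:R *
  ((ses_count L M N)%:R / (aut_card R M * aut_card R N)).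
Proof.
rewrite /Delta_coef -!mulrA; congr (_ * _).
have [h|h] := asboolP (E0_pair (cobj M) (cobj N)); last first.
  rewrite (_ : Wset _ _ _ = set0) ?ncard_set0 ?mul0r //.
  by apply/seteqP; split=> // xi [].
rewrite (_ : Wset _ _ _ = Ext1_mid (cobj L)); last by apply/seteqP; split=> [xi []|].
rewrite mul1r !mulrA; congr (_ / _); rewrite /hom_card /ses_count.
have hn : (ncard [set: hom (cobj M) (cobj N)])%:R != 0 :> C.
  by rewrite pnatr_eq0 -lt0n ncard_hom_gt0.
apply: (mulIf hn); rewrite mulrAC divfK // -!natrM.
by rewrite riedtmann.
Qed.

Lemma ses_countP L M N : ses_count L M N != 0%N -> exists i p,
  @short_exact _ _ (cobj N) (cobj L) (cobj M) i p.
Proof.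
rewrite -lt0n => h; have [[[i p] ip]|h0] := EM (exists ip, @ses_set _ _ (cobj M) (cobj N) (cobj L) ip).
  by exists i, p.
have s0 : @ses_set _ _ (cobj M) (cobj N) (cobj L) = set0.
  by apply/seteqP; split=> // ip ipS; case: h0; exists ip.
by move: h; rewrite /ses_count s0 ncard_set0.
Qed.

Lemma Delta_coef_neq0 L M N : Dc L M N != 0 -> exists i p,
  @short_exact _ _ (cobj N) (cobj L) (cobj M) i p.
Proof.
rewrite Delta_coefE => h; apply: ses_countP; apply: contraNneq h => ->.
by rewrite mul0r mulr0.
Qed.

Lemma Delta_coef_minimal L M N : minimal (repr L) -> Dc L M N != 0 ->
  minimal (repr M) /\ minimal (repr N).
Proof.
move=> Lm /Delta_coef_neq0 [i [p ip]].
exact: (minimal_short_exact A_ab A_ep A_her ip Lm).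
Qed.

Lemma iso_cobj X Y : iso (cobj X) (cobj Y) -> X = Y.
Proof. by move=> h; rewrite -[X]reprK -[Y]reprK; apply/iso_classP. Qed.

(** Extensions of complexes of projectives have projective components, so sums over [IsoCP A] see
    every filtration. *)
Lemma Iso_mid M N (Z : cplxCat A) (i : hom (cobj N) Z) (p : hom Z (cobj M)) :
  short_exact i p -> exists X, iso Z (cobj X).
Proof.
move=> ip; have [M1 M0] := cplxP_proj (repr M); have [N1 N0] := cplxP_proj (repr N).
have Zp := proj_mid A_ab ip M1 M0 N1 N0.
by exists (iso_class (CplxP Zp)); exact: iso_sym (cobj_iso (CplxP Zp)).
Qed.

Section Filtration.
Variables L M1 M2 M3 : IsoCP A.

Definition quotF X z := @quot_filtrations _ _ (cobj M1) (cobj M2) (cobj M3) (cobj L) (cobj X) z.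
Definition subF Y z := @sub_filtrations _ _ (cobj M1) (cobj M2) (cobj M3) (cobj L) (cobj Y) z.
Arguments quotF : clear implicits.
Arguments subF : clear implicits.
Definition good z := exists X q, quotF X z q.

Lemma good_sub z : good z <-> exists Y q, subF Y z q.
Proof.
split=> [[X [q /(filtrations_sub C_ab C_ep) [Z [q' h]]]]|
         [Y [q /(filtrations_quot C_ab C_ep) [Z [q' h]]]]].
  have [Y ZY] := Iso_mid h.1.1.
  by have [q2 h2] := sub_filtrations_transport ZY h; exists Y, q2.
have [X ZX] := Iso_mid h.1.2.
by have [q2 h2] := quot_filtrations_transport ZX h; exists X, q2.
Qed.


(** Group the pairs of sequences by their outer maps [z]. A good [z] occurs for one [X], with |Aut
    X| |Aut M2| filtrations, and the division leaves |Aut M2|. *)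
Lemma sum_quot_filtrations (s : seq (hom (cobj M3) (cobj L) * hom (cobj L) (cobj M1))) :
  uniq s -> (forall z, z \in s) ->
  \sum_(X \in [set: IsoCP A]) (ses_count L X M3 * ses_count X M1 M2)%:R / aut_card R X =
  aut_card R M2 * (\sum_(z <- s) `[< good z >])%:R.
Proof.
move=> us sT.
have cE X : (ses_count L X M3 * ses_count X M1 M2)%:R / aut_card R X =
    \sum_(z <- s) (ncard (quotF X z))%:R / aut_card R X.
  rewrite -mulr_suml -natr_sum; congr (_%:R / _).
  rewrite /ses_count -ncardX; try exact: vect_finite2.
  exact: (ncard_fibers (f := fun q => (q.1.1, q.2.2 ∘ q.1.2)) (vect_finite4 _) us).
under eq_fsbigr do rewrite cE.
have /choice [a ha] z : exists a, forall X, X <> a -> ncard (quotF X z) = 0%N.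
  have [[X0 [q0 h0]]|h] := EM (good z).
    exists X0 => X XX0; rewrite (_ : quotF X z = set0) ?ncard_set0 //.
    apply/seteqP; split=> // q h; apply: XX0; apply: iso_cobj.
    exact: quot_filtrations_iso h h0.
  (* No [X] contributes to this [z]; [M1] is an arbitrary value. *)
  exists M1 => X _; rewrite (_ : quotF X z = set0) ?ncard_set0 //.
  by apply/seteqP; split=> // q hq; apply: h; exists X, q.
rewrite (@fsum_exchange_single _ _ _ s _ a); last by move=> X z /ha ->; rewrite mul0r.
rewrite natr_sum mulr_sumr; apply: eq_bigr => z _.
rewrite (@fsum_single _ _ (a z)); last by move=> X /ha ->; rewrite mul0r.
have [[X [q h]]|h] := asboolP (good z); last first.
  rewrite (_ : quotF (a z) z = set0) ?ncard_set0 ?mul0r ?mulr0 //.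
  by apply/seteqP; split=> // q hq; apply: h; exists (a z), q.
have Xa : X = a z.
  apply: contrapT => /(ha z) /eqP; rewrite -leqn0 leqNgt => /negP; apply.
  by apply: ncard_gt0 h; exact: vect_finite4.
rewrite -Xa (quot_filtrations_card h) natrM mulr1 mulrC mulrA mulVf ?mul1r //.
exact: aut_card_neq0.
Qed.

Lemma sum_sub_filtrations (s : seq (hom (cobj M3) (cobj L) * hom (cobj L) (cobj M1))) :
  uniq s -> (forall z, z \in s) ->
  \sum_(Y \in [set: IsoCP A]) (ses_count Y M2 M3 * ses_count L M1 Y)%:R / aut_card R Y =
  aut_card R M2 * (\sum_(z <- s) `[< good z >])%:R.
Proof.
move=> us sT.
have cE Y : (ses_count Y M2 M3 * ses_count L M1 Y)%:R / aut_card R Y =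
    \sum_(z <- s) (ncard (subF Y z))%:R / aut_card R Y.
  rewrite -mulr_suml -natr_sum; congr (_%:R / _).
  rewrite /ses_count -ncardX; try exact: vect_finite2.
  exact: (ncard_fibers (f := fun q => (q.2.1 ∘ q.1.1, q.2.2)) (vect_finite4 _) us).
under eq_fsbigr do rewrite cE.
have /choice [a ha] z : exists a, forall Y, Y <> a -> ncard (subF Y z) = 0%N.
  have [[Y0 [q0 h0]]|h] := EM (exists Y q, subF Y z q).
    exists Y0 => Y YY0; rewrite (_ : subF Y z = set0) ?ncard_set0 //.
    apply/seteqP; split=> // q h; apply: YY0; apply: iso_cobj.
    exact: sub_filtrations_iso h h0.
  exists M1 => Y _; rewrite (_ : subF Y z = set0) ?ncard_set0 //.
  by apply/seteqP; split=> // q hq; apply: h; exists Y, q.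
rewrite (@fsum_exchange_single _ _ _ s _ a); last by move=> Y z /ha ->; rewrite mul0r.
rewrite natr_sum mulr_sumr; apply: eq_bigr => z _.
rewrite (@fsum_single _ _ (a z)); last by move=> Y /ha ->; rewrite mul0r.
have [/good_sub [Y [q h]]|h] := asboolP (good z); last first.
  rewrite (_ : subF (a z) z = set0) ?ncard_set0 ?mul0r ?mulr0 //.
  by apply/seteqP; split=> // q hq; apply/h/good_sub; exists (a z), q.
have Ya : Y = a z.
  apply: contrapT => /(ha z) /eqP; rewrite -leqn0 leqNgt => /negP; apply.
  by apply: ncard_gt0 h; exact: vect_finite4.
rewrite -Ya (sub_filtrations_card h) natrM mulr1 mulrC mulrA mulVf ?mul1r //.
exact: aut_card_neq0.
Qed.

End Filtration.


Lemma E0_pair_quot L M1 M2 M3 (i : hom (cobj M2) (cobj L)) (p : hom (cobj L) (cobj M1)) :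
  short_exact i p ->
  (E0_pair (cobj L) (cobj M3) /\ E0_pair (cobj M1) (cobj M2)) <->
  [/\ E0_pair (cobj M1) (cobj M2), E0_pair (cobj M1) (cobj M3) & E0_pair (cobj M2) (cobj M3)].
Proof.
move=> ip; split=> [[[a b] h12]|[h12 [a b] [c d]]].
  have [h0 h1] := inE0_mid A_ab A_ep ip h12.1 h12.2.
  split=> //; split=> h; [apply: a|apply: b|apply: a|apply: b].
  - by move=> /h0 [].
  - by move=> /h1 [].
  - by move=> /h0 [].
  - by move=> /h1 [].
have [h0 h1] := inE0_mid A_ab A_ep ip h12.1 h12.2.
split=> //; split=> h.
  have [x|/a //] := EM (H0_zero (cobj M1)); apply: c => y; apply: h; exact/h0.
have [x|/b //] := EM (H1_zero (cobj M1)); apply: d => y; apply: h; exact/h1.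
Qed.

Lemma E0_pair_sub L M1 M2 M3 (i : hom (cobj M3) (cobj L)) (p : hom (cobj L) (cobj M2)) :
  short_exact i p ->
  (E0_pair (cobj M1) (cobj L) /\ E0_pair (cobj M2) (cobj M3)) <->
  [/\ E0_pair (cobj M1) (cobj M2), E0_pair (cobj M1) (cobj M3) & E0_pair (cobj M2) (cobj M3)].
Proof.
move=> ip; split=> [[[a b] h12]|[[a b] [c d] h12]].
  have [h0 h1] := inE0_mid A_ab A_ep ip h12.1 h12.2.
  by split=> //; split=> h; [have /h1 [] := a h|have /h0 [] := b h|have /h1 [] := a h
    |have /h0 [] := b h].
have [h0 h1] := inE0_mid A_ab A_ep ip h12.1 h12.2.
by split=> //; split=> h; [apply/h1; split; [exact: c|exact: a]
  |apply/h0; split; [exact: d|exact: b]].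
Qed.

Lemma class_mid L M N (i : hom (cobj N) (cobj L)) (p : hom (cobj L) (cobj M)) :
  short_exact i p ->
  class0 (repr L) = class0 (repr M) + class0 (repr N) /\
  class1 (repr L) = class1 (repr M) + class1 (repr N).
Proof.
move=> /(short_exact_degreewise A_ab) [/K0_class_short_exact s1 /K0_class_short_exact s0].
by rewrite addrC [class1 (repr M) + _]addrC.
Qed.

Lemma biproduct_Iso M N : exists X i p, @short_exact _ _ (cobj N) (cobj X) (cobj M) i p.
Proof.
have [L MN] := cplxP_biproduct A_ab (repr M) (repr N).
exists (iso_class L); apply: biproduct_short_exact.
exact: biproduct_iso MN (iso_sym (cobj_iso L)).
Qed.

Lemma field_shuffle (F : fieldType) (t1 t2 b1 b2 f1 f2 u v w x : F) :
  t1 * b1 * (f1 * (x * w)) * (t2 * b2 * (f2 * (u * v))) =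
  t1 * t2 * (b1 * b2) * (u * v * w) * (f1 * f2 * x).
Proof. ring. Qed.

Lemma field_shuffle' (F : fieldType) (t1 t2 b1 b2 f1 f2 u v w x : F) :
  t1 * b1 * (f1 * (u * x)) * (t2 * b2 * (f2 * (v * w))) =
  t1 * t2 * (b1 * b2) * (u * v * w) * (f2 * f1 * x).
Proof. ring. Qed.

(** On the support of either sum the power of t and the E0 factor are the same for all middle terms.
    Both sides are thus [K] times sums that equal |Aut M2| times the number of good [z]. *)
Lemma Delta_coef_coassoc L M1 M2 M3 :
  \sum_(X \in [set: IsoCP A]) Dc L X M3 * Dc X M1 M2 =
  \sum_(Y \in [set: IsoCP A]) Dc L M1 Y * Dc Y M2 M3.
Proof.
(* [X0] and [Y0] fix a common exponent: [chiE] compares every [X] with [Y0] and every [Y] with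
   [X0]. *)
have [X0 [i0 [p0 s0]]] := biproduct_Iso M1 M2.
have [Y0 [j0 [q0 r0]]] := biproduct_Iso M2 M3.
have chiE X Y : (exists i p, @short_exact _ _ (cobj M2) (cobj X) (cobj M1) i p) ->
    (exists i p, @short_exact _ _ (cobj M3) (cobj Y) (cobj M2) i p) ->
    chi X M3 + chi M1 M2 = chi M1 Y + chi M2 M3.
  move=> [i [p /class_mid [c0 c1]]] [i' [p' /class_mid [c0' c1']]].
  by have := chi_cond c0 c1 c0' c1'; rewrite /iso_class !reprK.
pose th : C := `[< [/\ E0_pair (cobj M1) (cobj M2), E0_pair (cobj M1) (cobj M3)
  & E0_pair (cobj M2) (cobj M3)] >]%:R.
pose K : C := tpow (chi M1 Y0 + chi M2 M3) * th /
  (aut_card R M1 * aut_card R M2 * aut_card R M3).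
have lhs X : Dc L X M3 * Dc X M1 M2 =
    K * ((ses_count L X M3 * ses_count X M1 M2)%:R / aut_card R X).
  rewrite !Delta_coefE natrM /K !invfM.
  have [->|/ses_countP ex] := eqVneq (ses_count X M1 M2) 0%N; first by rewrite !(mulr0, mul0r).
  rewrite -(chiE X) //; last by exists j0, q0.
  rewrite tpowD /th; have [i [p ip]] := ex.
  have -> : `[< [/\ E0_pair (cobj M1) (cobj M2), E0_pair (cobj M1) (cobj M3)
      & E0_pair (cobj M2) (cobj M3)] >]%:R =
      `[< E0_pair (cobj X) (cobj M3) >]%:R * `[< E0_pair (cobj M1) (cobj M2) >]%:R :> C.
    rewrite -natrM mulnb -asbool_and; congr (nat_of_bool _)%:R; apply: asbool_equiv_eq.
    exact: iff_sym (E0_pair_quot _ ip).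
  exact: field_shuffle.
have rhs Y : Dc L M1 Y * Dc Y M2 M3 =
    K * ((ses_count Y M2 M3 * ses_count L M1 Y)%:R / aut_card R Y).
  rewrite !Delta_coefE natrM /K !invfM.
  have [->|/ses_countP ex] := eqVneq (ses_count Y M2 M3) 0%N; first by rewrite !(mulr0, mul0r).
  have -> : chi M1 Y0 + chi M2 M3 = chi M1 Y + chi M2 M3.
    by rewrite -(chiE X0 Y0) ?(chiE X0 Y) //; [exists i0, p0|exists i0, p0|exists j0, q0].
  rewrite tpowD /th; have [i [p ip]] := ex.
  have -> : `[< [/\ E0_pair (cobj M1) (cobj M2), E0_pair (cobj M1) (cobj M3)
      & E0_pair (cobj M2) (cobj M3)] >]%:R =
      `[< E0_pair (cobj M1) (cobj Y) >]%:R * `[< E0_pair (cobj M2) (cobj M3) >]%:R :> C.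
    rewrite -natrM mulnb -asbool_and; congr (nat_of_bool _)%:R; apply: asbool_equiv_eq.
    exact: iff_sym (E0_pair_sub _ ip).
  exact: field_shuffle'.
transitivity (K * \sum_(X \in [set: IsoCP A])
    (ses_count L X M3 * ses_count X M1 M2)%:R / aut_card R X).
  by rewrite mulr_fsumr; apply: eq_fsbigr => X _; exact: lhs.
transitivity (K * \sum_(Y \in [set: IsoCP A])
    (ses_count Y M2 M3 * ses_count L M1 Y)%:R / aut_card R Y); last first.
  by rewrite mulr_fsumr; apply: eq_fsbigr => Y _; exact: esym (rhs Y).
congr (_ * _).
have [s us sE] := finite_set_seq (@vect_finite2 k (hom (cobj M3) (cobj L)) (hom (cobj L) (cobj M1)) setT).
have sT z : z \in s by apply/sE.
by rewrite (sum_quot_filtrations _ us sT) (sum_sub_filtrations _ us sT).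
Qed.

Hypothesis chi_norm : chi_normalized logt chi.

(** The condition on chi for M = P = Q = Z and R = N reduces to chi(Z, Z) = chi(Z, N). *)
Lemma chi_zerol Z N : is_zero (cobj Z) -> tpow (chi Z N) = 1.
Proof.
move=> Z0; have [z1 z0] := (zero_degreewise _).1 Z0.
have c0 : class0 (repr Z) = 0 by exact: K0_class_zero.
have c1 : class1 (repr Z) = 0 by exact: K0_class_zero.
have := @chi_cond (repr Z) (repr N) (repr Z) (repr Z) (repr N).
rewrite c0 c1 !add0r /iso_class !reprK => /(_ erefl erefl erefl erefl) /addrI e.
 by rewrite -e; have := chi_norm Z0; rewrite /iso_class reprK.
Qed.

Lemma chi_zeror Z N : is_zero (cobj Z) -> tpow (chi N Z) = 1.
Proof.
move=> Z0; have [z1 z0] := (zero_degreewise _).1 Z0.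
have c0 : class0 (repr Z) = 0 by exact: K0_class_zero.
have c1 : class1 (repr Z) = 0 by exact: K0_class_zero.
have := @chi_cond (repr N) (repr Z) (repr N) (repr Z) (repr Z).
rewrite c0 c1 !addr0 /iso_class !reprK => /(_ erefl erefl erefl erefl) /addrI e.
by rewrite e; have := chi_norm Z0; rewrite /iso_class reprK.
Qed.

Lemma zero_acyclic (Z : cplxCat A) : is_zero Z -> acyclic Z.
Proof.
move=> /(zero_degreewise _).1 [/is_zeroE z1 /is_zeroE z0]; apply: (contractible_acyclic A_ab A_ep).
by exists 0, 0; rewrite !comp0m !compm0 !addr0 z1 z0.
Qed.

Lemma aut_card_zero Z : is_zero (cobj Z) -> aut_card R Z = 1.
Proof.
move=> /is_zeroE Z0; rewrite /aut_card (@ncard_unique _ _ (idm _)) //; first exact: is_iso_idm.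
by move=> f _; rewrite -[f]comp1m Z0 comp0m.
Qed.

(** A sequence with zero quotient is an isomorphism N -> L; for L = N there are |Aut N| of them,
    cancelling the denominator. *)
Lemma Delta_coef_zerol L Z N : is_zero (cobj Z) -> Dc L Z N = (L == N)%:R.
Proof.
move=> Z0; rewrite Delta_coefE (chi_zerol _ Z0) (aut_card_zero Z0) !mul1r.
have [a0 a1] := zero_acyclic Z0; rewrite asboolT ?mul1r; last by split=> /(_ _).
have [->|LN] := eqVneq L N; last first.
  suff -> : ses_count L Z N = 0%N by rewrite mul0r.
  apply/eqP/negPn/negP => /ses_countP [i [p ip]]; case/eqP: LN; apply: iso_cobj.
  apply: iso_sym; exists i; apply: (mono_epi_is_iso C_ab); first exact: is_kernel_mono ip.1.
  apply: epi0 => W u /(is_cokernel_desc ip.2) [v <-].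
  by rewrite ((Z0 _).1 v) comp0m.
suff -> : ses_count N Z N = ncard (@automorphisms _ _ (cobj N)) by rewrite divff //; exact: aut_card_neq0.
apply: (ncard_bij (r := fun (ip : hom (cobj N) (cobj N) * hom (cobj N) (cobj Z)) g => ip.1 = g)).
- exact: vect_finite2.
- exact: vect_finite.
- move=> [i p] [/= ki cp]; exists i; split=> //.
  apply: (mono_epi_is_iso C_ab); first exact: is_kernel_mono ki.
  by apply: epi0 => W u /(is_cokernel_desc cp) [v <-]; rewrite ((Z0 _).1 v) comp0m.
- move=> g gi; exists (g, 0); split=> // [|[i p] /= _ ->]; last first.
  by congr pair; exact: (Z0 _).2.
split=> /=; first apply: is_kernelI.
- exact: comp0m.
- exact: is_iso_mono.
- by move=> W u _; have [h [_ gh]] := gi; exists (h ∘ u); rewrite compA gh comp1m.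
apply: is_cokernelI; first exact: comp0m.
  by apply: epi0 => W u _; exact: (Z0 W).1.
by move=> W u ug; exists 0; rewrite comp0m (epi_eq0 (is_iso_epi gi) ug).
Qed.

Lemma Delta_coef_zeror L Z M : is_zero (cobj Z) -> Dc L M Z = (L == M)%:R.
Proof.
move=> Z0; rewrite Delta_coefE (chi_zeror _ Z0) (aut_card_zero Z0) mulr1 mul1r.
have [a0 a1] := zero_acyclic Z0; rewrite asboolT ?mul1r; last by split.
have [->|LM] := eqVneq L M; last first.
  suff -> : ses_count L M Z = 0%N by rewrite mul0r.
  apply/eqP/negPn/negP => /ses_countP [i [p ip]]; case/eqP: LM; apply: iso_cobj.
  exists p; apply: (mono_epi_is_iso C_ab); last exact: is_cokernel_epi ip.2.
  apply: mono0 => W u /(is_kernel_lift ip.1) [v <-].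
  by rewrite ((Z0 _).2 v) compm0.
suff -> : ses_count M M Z = ncard (@automorphisms _ _ (cobj M)) by rewrite divff //; exact: aut_card_neq0.
apply: (ncard_bij (r := fun (ip : hom (cobj Z) (cobj M) * hom (cobj M) (cobj M)) g => ip.2 = g)).
- exact: vect_finite2.
- exact: vect_finite.
- move=> [i p] [/= ki cp]; exists p; split=> //.
  apply: (mono_epi_is_iso C_ab); last exact: is_cokernel_epi cp.
  by apply: mono0 => W u /(is_kernel_lift ki) [v <-]; rewrite ((Z0 _).2 v) compm0.
- move=> g gi; exists (0, g); split=> // [|[i p] /= _ ->]; last first.
  by congr pair; exact: (Z0 _).1.
split=> /=; last apply: is_cokernelI.
- apply: is_kernelI; first exact: compm0.
    by apply: mono0 => W u _; exact: (Z0 W).2.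
  by move=> W u gu; exists 0; rewrite compm0 (mono_eq0 (is_iso_mono gi) gu).
- exact: compm0.
- exact: is_iso_epi.
- by move=> W u _; have [h [hg _]] := gi; exists (u ∘ h); rewrite -compA hg compm1.
Qed.

(** By [extension_mid_finite] the middle term is determined by an element of a finite Hom space.
    This underlies the continuity clause of topological coassociativity. *)
Lemma Delta_coef_finite M N : finite_set [set L | Dc L M N != 0].
Proof.
have [K [r hr]] := extension_mid_finite C_ab C_ep (cobj M) (cobj N).
have ex L : exists ip : hom (cobj N) (cobj L) * hom (cobj L) (cobj M),
    Dc L M N != 0 -> ses_set ip.
  have [_|/Delta_coef_neq0 [i [p ip]]] := eqVneq (Dc L M N) 0; last by exists (i, p).
  by exists (0, 0).
pose ip L := sval (cid (ex L)).
have hip L : Dc L M N != 0 -> ses_set (ip L) by exact: svalP (cid (ex L)).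
have ri : {in [set L | Dc L M N != 0] &, injective (fun L => r (cobj L) (ip L))}.
  move=> L L'; rewrite !inE /= => h h' e; apply: iso_cobj.
  exact: hr (hip _ h) (hip _ h') e.
by rewrite -(eq_finite_set (inj_card_eq ri)); exact: vect_finite.
Qed.

End Coalgebra.

(** * The coproduct in coordinates, coassociativity and counit *)

Section DeltaBasis.
Variables (k : finFieldType) (A : linCat k).
Hypotheses (A_ab : abelian A) (A_ep : enough_projectives A) (A_her : gl_dim_le A 1).
Variables (R : realType) (t logt : R[i]) (t_sqrt : t ^+ 2 = #|k|%:R).
Variables (DH : unitAlgType R[i]) (j : {linear Htw A R -> DH}).
Hypothesis DH_loc : ore_localization t j.
Variable chi : IsoCP A -> IsoCP A -> R[i].
Hypothesis chi_cond : chi_condition chi.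
Local Notation C := R[i].
Local Notation e := (DHbasis j).
Local Notation Dc := (Delta_coef logt chi).
Local Notation D := (Delta_basis j logt chi).
Implicit Types (b : DHindex A) (m n : minIso A).

Let eB : is_basis e := DHbasis_is_basis A_ab A_ep A_her t_sqrt DH_loc.

(* sum over m, n of c m n times [m] K_x K*_y ⊗ [n] K_x K*_y *)
Definition diag_tensor (c : minIso A -> minIso A -> C) (x y : K0 A) : ctensor2 C (DHindex A) :=
  fun p => if [&& p.1.1.2 == x, p.1.2 == y, p.2.1.2 == x & p.2.2 == y]
    then c p.1.1.1 p.2.1.1 else 0.

Lemma diag_tensorE c m n x y : diag_tensor c x y ((m, x, y), (n, x, y)) = c m n.
Proof. by rewrite /diag_tensor /= !eqxx. Qed.

Lemma diag_tensor_neq0 c x y p : diag_tensor c x y p != 0 ->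
  p = ((p.1.1.1, x, y), (p.2.1.1, x, y)).
Proof.
rewrite /diag_tensor; case: ifP => [|_]; last by rewrite eqxx.
by case: p => [[[m x1] y1] [[n x2] y2]] /= /and4P [/eqP -> /eqP -> /eqP -> /eqP ->].
Qed.

Lemma ctensor_mulr_diag c x y x' y' (z : DH) : (forall m, e (m, x, y) * z = e (m, x', y')) ->
  ctensor_mulr e (diag_tensor c x y) z z = diag_tensor c x' y'.
Proof.
move=> ez; apply/funext => p; rewrite /ctensor_mulr.
rewrite (@fsum_single _ _ ((p.1.1.1, x, y), (p.2.1.1, x, y))).
  rewrite diag_tensorE /pure_tensor /= !ez !coordE // /diag_tensor.
  case: p => [[[m x1] y1] [[n x2] y2]] /=; rewrite !xpair_eqE !eqxx /=.
  rewrite -natrM mulnb ![x' == _]eq_sym ![y' == _]eq_sym -andbA.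
  by case: ifP => _; rewrite ?mulr1 ?mulr0.
move=> q qp; have [->|/diag_tensor_neq0 qE] := eqVneq (diag_tensor c x y q) 0; first by rewrite mul0r.
rewrite qE /pure_tensor /= !ez !coordE //.
case: eqP => [p1|_]; last by rewrite mul0r mulr0.
case: eqP => [p2|_]; last by rewrite !mulr0.
by case: qp; rewrite qE -p1 -p2.
Qed.

Lemma Delta_E0_diag n : Delta_E0 j logt chi (val n) =
  diag_tensor (fun m m' => Dc (val n) (val m) (val m')) 0 0.
Proof.
have jE m : j << val m >> = e (m, 0, 0).
  by rewrite /DHbasis /= (Kelt0 A_ab A_ep A_her t_sqrt DH_loc)
    (Kselt0 A_ab A_ep A_her t_sqrt DH_loc) !mulr1.
have nm : minimal (repr (val n)) by apply/asboolP; exact: valP n.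
apply/funext => p; rewrite /Delta_E0 (@fsum_single _ _ (val p.1.1.1, val p.2.1.1)).
  rewrite /pure_tensor /= !jE !coordE // /diag_tensor.
  case: p => [[[m x1] y1] [[m' x2] y2]] /=; rewrite !xpair_eqE !eqxx /=.
  rewrite -natrM mulnb ![0 == _]eq_sym -andbA.
  by case: ifP => _; rewrite ?mulr1 ?mulr0.
move=> [M N] /= MNp; have [->|h] := eqVneq (Dc (val n) M N) 0; first by rewrite mul0r.
have [Mm Nm] := Delta_coef_minimal A_ab A_ep A_her nm h.
have Mm' : `[< minimal (repr M) >] by apply/asboolP.
have Nm' : `[< minimal (repr N) >] by apply/asboolP.
pose m : minIso A := exist (fun N : IsoCP A => `[< minimal (repr N) >]) M Mm'.
pose m' : minIso A := exist (fun N : IsoCP A => `[< minimal (repr N) >]) N Nm'.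
rewrite /pure_tensor /= -[M]/(val m) -[N]/(val m') !jE !coordE //.
case: eqP => [p1|_]; last by rewrite mul0r mulr0.
case: eqP => [p2|_]; last by rewrite !mulr0.
by case: MNp; rewrite -p1 -p2.
Qed.

Lemma Delta_basisE b :
  D b = diag_tensor (fun m m' => Dc (val b.1.1) (val m) (val m')) b.1.2 b.2.
Proof.
have K0E := Kelt0 A_ab A_ep A_her t_sqrt DH_loc.
have Ks0E := Kselt0 A_ab A_ep A_her t_sqrt DH_loc.
(* K_a is multiplied in while the K*-index is still 0, and K*_b afterwards, so no commutation scalar
   appears. *)
rewrite /Delta_basis Delta_E0_diag (@ctensor_mulr_diag _ 0 0 b.1.2 0); last first.
  by move=> m; rewrite /DHbasis /= K0E Ks0E !mulr1.
by apply: ctensor_mulr_diag => m; rewrite /DHbasis /= Ks0E mulr1.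
Qed.

Lemma Delta_linear a x y p : Delta j logt chi (a *: x + y) p =
  a * Delta j logt chi x p + Delta j logt chi y p.
Proof. exact: coord_sum_linear. Qed.

Lemma Delta_e b : Delta j logt chi (e b) = D b.
Proof. by apply/funext => p; exact: (coord_sum_basis eB (fun b => D b p)). Qed.

Lemma Delta_finite p : finite_set [set b | Delta j logt chi (e b) p != 0].
Proof.
have fin := Delta_coef_finite A_ab A_ep logt chi (val p.1.1.1) (val p.2.1.1).
pose f b := val b.1.1.
have fi : {in [set b | Delta j logt chi (e b) p != 0] &, injective f}.
  move=> b b'; rewrite !inE /= !Delta_e !Delta_basisE => /diag_tensor_neq0 pE.
  move=> /diag_tensor_neq0 pE' /val_inj bb.
  move: pE'; rewrite {1}pE => -[hx hy _ _].
  by case: b b' bb hx hy {pE} => [[n x] y] [[n' x'] y'] /= -> -> ->.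
rewrite -(eq_finite_set (inj_card_eq fi)); apply: sub_finite_set fin => L [b /=].
rewrite Delta_e Delta_basisE /diag_tensor; case: ifP => [_ h <-|_]; last by rewrite eqxx.
exact: h.
Qed.

(** Classes that are not minimal carry coefficient zero, so a sum over basis indices with fixed
    K-part extends to all of [IsoCP A], where [Delta_coef_coassoc] applies. *)
Lemma sum_minIso (x y : K0 A) (f : DHindex A -> C) (g : IsoCP A -> C) :
  (forall n, f (n, x, y) = g (val n)) ->
  (forall b, f b != 0 -> b = (b.1.1, x, y)) ->
  (forall X, g X != 0 -> minimal (repr X)) ->
  \sum_(b \in [set: DHindex A]) f b = \sum_(X \in [set: IsoCP A]) g X.
Proof.
move=> fg f0 g0; pose h n : DHindex A := (n, x, y).
rewrite -(@fsbig_widen _ _ _ _ (h @` setT)) //; last first.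
  move=> b /= [_ hb]; apply/eqP/negPn/negP => /f0 bE; apply: hb.
  by exists b.1.1; rewrite // bE.
rewrite fsbig_image; last by move=> n n' _ _ [].
rewrite -[RHS](@fsbig_widen _ _ _ _ ((val : minIso A -> _) @` setT)) //; last first.
  move=> X /= [_ hX]; apply/eqP/negPn/negP => /g0 Xm; apply: hX.
  by exists (exist (fun N : IsoCP A => `[< minimal (repr N) >]) X (asboolT Xm)).
rewrite fsbig_image; last by move=> n n' _ _; exact: val_inj.
by apply: eq_fsbigr => n _; exact: fg.
Qed.

Lemma Delta_basis_coassoc b p : tensor_l e (Delta j logt chi) (D b) p =
  tensor_r e (Delta j logt chi) (D b) p.
Proof.
rewrite /tensor_l /tensor_r; case: b p => [[n x] y] [[[[m1 x1] y1] [[m2 x2] y2]] [[m3 x3] y3]] /=.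
have nm : minimal (repr (val n)) by apply/asboolP; exact: valP n.
have neq0 (u v : C) : u * v != 0 -> u != 0 /\ v != 0.
  by rewrite mulf_eq0 negb_or => /andP.
(* Each application of Delta preserves the K-indices on both factors, so both sides vanish unless
   all three tensor factors carry those of the argument. *)
have [[ex1 ex2 ex3 [ey1 ey2 ey3]]|ne] :=
    EM [/\ x1 = x, x2 = x, x3 = x & [/\ y1 = y, y2 = y & y3 = y]]; last first.
  rewrite !fsbig1 // => b _; apply/eqP/negPn/negP => /neq0 [];
    rewrite Delta_e !Delta_basisE => /diag_tensor_neq0 /= e1 /diag_tensor_neq0 /= e2;
    apply: ne.
    by case: e2 => -> -> -> ->; case: e1 => bE -> ->; rewrite bE.
  by case: e2 => -> -> -> ->; case: e1 => -> -> bE; rewrite bE.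
rewrite {}ex1 {}ex2 {}ex3 {}ey1 {}ey2 {}ey3.
rewrite (@sum_minIso x y _ (fun X => Dc (val n) X (val m3) * Dc X (val m1) (val m2))).
- rewrite (@sum_minIso x y _ (fun Y => Dc (val n) (val m1) Y * Dc Y (val m2) (val m3))).
  + exact: Delta_coef_coassoc.
  + by move=> n'; rewrite Delta_e !Delta_basisE !diag_tensorE.
  + move=> b /neq0 []; rewrite Delta_basisE => /diag_tensor_neq0 /= e1 _.
    by case: e1 => {1}->.
  + by move=> Y /neq0 [/(Delta_coef_minimal A_ab A_ep A_her nm) []].
- by move=> n'; rewrite Delta_e !Delta_basisE !diag_tensorE.
- move=> b /neq0 []; rewrite Delta_basisE => /diag_tensor_neq0 /= e1 _.
  by case: e1 => {1}->.
- by move=> Y /neq0 [/(Delta_coef_minimal A_ab A_ep A_her nm) []].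
Qed.

Lemma fsum_contract (I J : choiceType) (r : seq J) (c : J -> C) (u : J -> I -> C) (v : I -> C) :
  finite_set [set i | v i != 0] ->
  \sum_(i \in [set: I]) (\sum_(a <- r) c a * u a i) * v i =
  \sum_(a <- r) c a * \sum_(i \in [set: I]) u a i * v i.
Proof.
move=> /finite_set_seq [s us Ss].
have s0 i : i \notin s -> v i = 0.
  by move=> is'; apply/eqP/negPn/negP => /Ss h; rewrite h in is'.
rewrite (fsum_seq us) => [|i /s0 ->]; last by rewrite mulr0.
under eq_bigr do rewrite mulr_suml.
rewrite exchange_big; apply: eq_bigr => a _ /=.
rewrite (fsum_seq us) => [|i /s0 ->]; last by rewrite mulr0.
by rewrite mulr_sumr; apply: eq_bigr => i _; rewrite mulrA.
Qed.

(** [x] is a finite combination of basis vectors, and [Delta_finite] makes each coefficient of the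
    extended maps a finite sum, so the identity may be checked on the basis. *)
Lemma Delta_coassociative : topological_coassociative e (Delta j logt chi).
Proof.
split=> // [||x]; [exact: Delta_linear|exact: Delta_finite|].
have [r ur cr] := coord_support eB x.
have DE q : Delta j logt chi x q = \sum_(b <- r) coord e x b * D b q.
  by rewrite -(coord_sumE (fun b => D b q) ur cr).
apply/funext => p.
transitivity (\sum_(b <- r) coord e x b * tensor_l e (Delta j logt chi) (D b) p).
  rewrite -fsum_contract; last exact: Delta_finite.
  by apply: eq_fsbigr => b _; rewrite DE.
under eq_bigr do rewrite Delta_basis_coassoc.
rewrite -fsum_contract; last exact: Delta_finite.
by apply: eq_fsbigr => b _; rewrite DE.
Qed.

Hypothesis chi_norm : chi_normalized logt chi.

Lemma counit_linear a x y : counit j (a *: x + y) = a * counit j x + counit j y.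
Proof. exact: coord_sum_linear. Qed.

Lemma counit_e b : counit j (e b) = counit_basis R b.
Proof. exact: coord_sum_basis. Qed.

Lemma minIso_zero : exists z : minIso A, is_zero (cobj (val z)).
Proof.
have [Z Z0] := ab_zero (abelian_cplx A_ab); have [Z1 Z2] := (zero_degreewise _).1 Z0.
pose Zp := CplxP (conj (zero_projective Z1) (zero_projective Z2)).
have z0 : is_zero (cobj (iso_class Zp)) by exact: is_zero_iso (iso_sym (cobj_iso Zp)) Z0.
have zm : minimal (repr (iso_class Zp)).
  move=> X [X' [i [_ [p [_ [pi1 _ _ _ _]]]]]] _.
  have p0 : p = 0 := (z0 X).1 p.
  by apply/is_zeroE; rewrite -pi1 p0 comp0m.
by exists (exist (fun N : IsoCP A => `[< minimal (repr N) >]) _ (asboolT zm)).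
Qed.

Lemma Delta_counital : topological_counit e (Delta j logt chi) (counit j).
Proof.
split=> [|x b]; first exact: counit_linear.
have [z z0] := minIso_zero.
(* The counit selects the zero complex, and the diagonal form of Delta forces the K-indices of [b];
   only this index contributes to either sum. *)
pose zb : DHindex A := (z, b.1.2, b.2).
have DE q : Delta j logt chi x q = \sum_(b \in [set: DHindex A]) coord e x b * D b q by [].
have zu n : is_zero (cobj (val n)) -> n = z.
  by move=> n0; apply/val_inj/iso_cobj; exact: zero_iso.
have D0 q q' : (q.1.2, q.2) <> (q'.1.2, q'.2) -> Delta j logt chi x (q, q') = 0.
  move=> qq; rewrite DE fsbig1 // => b' _; rewrite Delta_basisE /diag_tensor.
  case: ifP => [/and4P [/eqP /= e1 /eqP e2 /eqP e3 /eqP e4]|_]; last by rewrite mulr0.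
  by case: qq; rewrite e1 e2 e3 e4.
have c0 a : counit j (e a) != 0 -> a.1.1 = z.
  by rewrite counit_e /counit_basis; case: asboolP => [/zu //|_]; rewrite eqxx.
have cz : counit j (e zb) = 1 by rewrite counit_e /counit_basis asboolT.
have Dl : Delta j logt chi x (zb, b) = coord e x b.
  rewrite DE (@fsum_single _ _ b) => [|b' bb].
    rewrite Delta_basisE /diag_tensor /= !eqxx /= (Delta_coef_zerol A_ab A_ep chi_cond chi_norm) //.
    by rewrite eqxx mulr1.
  rewrite Delta_basisE /diag_tensor.
  case: ifP => [/and4P [/eqP /= e1 /eqP e2 _ _]|_]; last by rewrite mulr0.
  rewrite (Delta_coef_zerol A_ab A_ep chi_cond chi_norm) //.
  case: eqP => [/val_inj e3|_]; last by rewrite mulr0.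
  by case: bb; case: b' b e1 e2 e3 {zb D0 cz} => [[? ?] ?] [[? ?] ?] /= -> -> ->.
have Dr : Delta j logt chi x (b, zb) = coord e x b.
  rewrite DE (@fsum_single _ _ b) => [|b' bb].
    rewrite Delta_basisE /diag_tensor /= !eqxx /= (Delta_coef_zeror A_ab A_ep chi_cond chi_norm) //.
    by rewrite eqxx mulr1.
  rewrite Delta_basisE /diag_tensor.
  case: ifP => [/and4P [/eqP /= e1 /eqP e2 _ _]|_]; last by rewrite mulr0.
  rewrite (Delta_coef_zeror A_ab A_ep chi_cond chi_norm) //.
  case: eqP => [/val_inj e3|_]; last by rewrite mulr0.
  by case: bb; case: b' b e1 e2 e3 {zb D0 cz Dl} => [[? ?] ?] [[? ?] ?] /= -> -> ->.
have l0 a : a <> zb -> counit j (e a) * Delta j logt chi x (a, b) = 0.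
  move=> az; have [->|/c0 az1] := eqVneq (counit j (e a)) 0; first by rewrite mul0r.
  rewrite D0 ?mulr0 //= => -[a2 a3]; apply: az.
  by case: a az1 a2 a3 => [[? ?] ?] /= -> -> ->.
have r0 a : a <> zb -> Delta j logt chi x (b, a) * counit j (e a) = 0.
  move=> az; have [->|/c0 az1] := eqVneq (counit j (e a)) 0; first by rewrite mulr0.
  rewrite D0 ?mul0r //= => -[a2 a3]; apply: az.
  by case: a az1 a2 a3 => [[? ?] ?] /= -> <- <-.
split.
- apply: (sub_finite_set (B := [set zb])) => // a /= h.
  by apply: contrapT => /l0 e0; rewrite e0 eqxx in h.
- by rewrite (@fsum_single _ _ zb) // cz mul1r.
- apply: (sub_finite_set (B := [set zb])) => // a /= h.
  by apply: contrapT => /r0 e0; rewrite e0 eqxx in h.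
- by rewrite (@fsum_single _ _ zb) // cz mulr1.
Qed.

End DeltaBasis.

Theorem theorem3p18 (k : finFieldType) (A : linCat k)
  (A_abelian : abelian A)
  (A_small : essentially_small A)
  (A_gldim_fin : exists n, gl_dim_le A n)
  (A_proj : enough_projectives A)
  (A_hereditary : gl_dim_le A 1)
  (A_class : forall X : A, ~ is_zero X -> K0_class X <> 0)
  (R : realType) (t logt : R[i])
  (t_sqrt : t ^+ 2 = #|k|%:R) (t_log : cexp logt = t)
  (DH : unitAlgType R[i]) (j : {linear Htw A R -> DH})
  (DH_loc : ore_localization t j)
  (chi : IsoCP A -> IsoCP A -> R[i])
  (chi_cond : chi_condition chi) :
  topological_coassociative (DHbasis j) (Delta j logt chi) /\
  (chi_normalized logt chi ->
   topological_counit (DHbasis j) (Delta j logt chi) (counit j)).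
Proof.
split; first exact: (Delta_coassociative A_abelian A_proj A_hereditary logt t_sqrt DH_loc chi_cond).
exact: (Delta_counital A_abelian A_proj A_hereditary t_sqrt DH_loc chi_cond).
Qed.
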